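(* For all $\tau\in\mathbb{H}$ and $z\in\mathbb{C}$ with $\theta_1(z|\tau)\theta_2(z|\tau)\neq0$, writing $\theta_k=\theta_k(z|\tau)$, $\theta_1'=\theta_1'(z|\tau)$, $\vartheta_k=\vartheta_k(\tau)$, $\eta=\eta(\tau)$ and $\Lambda_0=\eta+\frac{\pi^2}{12}(\vartheta_3^4+\vartheta_4^4)$: $$\frac{\partial\theta_1}{\partial\tau}=\frac{-i}{4\pi}\frac{\theta_1'^2}{\theta_1}+\frac{i}{4}\pi\vartheta_3^2\vartheta_4^2\frac{\theta_2^2}{\theta_1}+\frac{i}{\pi}\Lambda_0\theta_1,$$ $$\frac{\partial\theta_2}{\partial\tau}=\frac{-i}{4\pi}\Big\{\frac{\theta_1'}{\theta_1}-\pi\vartheta_2^2\frac{\theta_3\theta_4}{\theta_1\theta_2}\Big\}^2\theta_2+\frac{i}{4}\pi\vartheta_3^2\vartheta_4^2\frac{\theta_1^2}{\theta_2}+\frac{i}{\pi}\Lambda_0\theta_2,$$ $$\frac{\partial\theta_3}{\partial\tau}=\frac{-i}{4\pi}\frac{\theta_1'^2}{\theta_1^2}\theta_3+\frac{i}{2}\vartheta_3^2\theta_1'\frac{\theta_2\theta_4}{\theta_1^2}-\frac{i}{4}\pi\vartheta_2^2\vartheta_3^2\frac{\theta_4^2}{\theta_1^2}\theta_3+\frac{i}{\pi}\Lambda_0\theta_3,$$ $$\frac{\partial\theta_4}{\partial\tau}=\frac{-i}{4\pi}\frac{\theta_1'^2}{\theta_1^2}\theta_4+\frac{i}{2}\vartheta_4^2\theta_1'\frac{\theta_2\theta_3}{\theta_1^2}-\frac{i}{4}\pi\vartheta_2^2\vartheta_4^2\frac{\theta_3^2}{\theta_1^2}\theta_4+\frac{i}{\pi}\Lambda_0\theta_4,$$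 $$\frac{\partial\theta_1'}{\partial\tau}=\frac{-i}{4\pi}\frac{\theta_1'^3}{\theta_1^2}+\frac{3i}{\pi}\Big\{\frac{\pi^2}{4}\vartheta_3^2\vartheta_4^2\frac{\theta_2^2}{\theta_1^2}+\Lambda_0\Big\}\theta_1'-\frac{i}{2}\pi^2\vartheta_2^2\vartheta_3^2\vartheta_4^2\frac{\theta_2\theta_3\theta_4}{\theta_1^2}.$$
   Context: $\mathbb{H}=\{\Im\tau>0\}$. $\theta_1(z|\tau)=2e^{\pi i\tau/4}\sum_{k\ge0}(-1)^ke^{(k^2+k)\pi i\tau}\sin((2k+1)\pi z)$, $\theta_2(z|\tau)=2e^{\pi i\tau/4}\sum_{k\ge0}e^{(k^2+k)\pi i\tau}\cos((2k+1)\pi z)$, $\theta_3(z|\tau)=1+2\sum_{k\ge1}e^{k^2\pi i\tau}\cos(2k\pi z)$, $\theta_4(z|\tau)=1+2\sum_{k\ge1}(-1)^ke^{k^2\pi i\tau}\cos(2k\pi z)$; $\theta_1'=\partial_z\theta_1$; $\vartheta_k(\tau)=\theta_k(0|\tau)$; $\eta(\tau)=2\pi^2\{\frac1{24}-\sum_{k\ge1}\frac{e^{2k\pi i\tau}}{(1-e^{2k\pi i\tau})^2}\}$. *)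

(* Defs.v *)
From Stdlib Require Import Reals ClassicalEpsilon.
From Coquelicot Require Import Coquelicot.

Local Open Scope C_scope.

Definition cexp (w : C) : C :=
  RtoC (exp (Re w)) * (RtoC (cos (Im w)) + Ci * RtoC (sin (Im w))).
Definition csin (w : C) : C := (cexp (Ci * w) - cexp (- (Ci * w))) / (2 * Ci).
Definition ccos (w : C) : C := (cexp (Ci * w) + cexp (- (Ci * w))) / 2.

Definition csum (a : nat -> C) : C :=
  (Series (fun n => Re (a n)), Series (fun n => Im (a n))).

Definition Cpi : C := RtoC PI.
Definition CN (k : nat) : C := RtoC (INR k).
Definition sgn (k : nat) : C := RtoC ((-1) ^ k)%R.

Definition theta1 (z tau : C) : C :=
  2 * cexp (Cpi * Ci * tau / 4) *
  csum (fun k => sgn k * cexp ((CN k * CN k + CN k) * Cpi * Ci * tau)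
                   * csin ((2 * CN k + 1) * Cpi * z)).
Definition theta2 (z tau : C) : C :=
  2 * cexp (Cpi * Ci * tau / 4) *
  csum (fun k => cexp ((CN k * CN k + CN k) * Cpi * Ci * tau)
                   * ccos ((2 * CN k + 1) * Cpi * z)).
(* sums over k >= 1, reindexed as k = n + 1 *)
Definition theta3 (z tau : C) : C :=
  1 + 2 * csum (fun n => cexp (CN (S n) * CN (S n) * Cpi * Ci * tau)
                          * ccos (2 * CN (S n) * Cpi * z)).
Definition theta4 (z tau : C) : C :=
  1 + 2 * csum (fun n => sgn (S n) * cexp (CN (S n) * CN (S n) * Cpi * Ci * tau)
                          * ccos (2 * CN (S n) * Cpi * z)).

(* Complex derivative (chosen classically; meaningful when it exists). *)
Definition CDerive (f : C -> C) (z : C) : C :=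
  epsilon (inhabits (RtoC 0)) (fun l => @is_derive C_AbsRing C_NormedModule f z l).

Definition theta1' (z tau : C) : C := CDerive (fun w => theta1 w tau) z.

Definition vtheta1 (tau : C) : C := theta1 0 tau.
Definition vtheta2 (tau : C) : C := theta2 0 tau.
Definition vtheta3 (tau : C) : C := theta3 0 tau.
Definition vtheta4 (tau : C) : C := theta4 0 tau.

Definition eta (tau : C) : C :=
  2 * Cpi * Cpi *
  (1 / 24 - csum (fun n => let e := cexp (2 * CN (S n) * Cpi * Ci * tau) in
                           e / ((1 - e) * (1 - e)))).

Definition Lambda0 (tau : C) : C :=
  eta tau + Cpi * Cpi / 12 * (vtheta3 tau ^ 4 + vtheta4 tau ^ 4).

(* Main.v *)
(** Each theta function is a sum of exponentials that satisfies the heat equation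
    [4 PI i d/dt = (d/dz)^2], so the claim is a system of identities between [z]-derivatives.
    They all come from one rearrangement of a double series: splitting the pairs of integers
    by the parity of their sum writes [theta_a (x + y | t) * theta_b (x - y | t)] as a
    combination of products of theta functions of [2 x] and [2 y] with parameter [2 t].
    Differentiating in [y] at [0] gives the Wronskians of [theta1] with the other thetas up to
    constants, and [theta1 theta1'' - theta1'^2] in terms of [theta1^2] and [theta2^2].  The
    constants follow from two facts.  Jacobi's formula [theta1'(0) = PI v2 v3 v4] holds because
    the quotient of its two sides is invariant under [t -> 2 t] and has limit [1] as the
    imaginary part of [t] grows.  The value of [theta1'''(0) / theta1'(0)] as a Lambert series is
    obtained as a limit of finite triple products, for which it is an exact recursion on the
    first and third moments of the coefficients. *)

Require Import Defs.
From Stdlib Require Import Reals Lra Lia ZArith List Permutation.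
From Stdlib Require Import Classical ClassicalEpsilon FunctionalExtensionality.
From Coquelicot Require Import Coquelicot.
Local Open Scope C_scope.

(** * Complex exponential, series and derivatives *)

(** No Liouville argument for elliptic functions and no infinite product is used: identities in [z]
    come from double series, and constants are found at [z = 0]. Splitting the products of [theta1]
    with [theta3] or [theta4] produces the characteristic [1/4], whose reflection is [3/4]. Hence
    one function [H] and its reflection carry both that product and the product of the two remaining
    thetas, which makes the Wronskian proportional to the latter. The second logarithmic derivatives
    contain two unknowns, the second derivatives at [0] of [theta3] and [theta2] with parameter
    [2 t]. They solve two linear equations: the square of Jacobi's formula, and the second
    derivative at [0] of the Wronskian identity for [theta1] and [theta2], where [eta] enters
    through [theta1'''(0)]. The coefficient [24] in front of the Lambert series has its origin in
    [(m + 2)^3 + (m - 2)^3 = 2 m^3 + 24 m]. *)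

Lemma cexp_add (u v : C) : cexp (u + v) = cexp u * cexp v.
Proof.
  destruct u as [a b], v as [c d]; unfold cexp; apply injective_projections; simpl;
    rewrite exp_plus, cos_plus, sin_plus; ring.
Qed.

Lemma cexp_0 : cexp 0 = 1.
Proof.
  unfold cexp; apply injective_projections; simpl; rewrite exp_0, cos_0, sin_0; ring.
Qed.

Lemma cexp_pair (x y : R) : cexp (x, y) = (exp x * cos y, exp x * sin y)%R.
Proof. unfold cexp; apply injective_projections; simpl; ring. Qed.

Lemma Cmod_cexp (w : C) : Cmod (cexp w) = exp (Re w).
Proof.
  destruct w as [x y]; rewrite cexp_pair; unfold Cmod; simpl.
  replace (_ + _)%R with (exp x * exp x * ((sin y)² + (cos y)²))%R
    by (unfold Rsqr; ring).
  rewrite sin2_cos2, Rmult_1_r. apply sqrt_square, Rlt_le, exp_pos.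
Qed.

Lemma cexp_neq_0 (w : C) : cexp w <> 0.
Proof. apply Cmod_gt_0; rewrite Cmod_cexp; apply exp_pos. Qed.

Lemma cexp_opp (w : C) : cexp (- w) * cexp w = 1.
Proof. rewrite <- cexp_add, <- cexp_0; f_equal; ring. Qed.

Lemma cexp_pow (w : C) (n : nat) : cexp w ^ n = cexp (CN n * w).
Proof.
  induction n as [|n IH].
  - unfold CN; simpl; rewrite <- cexp_0; f_equal; ring.
  - rewrite Cpow_S, IH, <- cexp_add; f_equal; unfold CN; rewrite S_INR, RtoC_plus; ring.
Qed.

Lemma cexp_PI : cexp (Cpi * Ci) = -1.
Proof.
  unfold Cpi; replace (RtoC PI * Ci) with ((0, PI)%R : C)
    by (apply injective_projections; simpl; ring).
  rewrite cexp_pair, exp_0, cos_PI, sin_PI; apply injective_projections; simpl; ring.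
Qed.

Lemma cexp_PI2 : cexp (Cpi * Ci / 2) = Ci.
Proof.
  unfold Cpi; replace (RtoC PI * Ci / 2) with ((0, PI / 2)%R : C)
    by (apply injective_projections; simpl; field).
  rewrite cexp_pair, exp_0, cos_PI2, sin_PI2; apply injective_projections; simpl; ring.
Qed.

(** The mean value theorem fails for plane curves, so it is applied to the real function obtained by
    projecting the curve on its total increment [(a, b)]. Bounding the projected velocity leaves one
    factor [Cmod (a, b)] to cancel. *)
Lemma curve_mean_value (gr gi dr di : R -> R) (M : R) :
  (forall t, is_derive gr t (dr t)) -> (forall t, is_derive gi t (di t)) ->
  (forall t, (0 <= t <= 1)%R -> (Cmod (dr t, di t) <= M)%R) ->
  (Cmod (gr 1 - gr 0, gi 1 - gi 0)%R <= M)%R.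
Proof.
  intros Hr Hi HM.
  set (a := (gr 1 - gr 0)%R); set (b := (gi 1 - gi 0)%R).
  destruct (MVT_gen (fun t => a * gr t + b * gi t)%R 0 1
              (fun t => a * dr t + b * di t)%R) as [c [Hc Heq]].
  - intros t _; apply (is_derive_plus (fun t => a * gr t)%R (fun t => b * gi t)%R); apply is_derive_scal; auto.
  - intros t _; apply continuity_pt_filterlim.
    apply (ex_derive_continuous (fun t => a * gr t + b * gi t)%R).
    exists (a * dr t + b * di t)%R.
    apply (is_derive_plus (fun t => a * gr t)%R (fun t => b * gi t)%R); apply is_derive_scal; auto.
  - rewrite Rmin_left, Rmax_right in Hc by lra.
    assert (Hsq : (Cmod (a, b) * Cmod (a, b) <= Cmod (a, b) * M)%R).
    { replace (Cmod (a, b) * Cmod (a, b))%R with (a * a + b * b)%R.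
      2:{ replace (Cmod (a, b) * Cmod (a, b))%R with (Cmod (a, b) ^ 2)%R by ring.
          rewrite Cmod2_alt; simpl; ring. }
      replace (a * a + b * b)%R with (a * dr c + b * di c)%R
        by (unfold a, b in *; lra).
      replace (a * dr c + b * di c)%R with (Re (Cconj (a, b) * (dr c, di c)))
        by (simpl; ring).
      eapply Rle_trans; [apply Rle_abs|].
      eapply Rle_trans; [apply re_le_Cmod|].
      rewrite Cmod_mult, Cmod_conj.
      apply Rmult_le_compat_l; [apply Cmod_ge_0|auto]. }
    destruct (Rle_lt_or_eq_dec 0 (Cmod (a, b)) (Cmod_ge_0 _)) as [H|H].
    + apply Rmult_le_reg_l with (Cmod (a, b)); auto.
    + rewrite <- H. eapply Rle_trans; [apply Cmod_ge_0|apply (HM c Hc)].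
Qed.

Lemma Re_le_Cmod (w : C) : (Re w <= Cmod w)%R.
Proof. eapply Rle_trans; [apply Rle_abs|apply re_le_Cmod]. Qed.

Lemma Cmod_cexp_le (w : C) : (Cmod (cexp w) <= exp (Cmod w))%R.
Proof.
  rewrite Cmod_cexp. destruct (Re_le_Cmod w) as [H|H].
  - now apply Rlt_le, exp_increasing.
  - now rewrite H; right.
Qed.

Lemma exp_le (x y : R) : (x <= y)%R -> (exp x <= exp y)%R.
Proof. intros [H|H]; [now apply Rlt_le, exp_increasing|now rewrite H; right]. Qed.

(** The curve is [cexp] along the segment from [0] to [h], with velocity [h * cexp (t h)]. *)
Lemma cexp_sub1_bound (h : C) : (Cmod (cexp h - 1) <= Cmod h * exp (Cmod h))%R.
Proof.
  destruct h as [x y].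
  replace (cexp (x, y) - 1) with
    ((exp (1 * x) * cos (1 * y) - exp (0 * x) * cos (0 * y),
      exp (1 * x) * sin (1 * y) - exp (0 * x) * sin (0 * y))%R : C).
  2:{ rewrite cexp_pair, !Rmult_1_l, !Rmult_0_l, exp_0, cos_0, sin_0.
      apply injective_projections; simpl; ring. }
  apply (curve_mean_value (fun t => exp (t * x) * cos (t * y))%R
           (fun t => exp (t * x) * sin (t * y))%R
           (fun t => x * exp (t * x) * cos (t * y) - y * exp (t * x) * sin (t * y))%R
           (fun t => x * exp (t * x) * sin (t * y) + y * exp (t * x) * cos (t * y))%R).
  - intros t; auto_derive; auto; ring.
  - intros t; auto_derive; auto; ring.
  - intros t Ht.
    match goal with |- (Cmod ?u <= _)%R =>
      replace u with ((x, y) * cexp (RtoC t * (x, y))) end.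
    2:{ replace (RtoC t * (x, y)) with ((t * x, t * y)%R : C)
          by (apply injective_projections; simpl; ring).
        rewrite cexp_pair; apply injective_projections; simpl; ring. }
    rewrite Cmod_mult; apply Rmult_le_compat_l; [apply Cmod_ge_0|].
    eapply Rle_trans; [apply Cmod_cexp_le|].
    apply exp_le; rewrite Cmod_mult, Cmod_R, Rabs_right by lra.
    pose proof (Cmod_ge_0 (x, y)); nra.
Qed.

(** On the same segment the velocity is now [h * (cexp (t h) - 1)], and the first-order bound
    supplies the second factor [Cmod h]. *)
Lemma cexp_sub2_bound (h : C) :
  (Cmod (cexp h - 1 - h) <= Cmod h ^ 2 * exp (Cmod h))%R.
Proof.
  destruct h as [x y].
  replace (cexp (x, y) - 1 - (x, y)) with
    (((exp (1 * x) * cos (1 * y) - 1 * x) - (exp (0 * x) * cos (0 * y) - 0 * x),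
      (exp (1 * x) * sin (1 * y) - 1 * y) - (exp (0 * x) * sin (0 * y) - 0 * y))%R : C).
  2:{ rewrite cexp_pair, !Rmult_1_l, !Rmult_0_l, exp_0, cos_0, sin_0.
      apply injective_projections; simpl; ring. }
  apply (curve_mean_value (fun t => exp (t * x) * cos (t * y) - t * x)%R
           (fun t => exp (t * x) * sin (t * y) - t * y)%R
           (fun t => x * exp (t * x) * cos (t * y) - y * exp (t * x) * sin (t * y) - x)%R
           (fun t => x * exp (t * x) * sin (t * y) + y * exp (t * x) * cos (t * y) - y)%R).
  - intros t; auto_derive; auto; ring.
  - intros t; auto_derive; auto; ring.
  - intros t Ht.
    match goal with |- (Cmod ?u <= _)%R =>
      replace u with ((x, y) * (cexp (RtoC t * (x, y)) - 1)) end.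
    2:{ replace (RtoC t * (x, y)) with ((t * x, t * y)%R : C)
          by (apply injective_projections; simpl; ring).
        rewrite cexp_pair; apply injective_projections; simpl; ring. }
    rewrite Cmod_mult; simpl; rewrite Rmult_1_r, Rmult_assoc.
    apply Rmult_le_compat_l; [apply Cmod_ge_0|].
    eapply Rle_trans; [apply cexp_sub1_bound|].
    assert (Hle : (Cmod (RtoC t * (x, y)) <= Cmod (x, y))%R).
    { rewrite Cmod_mult, Cmod_R, Rabs_right by lra.
      pose proof (Cmod_ge_0 (x, y)); nra. }
    apply Rmult_le_compat; auto using Cmod_ge_0, exp_le.
    apply Rlt_le, exp_pos.
Qed.

(** * Absolutely convergent complex series and limits of sequences *)

Definition csummable (a : nat -> C) : Prop := ex_series (fun n => Cmod (a n)).

Lemma ex_series_dominated (a b : nat -> R) :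
  (forall n, (0 <= a n <= b n)%R) -> ex_series b -> ex_series a.
Proof.
  intros H Hb; apply (@ex_series_le R_AbsRing R_CompleteNormedModule) with b; auto.
  intros n; destruct (H n); unfold norm; simpl; unfold abs; simpl.
  rewrite Rabs_right; lra.
Qed.

Lemma csummable_dominated (a : nat -> C) (b : nat -> R) :
  (forall n, (Cmod (a n) <= b n)%R) -> ex_series b -> csummable a.
Proof.
  intros H; apply ex_series_dominated; intros n; split; auto using Cmod_ge_0.
Qed.

Lemma im_le_Cmod (w : C) : (Rabs (Im w) <= Cmod w)%R.
Proof.
  eapply Rle_trans; [|apply Rmax_Cmod]; apply Rmax_r.
Qed.

Lemma csummable_Re (a : nat -> C) : csummable a -> ex_series (fun n => Re (a n)).
Proof.
  intros H; apply ex_series_Rabs; revert H; apply ex_series_dominated.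
  intros n; split; [apply Rabs_pos|apply re_le_Cmod].
Qed.

Lemma csummable_Im (a : nat -> C) : csummable a -> ex_series (fun n => Im (a n)).
Proof.
  intros H; apply ex_series_Rabs; revert H; apply ex_series_dominated.
  intros n; split; [apply Rabs_pos|apply im_le_Cmod].
Qed.

Lemma csummable_plus (a b : nat -> C) :
  csummable a -> csummable b -> csummable (fun n => a n + b n).
Proof.
  intros Ha Hb; eapply csummable_dominated with (fun n => Cmod (a n) + Cmod (b n))%R.
  - intros n; apply Cmod_triangle.
  - now apply @ex_series_plus.
Qed.

Lemma csummable_scal (c : C) (a : nat -> C) :
  csummable a -> csummable (fun n => c * a n).
Proof.
  intros Ha; apply csummable_dominated with (fun n => Cmod c * Cmod (a n))%R.
  - intros n; rewrite Cmod_mult; right; auto.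
  - now apply @ex_series_scal_l.
Qed.

Lemma csum_ext (a b : nat -> C) : (forall n, a n = b n) -> csum a = csum b.
Proof. intros H; f_equal; now apply functional_extensionality. Qed.

Lemma csum_plus (a b : nat -> C) : csummable a -> csummable b ->
  csum (fun n => a n + b n) = csum a + csum b.
Proof.
  intros Ha Hb; unfold csum; apply injective_projections; simpl.
  - rewrite <- Series_plus by now apply csummable_Re. now apply Series_ext.
  - rewrite <- Series_plus by now apply csummable_Im. now apply Series_ext.
Qed.

Lemma csum_scal (c : C) (a : nat -> C) : csummable a ->
  csum (fun n => c * a n) = c * csum a.
Proof.
  intros Ha; unfold csum; pose proof (csummable_Re _ Ha); pose proof (csummable_Im _ Ha).
  apply injective_projections; simpl.
  - rewrite <- !Series_scal_l, <- Series_minus by now apply @ex_series_scal_l.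
    now apply Series_ext.
  - rewrite <- !Series_scal_l, <- Series_plus by now apply @ex_series_scal_l.
    now apply Series_ext.
Qed.

(** The factor [2] comes from bounding the real and imaginary parts separately; only finiteness and
    smallness of such bounds matter later. *)
Lemma csum_bound (a : nat -> C) : csummable a ->
  (Cmod (csum a) <= 2 * Series (fun n => Cmod (a n)))%R.
Proof.
  intros Ha.
  assert (HR : (Rabs (Series (fun n => Re (a n))) <= Series (fun n => Cmod (a n)))%R).
  { eapply Rle_trans; [apply Series_Rabs|apply Series_le]; auto.
    - revert Ha; apply ex_series_dominated; intros n; split; [apply Rabs_pos|apply re_le_Cmod].
    - intros n; split; [apply Rabs_pos|apply re_le_Cmod]. }
  assert (HI : (Rabs (Series (fun n => Im (a n))) <= Series (fun n => Cmod (a n)))%R).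
  { eapply Rle_trans; [apply Series_Rabs|apply Series_le]; auto.
    - revert Ha; apply ex_series_dominated; intros n; split; [apply Rabs_pos|apply im_le_Cmod].
    - intros n; split; [apply Rabs_pos|apply im_le_Cmod]. }
  replace (csum a) with (RtoC (Re (csum a)) + Ci * RtoC (Im (csum a)))
    by (apply injective_projections; simpl; ring).
  eapply Rle_trans; [apply Cmod_triangle|].
  rewrite Cmod_mult, Cmod_Ci, !Cmod_R; simpl; lra.
Qed.

Lemma csummable_incr_1 (a : nat -> C) : csummable a -> csummable (fun n => a (S n)).
Proof.
  intros H; apply (ex_series_incr_1 (fun n => Cmod (a n)) : _ <-> _); exact H.
Qed.

Lemma csum_incr_1 (a : nat -> C) : csummable a ->
  csum a = a 0%nat + csum (fun n => a (S n)).
Proof.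
  intros Ha; unfold csum; apply injective_projections; simpl.
  - apply (Series_incr_1 (fun n => Re (a n))); now apply csummable_Re.
  - apply (Series_incr_1 (fun n => Im (a n))); now apply csummable_Im.
Qed.

Fixpoint fsum {I : Type} (f : I -> C) (l : list I) : C :=
  match l with nil => 0 | i :: l => f i + fsum f l end.

Lemma fsum_app {I : Type} (f : I -> C) (l l' : list I) :
  fsum f (l ++ l') = fsum f l + fsum f l'.
Proof. induction l as [|i l IH]; simpl; [ring|rewrite IH; ring]. Qed.

Lemma fsum_map {I J : Type} (f : J -> C) (g : I -> J) (l : list I) :
  fsum f (map g l) = fsum (fun i => f (g i)) l.
Proof. induction l as [|i l IH]; simpl; [auto|now rewrite IH]. Qed.

Lemma csum_split (n : nat) : forall a : nat -> C, csummable a ->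
  csum a = fsum a (seq 0 n) + csum (fun k => a (n + k)%nat).
Proof.
  induction n as [|n IH]; intros a Ha; simpl.
  - rewrite Cplus_0_l; now apply csum_ext.
  - rewrite csum_incr_1, (IH (fun k => a (S k))) by auto using csummable_incr_1.
    rewrite <- seq_shift, fsum_map; ring.
Qed.

Lemma series_tail (b : nat -> R) : ex_series b -> forall eps : R, (0 < eps)%R ->
  exists N, forall n, (N <= n)%nat -> (Rabs (Series (fun k => b (n + k)%nat)) < eps)%R.
Proof.
  intros Hb eps Heps.
  pose proof (Series_correct _ Hb) as H.
  apply is_lim_seq_Reals in H.
  destruct (H eps Heps) as [N HN]; exists (S N); intros n Hn.
  specialize (HN (pred n) ltac:(lia)).
  rewrite (Series_incr_n b n) in HN by (auto; lia).
  unfold R_dist in HN; rewrite sum_n_Reals in HN.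
  match type of HN with (Rabs ?u < _)%R =>
    replace u with (- Series (fun k => b (n + k)%nat))%R in HN by ring end.
  now rewrite Rabs_Ropp in HN.
Qed.

Definition clim (s : nat -> C) (l : C) : Prop :=
  forall eps : R, (0 < eps)%R -> exists N, forall n, (N <= n)%nat ->
    (Cmod (s n - l) < eps)%R.

Lemma clim_ext (s s' : nat -> C) (l : C) :
  (forall n, s n = s' n) -> clim s l -> clim s' l.
Proof. intros H Hs; now rewrite <- (functional_extensionality _ _ H). Qed.

Lemma clim_const (c : C) : clim (fun _ => c) c.
Proof.
  intros eps H; exists 0%nat; intros; replace (c - c) with (RtoC 0) by ring.
  now rewrite Cmod_0.
Qed.

Lemma clim_unique (s : nat -> C) (l l' : C) : clim s l -> clim s l' -> l = l'.
Proof.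
  intros H H'; apply Ceq_minus, Cmod_eq_0.
  destruct (Rle_lt_or_eq_dec 0 (Cmod (l - l')) (Cmod_ge_0 _)) as [Hp|Hp]; auto.
  destruct (H (Cmod (l - l') / 2)%R ltac:(lra)) as [N HN].
  destruct (H' (Cmod (l - l') / 2)%R ltac:(lra)) as [N' HN'].
  specialize (HN (N + N')%nat ltac:(lia)); specialize (HN' (N + N')%nat ltac:(lia)).
  pose proof (Cmod_triangle (- (s (N + N')%nat - l)) (s (N + N')%nat - l')) as Ht.
  rewrite Cmod_opp in Ht.
  replace (- (s (N + N')%nat - l) + (s (N + N')%nat - l')) with (l - l') in Ht by ring.
  lra.
Qed.

Lemma clim_plus (s s' : nat -> C) (l l' : C) :
  clim s l -> clim s' l' -> clim (fun n => s n + s' n) (l + l').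
Proof.
  intros H H' eps Heps.
  destruct (H (eps / 2)%R ltac:(lra)) as [N HN].
  destruct (H' (eps / 2)%R ltac:(lra)) as [N' HN'].
  exists (N + N')%nat; intros n Hn.
  specialize (HN n ltac:(lia)); specialize (HN' n ltac:(lia)).
  pose proof (Cmod_triangle (s n - l) (s' n - l')) as Ht.
  replace (s n - l + (s' n - l')) with (s n + s' n - (l + l')) in Ht by ring. lra.
Qed.

Lemma clim_mult (s s' : nat -> C) (l l' : C) :
  clim s l -> clim s' l' -> clim (fun n => s n * s' n) (l * l').
Proof.
  intros H H' eps Heps.
  set (A := (Cmod l + 1)%R); set (B := (Cmod l' + 1)%R).
  assert (HA : (1 <= A)%R) by (unfold A; pose proof (Cmod_ge_0 l); lra).
  assert (HB : (1 <= B)%R) by (unfold B; pose proof (Cmod_ge_0 l'); lra).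
  set (e := Rmin 1 (eps / (A + B))).
  assert (Hq : (0 < eps / (A + B))%R) by (apply Rdiv_lt_0_compat; lra).
  assert (He : (0 < e)%R) by (unfold e; apply Rmin_pos; lra).
  assert (He1 : (e <= 1)%R) by apply Rmin_l.
  assert (He2 : (e * (A + B) <= eps)%R).
  { apply Rle_trans with (eps / (A + B) * (A + B))%R.
    - apply Rmult_le_compat_r; [lra|apply Rmin_r].
    - right; field; lra. }
  destruct (H e He) as [N HN]; destruct (H' e He) as [N' HN'].
  exists (N + N')%nat; intros n Hn.
  specialize (HN n ltac:(lia)); specialize (HN' n ltac:(lia)).
  replace (s n * s' n - l * l') with
    ((s n - l) * (s' n - l') + ((s n - l) * l' + l * (s' n - l'))) by ring.
  eapply Rle_lt_trans; [apply Cmod_triangle|].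
  eapply Rle_lt_trans; [apply Rplus_le_compat_l, Cmod_triangle|].
  rewrite !Cmod_mult; unfold A, B in *.
  pose proof (Cmod_ge_0 (s n - l)); pose proof (Cmod_ge_0 (s' n - l'));
    pose proof (Cmod_ge_0 l); pose proof (Cmod_ge_0 l').
  nra.
Qed.

Lemma clim_fsum {I : Type} (a : nat -> I -> C) (b : I -> C) (l : list I) :
  (forall i, clim (fun n => a n i) (b i)) ->
  clim (fun n => fsum (a n) l) (fsum b l).
Proof.
  intros H; induction l as [|i l IH]; simpl; [apply clim_const|].
  now apply clim_plus.
Qed.

Lemma clim_bound (s : nat -> C) (l : C) (B : R) :
  clim s l -> (forall n, (Cmod (s n) <= B)%R) -> (Cmod l <= B)%R.
Proof.
  intros H HB; apply Rnot_lt_le; intros Hlt.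
  destruct (H (Cmod l - B)%R ltac:(lra)) as [N HN]; specialize (HN N (le_n _)).
  specialize (HB N); pose proof (Cmod_triangle (- (s N - l)) (s N)) as Ht.
  rewrite Cmod_opp in Ht; replace (- (s N - l) + s N) with l in Ht by ring. lra.
Qed.

Lemma clim_csum (a : nat -> C) : csummable a ->
  clim (fun n => fsum a (seq 0 n)) (csum a).
Proof.
  intros Ha eps Heps; destruct (series_tail _ Ha (eps / 2)%R ltac:(lra)) as [N HN].
  exists N; intros n Hn; specialize (HN n Hn).
  rewrite (csum_split n a Ha).
  replace (_ - _) with (- csum (fun k => a (n + k)%nat)) by ring.
  rewrite Cmod_opp; eapply Rle_lt_trans; [apply csum_bound|].
  - apply (ex_series_incr_n (fun k => Cmod (a k)) n : _ <-> _); exact Ha.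
  - pose proof (Rle_abs (Series (fun k => Cmod (a (n + k)%nat)))); lra.
Qed.

(** Tannery's theorem. It serves both for letting the imaginary part of [t] grow and for the limit
    of the finite triple products. *)
Lemma clim_csum_dominated (a : nat -> nat -> C) (b : nat -> C) (B : nat -> R) :
  (forall n k, (Cmod (a n k) <= B k)%R) -> ex_series B ->
  (forall k, clim (fun n => a n k) (b k)) ->
  clim (fun n => csum (a n)) (csum b).
Proof.
  intros HB HsB Hlim eps Heps.
  assert (Hb : forall k, (Cmod (b k) <= B k)%R).
  { intros k; apply (clim_bound (fun n => a n k)); auto. }
  assert (Htail : forall (u : nat -> C) K, (forall k, (Cmod (u k) <= B k)%R) ->
            (Cmod (csum (fun k => u (K + k)%nat)) <= 2 * Series (fun k => B (K + k)%nat))%R).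
  { intros u K Hu.
    assert (HBK : ex_series (fun k => B (K + k)%nat))
      by (apply (ex_series_incr_n B K : _ <-> _); exact HsB).
    eapply Rle_trans; [apply csum_bound|].
    - now apply csummable_dominated with (fun k => B (K + k)%nat).
    - apply Rmult_le_compat_l; [lra|]; apply Series_le; auto.
      intros k; split; auto using Cmod_ge_0. }
  (* Each of the two tails is at most twice the tail of [B], hence below [eps / 4]; the finite head
     gets another [eps / 4]. *)
  destruct (series_tail _ HsB (eps / 8)%R ltac:(lra)) as [K HK].
  specialize (HK K (le_n _)).
  pose proof (Rle_abs (Series (fun k => B (K + k)%nat))) as Habs.
  destruct (clim_fsum a b (seq 0 K) Hlim (eps / 4)%R ltac:(lra)) as [N HN].
  exists N; intros n Hn; specialize (HN n Hn).
  rewrite (csum_split K (a n)), (csum_split K b)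
    by (eapply csummable_dominated; eauto).
  pose proof (Htail (a n) K (HB n)) as H1; pose proof (Htail b K Hb) as H2.
  set (u := csum (fun k => a n (K + k)%nat)) in *; set (v := csum (fun k => b (K + k)%nat)) in *.
  set (w := fsum (a n) (seq 0 K)) in *; set (x := fsum b (seq 0 K)) in *.
  replace (w + u - (x + v)) with ((w - x) + (u + - v)) by ring.
  eapply Rle_lt_trans; [apply Cmod_triangle|].
  eapply Rle_lt_trans; [apply Rplus_le_compat_l, Cmod_triangle|].
  rewrite Cmod_opp; lra.
Qed.

(** An explicit form that mediates between two module structures on [C]: the theorem uses
    [C_NormedModule], while the product and chain rules are stated for
    [AbsRing_NormedModule C_AbsRing]. *)
Definition cder (f : C -> C) (z l : C) : Prop :=
  forall eps : R, (0 < eps)%R -> exists delta : R, (0 < delta)%R /\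
    forall h, (Cmod h < delta)%R -> (Cmod (f (z + h)%C - f z - l * h) <= eps * Cmod h)%R.

Lemma Cplus_minus_cancel (z y : C) : z + (y - z) = y.
Proof. ring. Qed.

Lemma cder_is_derive (f : C -> C) (z l : C) :
  cder f z l -> @is_derive C_AbsRing C_NormedModule f z l.
Proof.
  intros H; split; [apply @is_linear_scal_l|].
  intros x Hx eps.
  pose proof (@is_filter_lim_locally_unique C_AbsRing (AbsRing_NormedModule C_AbsRing) _ _ Hx); subst x.
  destruct (H eps (cond_pos eps)) as [d [Hd Hh]].
  exists (mkposreal d Hd); intros y Hy.
  specialize (Hh (y - z) Hy).
  rewrite Cplus_minus_cancel in Hh.
  rewrite (Cmult_comm l) in Hh; exact Hh.
Qed.

Lemma cder_iff (f : C -> C) (z l : C) :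
  cder f z l <-> @is_derive C_AbsRing (AbsRing_NormedModule C_AbsRing) f z l.
Proof.
  split; intros H.
  - split; [apply @is_linear_scal_l|].
    intros x Hx eps.
    pose proof (@is_filter_lim_locally_unique C_AbsRing (AbsRing_NormedModule C_AbsRing) _ _ Hx); subst x.
    destruct (H eps (cond_pos eps)) as [d [Hd Hh]].
    exists (mkposreal d Hd); intros y Hy.
    specialize (Hh (y - z) Hy).
    rewrite Cplus_minus_cancel in Hh.
    rewrite (Cmult_comm l) in Hh; exact Hh.
  - intros eps Heps; destruct H as [_ H].
    specialize (H z (fun P HP => HP) (mkposreal eps Heps)).
    destruct H as [d Hd]; exists d; split; [apply cond_pos|].
    intros h Hh; specialize (Hd (z + h)).
    assert (Hb : @ball (AbsRing_NormedModule C_AbsRing) z d (z + h)).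
    { change (Cmod (z + h - z) < d)%R; now replace (z + h - z) with h by ring. }
    specialize (Hd Hb).
    change (Cmod (f (z + h)%C - f z - (z + h - z) * l) <= eps * Cmod (z + h - z))%R in Hd.
    replace (z + h - z) with h in Hd by ring.
    now rewrite (Cmult_comm l).
Qed.

Lemma cder_unique (f : C -> C) (z l l' : C) : cder f z l -> cder f z l' -> l = l'.
Proof.
  intros H H'.
  now rewrite <- (is_C_derive_unique f z l), <- (is_C_derive_unique f z l')
    by now apply cder_is_derive.
Qed.

Lemma CDerive_cder (f : C -> C) (z l : C) : cder f z l -> CDerive f z = l.
Proof.
  intros H; unfold CDerive.
  assert (He : @is_derive C_AbsRing C_NormedModule f z
    (epsilon (inhabits (RtoC 0)) (fun l => @is_derive C_AbsRing C_NormedModule f z l))).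
  { apply epsilon_spec; exists l; now apply cder_is_derive. }
  apply cder_is_derive in H.
  now rewrite <- (is_C_derive_unique _ _ _ H), <- (is_C_derive_unique _ _ _ He) at 1.
Qed.

Lemma cder_local (f g : C -> C) (z l : C) (delta : R) : (0 < delta)%R ->
  (forall h, (Cmod h < delta)%R -> f (z + h) = g (z + h)) ->
  cder f z l -> cder g z l.
Proof.
  intros Hd He H eps Heps; destruct (H eps Heps) as [d [Hd' Hh]].
  exists (Rmin d delta); split; [now apply Rmin_pos|]; intros h Hlt.
  rewrite <- He by (eapply Rlt_le_trans; [exact Hlt|apply Rmin_r]).
  replace (g z) with (f z).
  - apply Hh; eapply Rlt_le_trans; [exact Hlt|apply Rmin_l].
  - rewrite <- (Cplus_0_r z); apply He; now rewrite Cmod_0.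
Qed.

Lemma cder_ext (f g : C -> C) (z l : C) :
  (forall w, f w = g w) -> cder f z l -> cder g z l.
Proof. intros H; now rewrite (functional_extensionality _ _ H). Qed.

Lemma cder_const (c z : C) : cder (fun _ => c) z 0.
Proof. apply cder_iff; apply @is_derive_const. Qed.

Lemma cder_plus (f g : C -> C) (z l m : C) :
  cder f z l -> cder g z m -> cder (fun w => f w + g w) z (l + m).
Proof. rewrite !cder_iff; apply @is_derive_plus. Qed.

Lemma cder_mult (f g : C -> C) (z l m : C) :
  cder f z l -> cder g z m -> cder (fun w => f w * g w) z (l * g z + f z * m).
Proof.
  rewrite !cder_iff; intros Hf Hg; apply (@is_derive_mult C_AbsRing f g z l m); auto.
  intros; apply Cmult_comm.
Qed.

Lemma cder_affine (f : C -> C) (c d z l : C) :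
  cder f (c * z + d) l -> cder (fun w => f (c * w + d)) z (c * l).
Proof.
  rewrite !cder_iff; intros H.
  apply (@is_derive_comp C_AbsRing (AbsRing_NormedModule C_AbsRing) f (fun w => c * w + d) z l c); auto.
  apply cder_iff; intros eps Heps; exists 1%R; split; [lra|]; intros h _.
  replace (c * (z + h) + d - (c * z + d) - c * h) with (RtoC 0) by ring.
  rewrite Cmod_0; apply Rmult_le_pos; [lra|apply Cmod_ge_0].
Qed.

(** For exponential terms the error of the linear approximation is explicit, and [cexp_sub2_bound]
    makes it at most [Cmod h ^ 2] times a summable sequence. The whole error is thus quadratic in
    [h], without any uniform convergence of derivatives. Terms of theta series are exponential both
    in [z] and in [t], so one lemma covers both derivatives. *)
Lemma cder_csum (F : nat -> C -> C) (lam : nat -> C) (z : C) (delta : R) :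
  (0 < delta)%R ->
  (forall n h, F n (z + h) = F n z * cexp (lam n * h)) ->
  csummable (fun n => F n z) ->
  ex_series (fun n => Cmod (F n z) * (Cmod (lam n) ^ 2 * exp (Cmod (lam n) * delta)))%R ->
  cder (fun w => csum (fun n => F n w)) z (csum (fun n => lam n * F n z)).
Proof.
  intros Hd HF H0 H2.
  (* Since [y <= 1 + y ^ 2], the differentiated series is dominated by the sum of the two series
     assumed convergent. *)
  assert (H1 : csummable (fun n => lam n * F n z)).
  { eapply csummable_dominated; [|exact (@ex_series_plus R_AbsRing R_NormedModule _ _ H0 H2)].
    intros n; unfold plus; simpl; rewrite Cmod_mult.
    pose proof (Cmod_ge_0 (F n z)); pose proof (Cmod_ge_0 (lam n)).
    assert (1 <= exp (Cmod (lam n) * delta))%R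
      by (rewrite <- exp_0; apply exp_le, Rmult_le_pos; lra).
    rewrite Rmult_1_r.
    assert (Cmod (lam n) <= 1 + Cmod (lam n) * Cmod (lam n) * exp (Cmod (lam n) * delta))%R.
    { pose proof (Rle_0_sqr (Cmod (lam n) - 1)) as Hs; unfold Rsqr in Hs.
      pose proof (Rmult_le_pos _ _ H1 H1); nra. }
    nra. }
  set (K := (2 * Series (fun n => Cmod (F n z) * (Cmod (lam n) ^ 2 * exp (Cmod (lam n) * delta))))%R).
  assert (HK : (0 <= K)%R).
  { unfold K; apply Rmult_le_pos; [lra|].
    rewrite <- (Rmult_0_l (Series (fun n => Cmod (F n z) * (Cmod (lam n) ^ 2 * exp (Cmod (lam n) * delta)))))%R.
    rewrite <- Series_scal_l; apply Series_le; auto; intros n.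
    assert (0 <= Cmod (F n z) * (Cmod (lam n) ^ 2 * exp (Cmod (lam n) * delta)))%R; [|lra].
    apply Rmult_le_pos; [apply Cmod_ge_0|].
    apply Rmult_le_pos; [apply pow_le, Cmod_ge_0|apply Rlt_le, exp_pos]. }
  intros eps Heps.
  assert (Hq : (0 < eps / (K + 1))%R) by (apply Rdiv_lt_0_compat; lra).
  exists (Rmin delta (eps / (K + 1))); split; [now apply Rmin_pos|]; intros h Hh.
  assert (Hh1 : (Cmod h < delta)%R) by (eapply Rlt_le_trans; [exact Hh|apply Rmin_l]).
  assert (Hh2 : (Cmod h < eps / (K + 1))%R) by (eapply Rlt_le_trans; [exact Hh|apply Rmin_r]).
  pose proof (Cmod_ge_0 h) as Hh0.
  set (G := fun n => F n z * (cexp (lam n * h) - 1 - lam n * h)).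
  assert (HG : forall n, (Cmod (G n) <= Cmod h ^ 2 *
                 (Cmod (F n z) * (Cmod (lam n) ^ 2 * exp (Cmod (lam n) * delta))))%R).
  { intros n; unfold G; rewrite Cmod_mult.
    apply Rle_trans with (Cmod (F n z) * (Cmod (lam n * h) ^ 2 * exp (Cmod (lam n * h))))%R.
    - apply Rmult_le_compat_l; [apply Cmod_ge_0|apply cexp_sub2_bound].
    - rewrite Cmod_mult.
      assert (exp (Cmod (lam n) * Cmod h) <= exp (Cmod (lam n) * delta))%R.
      { apply exp_le, Rmult_le_compat_l; [apply Cmod_ge_0|lra]. }
      apply Rle_trans with (Cmod (F n z) * ((Cmod (lam n) * Cmod h) ^ 2 * exp (Cmod (lam n) * delta)))%R.
      + apply Rmult_le_compat_l; [apply Cmod_ge_0|].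
        apply Rmult_le_compat_l; auto; apply pow_le, Rmult_le_pos; auto using Cmod_ge_0.
      + right; ring. }
  assert (HsG : csummable G).
  { eapply csummable_dominated; [exact HG|]; now apply @ex_series_scal_l. }
  replace (csum (fun n => F n (z + h))) with
    (csum (fun n => F n z) + (h * csum (fun n => lam n * F n z) + csum G)).
  2:{ rewrite <- csum_scal, <- !csum_plus by auto using csummable_plus, csummable_scal.
      apply csum_ext; intros n; rewrite HF; unfold G; ring. }
  replace (_ - _ - _) with (csum G) by ring.
  eapply Rle_trans; [now apply csum_bound|].
  apply Rle_trans with (Cmod h * (Cmod h * K))%R.
  - replace (Cmod h * (Cmod h * K))%R with (2 * Series (fun n => Cmod h ^ 2 *
                 (Cmod (F n z) * (Cmod (lam n) ^ 2 * exp (Cmod (lam n) * delta)))))%R.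
    + apply Rmult_le_compat_l; [lra|]; apply Series_le; [|now apply @ex_series_scal_l].
      intros n; split; auto using Cmod_ge_0.
    + unfold K; rewrite Series_scal_l; ring.
  - rewrite (Rmult_comm eps); apply Rmult_le_compat_l; auto.
    apply Rle_trans with (eps / (K + 1) * (K + 1))%R; [nra|right; field; lra].
Qed.

(** * Unordered sums *)

Fixpoint rsum {I : Type} (g : I -> R) (l : list I) : R :=
  match l with nil => 0%R | i :: l => (g i + rsum g l)%R end.

Lemma rsum_app {I : Type} (g : I -> R) (l l' : list I) :
  rsum g (l ++ l') = (rsum g l + rsum g l')%R.
Proof. induction l as [|i l IH]; simpl; [ring|rewrite IH; ring]. Qed.

Lemma rsum_map {I J : Type} (g : J -> R) (h : I -> J) (l : list I) :
  rsum g (map h l) = rsum (fun i => g (h i)) l.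
Proof. induction l as [|i l IH]; simpl; [auto|now rewrite IH]. Qed.

Lemma rsum_perm {I : Type} (g : I -> R) (l l' : list I) :
  Permutation l l' -> rsum g l = rsum g l'.
Proof. induction 1; simpl; try lra. Qed.

Lemma fsum_perm {I : Type} (f : I -> C) (l l' : list I) :
  Permutation l l' -> fsum f l = fsum f l'.
Proof.
  induction 1 as [|x l l' H IH|x y l|l l' l'' H IH H' IH']; simpl; auto.
  - now rewrite IH.
  - ring.
  - now rewrite IH.
Qed.

Lemma rsum_nonneg {I : Type} (g : I -> R) (l : list I) :
  (forall i, (0 <= g i)%R) -> (0 <= rsum g l)%R.
Proof. intros H; induction l as [|i l IH]; simpl; [lra|specialize (H i); lra]. Qed.

Lemma fsum_le_rsum {I : Type} (f : I -> C) (l : list I) :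
  (Cmod (fsum f l) <= rsum (fun i => Cmod (f i)) l)%R.
Proof.
  induction l as [|i l IH]; simpl; [rewrite Cmod_0; lra|].
  eapply Rle_trans; [apply Cmod_triangle|lra].
Qed.

Lemma NoDup_incl_complement {I : Type} (l0 : list I) : forall l : list I,
  NoDup l0 -> NoDup l -> incl l0 l -> exists r, Permutation l (l0 ++ r).
Proof.
  induction l0 as [|x l0 IH]; intros l H0 H Hi; [exists l; auto|].
  destruct (in_split x l) as [l1 [l2 Hl]]; [apply Hi; simpl; auto|].
  inversion H0 as [|? ? Hx H0']; subst.
  destruct (IH (l1 ++ l2)) as [r Hr]; auto.
  - apply NoDup_remove_1 in H; auto.
  - intros y Hy; assert (In y (l1 ++ x :: l2)) as Hin by (apply Hi; simpl; auto).
    apply in_app_or in Hin; apply in_or_app; destruct Hin as [|[|]]; auto; subst; easy.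
  - exists r; simpl; rewrite <- Hr; symmetry; apply Permutation_middle.
Qed.

Lemma rsum_mono {I : Type} (g : I -> R) (l L : list I) :
  (forall i, (0 <= g i)%R) -> NoDup l -> NoDup L -> incl l L ->
  (rsum g l <= rsum g L)%R.
Proof.
  intros Hg Hl HL Hi; destruct (NoDup_incl_complement l L Hl HL Hi) as [r Hr].
  rewrite (rsum_perm g _ _ Hr), rsum_app; pose proof (rsum_nonneg g r Hg); lra.
Qed.

Lemma NoDup_same_elements {I : Type} (l : list I) :
  exists l', NoDup l' /\ forall x, In x l' <-> In x l.
Proof.
  induction l as [|x l [l' [H1 H2]]].
  - exists nil; split; [constructor|easy].
  - destruct (classic (In x l)) as [Hx|Hx].
    + exists l'; split; auto; intros y; rewrite H2; simpl; intuition; now subst.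
    + exists (x :: l'); split; [constructor; auto; now rewrite H2|].
      intros y; simpl; rewrite H2; tauto.
Qed.

(* A value approached by finite sums over arbitrarily large finite sets of indices; for
   absolutely summable families this is the unordered sum, by [is_usum_unique]. *)
Definition is_usum {I : Type} (f : I -> C) (s : C) : Prop :=
  forall (eps : R) (l0 : list I), (0 < eps)%R ->
    exists L, NoDup L /\ incl l0 L /\ (Cmod (fsum f L - s) < eps)%R.

Definition abs_bounded {I : Type} (f : I -> C) : Prop :=
  exists M : R, forall l, NoDup l -> (rsum (fun i => Cmod (f i)) l <= M)%R.

(** Take a finite set whose absolute sum is within [eps] of the supremum: whatever is disjoint from
    it contributes less than [eps]. *)
Lemma abs_bounded_tail {I : Type} (f : I -> C) (eps : R) :
  abs_bounded f -> (0 < eps)%R ->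
  exists l0, NoDup l0 /\
    forall r, NoDup (l0 ++ r) -> (rsum (fun i => Cmod (f i)) r < eps)%R.
Proof.
  intros [M HM] Heps.
  set (E := fun x => exists l, NoDup l /\ x = rsum (fun i => Cmod (f i)) l).
  destruct (completeness E) as [m [Hub Hlub]].
  - exists M; intros x [l [Hl Hx]]; subst; auto.
  - exists 0%R, nil; split; [constructor|reflexivity].
  - destruct (classic (exists l, NoDup l /\ (m - eps < rsum (fun i => Cmod (f i)) l)%R))
      as [[l [Hl Hlt]]|Hno].
    + exists l; split; auto; intros r Hr.
      assert (rsum (fun i => Cmod (f i)) (l ++ r) <= m)%R as Hm
        by (apply Hub; exists (l ++ r); auto).
      rewrite rsum_app in Hm; lra.
    + assert (m <= m - eps)%R; [|lra].
      apply Hlub; intros x [l [Hl Hx]]; subst.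
      apply Rnot_lt_le; intros Hlt; apply Hno; exists l; auto.
Qed.

Lemma is_usum_unique {I : Type} (f : I -> C) (s s' : C) :
  abs_bounded f -> is_usum f s -> is_usum f s' -> s = s'.
Proof.
  intros Hb Hs Hs'; apply Ceq_minus, Cmod_eq_0.
  destruct (Rle_lt_or_eq_dec 0 (Cmod (s - s')) (Cmod_ge_0 _)) as [Hp|Hp]; auto.
  set (e := (Cmod (s - s') / 3)%R); assert (He : (0 < e)%R) by (unfold e; lra).
  destruct (abs_bounded_tail f e Hb He) as [l0 [Hl0 Htail]].
  destruct (Hs e l0 He) as [L [HL [Hi Hlt]]].
  (* The second approximating set is required to contain the first one, so the two sums differ by a
     sum over elements outside [l0]. *)
  destruct (Hs' e L He) as [L' [HL' [Hi' Hlt']]].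
  destruct (NoDup_incl_complement _ _ Hl0 HL Hi) as [r0 Hr0].
  destruct (NoDup_incl_complement _ _ HL HL' Hi') as [r Hr].
  assert (Hnd : NoDup (l0 ++ r)).
  { assert (H : NoDup (r0 ++ (l0 ++ r))).
    { apply Permutation_NoDup with L'; auto.
      rewrite Hr, Hr0, app_assoc.
      apply Permutation_app_tail, Permutation_app_comm. }
    apply NoDup_app_remove_l in H; auto. }
  specialize (Htail r Hnd).
  rewrite (fsum_perm f _ _ Hr), fsum_app in Hlt'.
  pose proof (fsum_le_rsum f r) as Hfr.
  pose proof (Cmod_triangle (- (fsum f L - s)) ((fsum f L + fsum f r - s') + - fsum f r)) as H1.
  pose proof (Cmod_triangle (fsum f L + fsum f r - s') (- fsum f r)) as H2.
  rewrite Cmod_opp in H1; rewrite Cmod_opp in H2.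
  replace (- (fsum f L - s) + ((fsum f L + fsum f r - s') + - fsum f r))
    with (s - s') in H1 by ring.
  unfold e in *; lra.
Qed.

Lemma rsum_scal {J : Type} (c : R) (g : J -> R) (l : list J) :
  rsum (fun j => c * g j)%R l = (c * rsum g l)%R.
Proof. induction l as [|j l IH]; simpl; [ring|rewrite IH; ring]. Qed.

Lemma fsum_scal {J : Type} (c : C) (g : J -> C) (l : list J) :
  fsum (fun j => c * g j) l = c * fsum g l.
Proof. induction l as [|j l IH]; simpl; [ring|rewrite IH; ring]. Qed.

Lemma rsum_list_prod {I J : Type} (f : I -> R) (g : J -> R) (l : list I) (l' : list J) :
  rsum (fun p => f (fst p) * g (snd p))%R (list_prod l l') = (rsum f l * rsum g l')%R.
Proof.
  induction l as [|i l IH]; simpl; [ring|].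
  rewrite rsum_app, IH, rsum_map; simpl; rewrite rsum_scal; ring.
Qed.

Lemma fsum_list_prod {I J : Type} (f : I -> C) (g : J -> C) (l : list I) (l' : list J) :
  fsum (fun p => f (fst p) * g (snd p)) (list_prod l l') = fsum f l * fsum g l'.
Proof.
  induction l as [|i l IH]; simpl; [ring|].
  rewrite fsum_app, IH, fsum_map; simpl; rewrite fsum_scal; ring.
Qed.

Lemma NoDup_list_prod {I J : Type} (l : list I) (l' : list J) :
  NoDup l -> NoDup l' -> NoDup (list_prod l l').
Proof.
  intros Hl Hl'; induction Hl as [|i l Hi Hl IH]; simpl; [constructor|].
  apply NoDup_app; auto.
  - apply FinFun.Injective_map_NoDup; auto; intros x y H; now inversion H.
  - intros [x y] H H'; apply in_map_iff in H; destruct H as [j [Hj _]]; inversion Hj; subst.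
    apply in_prod_iff in H'; tauto.
Qed.

Lemma incl_list_prod {I J : Type} (l0 : list (I * J)) (l : list I) (l' : list J) :
  incl (map fst l0) l -> incl (map snd l0) l' -> incl l0 (list_prod l l').
Proof.
  intros H H' [i j] Hin; apply in_prod_iff; split.
  - apply H, in_map_iff; exists (i, j); auto.
  - apply H', in_map_iff; exists (i, j); auto.
Qed.

(** A finite set of pairs lies in the rectangle spanned by its two projections, where the sum of
    absolute values factors. *)
Lemma abs_bounded_prod {I J : Type} (f : I -> C) (g : J -> C) :
  abs_bounded f -> abs_bounded g -> abs_bounded (fun p => f (fst p) * g (snd p)).
Proof.
  intros [M HM] [N HN]; exists (M * N)%R; intros l Hl.
  destruct (NoDup_same_elements (map fst l)) as [l1 [H1 H1']].
  destruct (NoDup_same_elements (map snd l)) as [l2 [H2 H2']].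
  apply Rle_trans with (rsum (fun p => Cmod (f (fst p)) * Cmod (g (snd p)))%R (list_prod l1 l2)).
  - replace (fun p : I * J => Cmod (f (fst p) * g (snd p))) with
      (fun p : I * J => Cmod (f (fst p)) * Cmod (g (snd p)))%R
      by (apply functional_extensionality; intros p; now rewrite Cmod_mult).
    apply rsum_mono; auto using NoDup_list_prod.
    + intros p; apply Rmult_le_pos; apply Cmod_ge_0.
    + apply incl_list_prod; intros x Hx; [now apply H1'|now apply H2'].
  - rewrite (rsum_list_prod (fun i => Cmod (f i)) (fun j => Cmod (g j))); apply Rmult_le_compat; auto.
    + apply rsum_nonneg; intros; apply Cmod_ge_0.
    + apply rsum_nonneg; intros; apply Cmod_ge_0.
Qed.

Lemma is_usum_prod {I J : Type} (f : I -> C) (g : J -> C) (s t : C) :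
  is_usum f s -> is_usum g t -> is_usum (fun p => f (fst p) * g (snd p)) (s * t).
Proof.
  intros Hs Ht eps l0 Heps.
  set (A := (Cmod s + Cmod t + 1)%R).
  assert (HA : (1 <= A)%R)
    by (unfold A; pose proof (Cmod_ge_0 s); pose proof (Cmod_ge_0 t); lra).
  assert (Hq : (0 < eps / A)%R) by (apply Rdiv_lt_0_compat; lra).
  set (e := Rmin 1 (eps / A)).
  assert (He : (0 < e)%R) by (apply Rmin_pos; lra).
  assert (He1 : (e <= 1)%R) by apply Rmin_l.
  assert (He2 : (e * A <= eps)%R).
  { apply Rle_trans with (eps / A * A)%R.
    - apply Rmult_le_compat_r; [lra|apply Rmin_r].
    - right; field; lra. }
  destruct (Hs e (map fst l0) He) as [L [HL [Hi Hlt]]].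
  destruct (Ht e (map snd l0) He) as [L' [HL' [Hi' Hlt']]].
  exists (list_prod L L'); split; [now apply NoDup_list_prod|].
  split; [now apply incl_list_prod|].
  rewrite (fsum_list_prod f g).
  replace (_ - _) with ((fsum f L - s) * (fsum g L' - t) +
                        ((fsum f L - s) * t + s * (fsum g L' - t))) by ring.
  eapply Rle_lt_trans; [apply Cmod_triangle|].
  eapply Rle_lt_trans; [apply Rplus_le_compat_l, Cmod_triangle|].
  rewrite !Cmod_mult; unfold A in *.
  pose proof (Cmod_ge_0 (fsum f L - s)); pose proof (Cmod_ge_0 (fsum g L' - t));
    pose proof (Cmod_ge_0 s); pose proof (Cmod_ge_0 t).
  nra.
Qed.

(** * Unordered sums over an index set split into two disjoint images *)

Section Splitting.
Context {I J K : Type} (phi : J -> I) (psi : K -> I)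
  (phi_inj : forall x y, phi x = phi y -> x = y)
  (psi_inj : forall x y, psi x = psi y -> x = y)
  (images_disjoint : forall x y, phi x <> psi y)
  (images_cover : forall i, (exists x, phi x = i) \/ (exists y, psi y = i)).

Lemma cover_list (l : list I) :
  exists l1 l2, incl l (map phi l1 ++ map psi l2).
Proof.
  induction l as [|i l [l1 [l2 H]]].
  - exists nil, nil; easy.
  - destruct (images_cover i) as [[x Hx]|[x Hx]].
    + exists (x :: l1), l2; intros y [Hy|Hy]; simpl; [left; congruence|right; auto].
    + exists l1, (x :: l2); intros y [Hy|Hy]; apply in_or_app.
      * right; left; congruence.
      * apply H in Hy; apply in_app_or in Hy; simpl; tauto.
Qed.

Lemma NoDup_union (l1 : list J) (l2 : list K) :
  NoDup l1 -> NoDup l2 -> NoDup (map phi l1 ++ map psi l2).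
Proof.
  intros H1 H2; apply NoDup_app.
  - now apply FinFun.Injective_map_NoDup.
  - now apply FinFun.Injective_map_NoDup.
  - intros x Hx Hx'; apply in_map_iff in Hx; apply in_map_iff in Hx'.
    destruct Hx as [a [Ha _]], Hx' as [b [Hb _]]; subst; symmetry in Hb.
    now apply images_disjoint in Hb.
Qed.

Lemma abs_bounded_union (f : I -> C) :
  abs_bounded (fun x => f (phi x)) -> abs_bounded (fun y => f (psi y)) -> abs_bounded f.
Proof.
  intros [M HM] [N HN]; exists (M + N)%R; intros l Hl.
  destruct (cover_list l) as [l1 [l2 Hi]].
  destruct (NoDup_same_elements l1) as [l1' [H1 H1']].
  destruct (NoDup_same_elements l2) as [l2' [H2 H2']].
  apply Rle_trans with (rsum (fun i => Cmod (f i)) (map phi l1' ++ map psi l2')).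
  - apply rsum_mono; auto using NoDup_union.
    + intros; apply Cmod_ge_0.
    + intros y Hy; apply Hi, in_app_or in Hy; apply in_or_app.
      destruct Hy as [Hy|Hy]; [left|right]; apply in_map_iff in Hy; apply in_map_iff;
        destruct Hy as [x [Hx Hx']]; exists x; split; auto; [now apply H1'|now apply H2'].
  - rewrite rsum_app, !rsum_map; apply Rplus_le_compat; auto.
Qed.

Lemma is_usum_union (f : I -> C) (s t : C) :
  is_usum (fun x => f (phi x)) s -> is_usum (fun y => f (psi y)) t -> is_usum f (s + t).
Proof.
  intros Hs Ht eps l0 Heps.
  destruct (cover_list l0) as [l1 [l2 Hi]].
  destruct (Hs (eps / 2)%R l1 ltac:(lra)) as [L1 [H1 [Hi1 Hlt1]]].
  destruct (Ht (eps / 2)%R l2 ltac:(lra)) as [L2 [H2 [Hi2 Hlt2]]].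
  exists (map phi L1 ++ map psi L2); split; [now apply NoDup_union|]; split.
  - intros x Hx; apply Hi, in_app_or in Hx; apply in_or_app.
    destruct Hx as [Hx|Hx]; [left|right]; apply in_map_iff in Hx; apply in_map_iff;
        destruct Hx as [y [Hy Hy']]; exists y; split; auto.
  - rewrite fsum_app, !fsum_map.
    replace (_ - _) with ((fsum (fun i => f (phi i)) L1 - s) +
                          (fsum (fun i => f (psi i)) L2 - t)) by ring.
    eapply Rle_lt_trans; [apply Cmod_triangle|lra].
Qed.

End Splitting.

Lemma rsum_seq_le_Series (n : nat) : forall b : nat -> R, (forall k, (0 <= b k)%R) ->
  ex_series b -> (rsum b (seq 0 n) <= Series b)%R.
Proof.
  assert (Hpos : forall b : nat -> R, (forall k, (0 <= b k)%R) -> ex_series b -> (0 <= Series b)%R).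
  { intros b Hb Hs; rewrite <- (Rmult_0_l (Series b)), <- Series_scal_l.
    apply Series_le; auto; intros k; specialize (Hb k); lra. }
  induction n as [|n IH]; intros b Hb Hs; simpl; auto.
  rewrite Series_incr_1, <- seq_shift, rsum_map by auto.
  apply Rplus_le_compat_l, IH; auto.
  apply (ex_series_incr_1 b : _ <-> _); exact Hs.
Qed.

Lemma incl_seq (l : list nat) : exists N, forall n, (N <= n)%nat -> incl l (seq 0 n).
Proof.
  exists (S (list_max l)); intros n Hn x Hx; apply in_seq; split; [lia|].
  pose proof (list_max_le l (list_max l)) as [H _]; specialize (H (le_n _)).
  rewrite Forall_forall in H; specialize (H x Hx); lia.
Qed.

Lemma csummable_abs_bounded (a : nat -> C) : csummable a -> abs_bounded a.
Proof.
  intros Ha; exists (Series (fun n => Cmod (a n))); intros l Hl.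
  destruct (incl_seq l) as [N HN].
  eapply Rle_trans; [|apply (rsum_seq_le_Series N)]; auto using Cmod_ge_0.
  apply rsum_mono; auto using seq_NoDup, Cmod_ge_0.
Qed.

Lemma csum_is_usum (a : nat -> C) : csummable a -> is_usum a (csum a).
Proof.
  intros Ha eps l0 Heps; destruct (incl_seq l0) as [N HN].
  destruct (clim_csum a Ha eps Heps) as [N' HN'].
  exists (seq 0 (N + N')); split; [apply seq_NoDup|]; split.
  - apply HN; lia.
  - apply HN'; lia.
Qed.

(** The integers are cut between [-1] and [0], so that the reflection [n -> -1 - n] exchanges the
    halves. This is the sign change of [n + 1/2], the symmetry of half-integral characteristics. *)
Definition zsummable (f : Z -> C) : Prop :=
  csummable (fun n => f (Z.of_nat n)) /\ csummable (fun n => f (-1 - Z.of_nat n)%Z).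

Definition zsum (f : Z -> C) : C :=
  csum (fun n => f (Z.of_nat n)) + csum (fun n => f (-1 - Z.of_nat n)%Z).

Lemma Z_halves_cover (i : Z) :
  (exists n, Z.of_nat n = i) \/ (exists n, (-1 - Z.of_nat n)%Z = i).
Proof.
  destruct (Z_le_gt_dec 0 i).
  - left; exists (Z.to_nat i); lia.
  - right; exists (Z.to_nat (-1 - i)); lia.
Qed.

Lemma zsummable_abs_bounded (f : Z -> C) : zsummable f -> abs_bounded f.
Proof.
  intros [H1 H2].
  apply (abs_bounded_union Z.of_nat (fun n => (-1 - Z.of_nat n)%Z));
    auto using csummable_abs_bounded, Z_halves_cover; intros; lia.
Qed.

Lemma zsum_is_usum (f : Z -> C) : zsummable f -> is_usum f (zsum f).
Proof.
  intros [H1 H2].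
  apply (is_usum_union Z.of_nat (fun n => (-1 - Z.of_nat n)%Z));
    auto using Z_halves_cover; try (intros; lia).
  - apply (csum_is_usum (fun n => f (Z.of_nat n)) H1).
  - apply (csum_is_usum (fun n => f (-1 - Z.of_nat n)%Z) H2).
Qed.

(* The pairs [(k + k', k - k')] and [(k + k' + 1, k - k')] partition the lattice of all
   pairs of integers. *)
Lemma zsum_mult_split (f g f0 g0 f1 g1 : Z -> C) :
  zsummable f -> zsummable g -> zsummable f0 -> zsummable g0 ->
  zsummable f1 -> zsummable g1 ->
  (forall k k', f (k + k')%Z * g (k - k')%Z = f0 k * g0 k') ->
  (forall k k', f (k + k' + 1)%Z * g (k - k')%Z = f1 k * g1 k') ->
  zsum f * zsum g = zsum f0 * zsum g0 + zsum f1 * zsum g1.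
Proof.
  intros Hf Hg Hf0 Hg0 Hf1 Hg1 H0 H1.
  apply (is_usum_unique (fun p : Z * Z => f (fst p) * g (snd p))).
  - apply abs_bounded_prod; now apply zsummable_abs_bounded.
  - apply is_usum_prod; now apply zsum_is_usum.
  - apply (is_usum_union (fun p : Z * Z => (fst p + snd p, fst p - snd p)%Z)
             (fun p : Z * Z => (fst p + snd p + 1, fst p - snd p)%Z)); simpl.
    + intros [a b] [c d] H; simpl in H; inversion H; f_equal; lia.
    + intros [a b] [c d] H; simpl in H; inversion H; f_equal; lia.
    + intros [a b] [c d] H; simpl in H; inversion H; lia.
    (* For [a + b = 2 q] or [a + b = 2 q + 1] the preimage of [(a, b)] is [k = q], [k' = q - b]. *)
    + intros [a b]; pose proof (Z.div_mod (a + b) 2 ltac:(lia)) as Hd.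
      pose proof (Z.mod_pos_bound (a + b) 2 ltac:(lia)) as Hm.
      set (q := ((a + b) / 2)%Z) in *.
      destruct (Z.eq_dec ((a + b) mod 2) 0) as [Hz|Hz].
      * left; exists (q, q - b)%Z; simpl; f_equal; lia.
      * right; exists (q, q - b)%Z; simpl; f_equal; lia.
    + replace (fun x : Z * Z => f (fst x + snd x)%Z * g (fst x - snd x)%Z)
        with (fun x : Z * Z => f0 (fst x) * g0 (snd x))
        by (apply functional_extensionality; intros [a b]; simpl; now rewrite H0).
      apply is_usum_prod; now apply zsum_is_usum.
    + replace (fun x : Z * Z => f (fst x + snd x + 1)%Z * g (fst x - snd x)%Z)
        with (fun x : Z * Z => f1 (fst x) * g1 (snd x))
        by (apply functional_extensionality; intros [a b]; simpl; now rewrite H1).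
      apply is_usum_prod; now apply zsum_is_usum.
Qed.

Lemma zsum_ext (f g : Z -> C) : (forall n, f n = g n) -> zsum f = zsum g.
Proof. intros H; f_equal; now apply functional_extensionality. Qed.

Lemma zsum_scal (c : C) (f : Z -> C) : zsummable f ->
  zsum (fun n => c * f n) = c * zsum f.
Proof.
  intros [H1 H2]; unfold zsum.
  rewrite (csum_scal c (fun n => f (Z.of_nat n))) by auto.
  rewrite (csum_scal c (fun n => f (-1 - Z.of_nat n)%Z)) by auto; ring.
Qed.

Lemma zsum_reflect (f : Z -> C) : zsum (fun n => f (-1 - n)%Z) = zsum f.
Proof.
  unfold zsum; rewrite Cplus_comm; f_equal; apply csum_ext; intros n; f_equal; lia.
Qed.

Lemma zsum_shift (f : Z -> C) : zsummable f -> zsum (fun n => f (n + 1)%Z) = zsum f.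
Proof.
  intros [H1 H2]; unfold zsum.
  rewrite (csum_incr_1 (fun n => f (Z.of_nat n))) by auto.
  rewrite (csum_incr_1 (fun n => f (-1 - Z.of_nat n + 1)%Z)).
  - replace (csum (fun n => f (Z.of_nat n + 1)%Z)) with (csum (fun n => f (Z.of_nat (S n))))
      by (apply csum_ext; intros; f_equal; lia).
    replace (csum (fun n => f (-1 - Z.of_nat (S n) + 1)%Z))
      with (csum (fun n => f (-1 - Z.of_nat n)%Z))
      by (apply csum_ext; intros; f_equal; lia).
    change (-1 - Z.of_nat 0 + 1)%Z with (Z.of_nat 0); ring.
  - apply (ex_series_incr_1 (fun n => Cmod (f (-1 - Z.of_nat n + 1)%Z)) : _ <-> _).
    revert H2; apply ex_series_ext; intros n; do 2 f_equal; lia.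
Qed.

(** * Theta functions with characteristics *)

(** Arbitrary real characteristics keep the family closed under the splitting of double series,
    which halves sums and differences of characteristics. The power [p] puts all [z]-derivatives
    into the same family. *)
Definition gterm (p : nat) (a b : R) (z t : C) (n : Z) : C :=
  (2 * Cpi * Ci * RtoC (IZR n + a)) ^ p *
  cexp (Cpi * Ci * (RtoC (IZR n + a) * RtoC (IZR n + a) * t)
        + 2 * Cpi * Ci * RtoC (IZR n + a) * (z + RtoC b)).

(* The [p]-th [z]-derivative of the theta function with characteristics [a] and [b]. *)
Definition gtheta (p : nat) (a b : R) (z t : C) : C := zsum (gterm p a b z t).

Lemma exp_INR_mult (n : nat) (x : R) : exp (INR n * x) = (exp x ^ n)%R.
Proof.
  induction n as [|n IH]; [simpl; now rewrite Rmult_0_l, exp_0|].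
  rewrite S_INR, Rmult_plus_distr_r, exp_plus, IH, Rmult_1_l; simpl; ring.
Qed.

Lemma ex_series_exp_opp (K : R) : ex_series (fun n => K * exp (- INR n))%R.
Proof.
  apply @ex_series_scal_l.
  apply (ex_series_ext (fun n => (exp (-1)) ^ n)%R).
  - intros n; rewrite <- exp_INR_mult; f_equal; ring.
  - apply ex_series_geom; rewrite Rabs_right by (left; apply exp_pos).
    rewrite <- exp_0; apply exp_increasing; lra.
Qed.

Lemma zsummable_exp_decay (f : Z -> C) (K : R) :
  (forall n, (Cmod (f n) <= K * exp (- Rabs (IZR n)))%R) -> zsummable f.
Proof.
  intros H.
  assert (HK : (0 <= K)%R).
  { specialize (H 0%Z); rewrite Rabs_R0, Ropp_0, exp_0 in H.
    pose proof (Cmod_ge_0 (f 0%Z)); lra. }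
  split; apply csummable_dominated with (fun n => K * exp (- INR n))%R;
    try apply ex_series_exp_opp; intros n; eapply Rle_trans; try apply H;
    apply Rmult_le_compat_l; auto; apply exp_le; rewrite INR_IZR_INZ.
  - rewrite Rabs_right; [lra|]; apply Rle_ge, IZR_le; lia.
  - rewrite minus_IZR, Rabs_left; [lra|]; assert (0 <= IZR (Z.of_nat n))%R by (apply IZR_le; lia); lra.
Qed.

(** The constant is the maximum of [- v y^2 + (c + 1) y], found by completing the square, together
    with the cost [Rabs a] of replacing [x + a] by [x]. *)
Lemma gaussian_decay (v c a : R) : (0 < v)%R ->
  exists K : R, forall x : R,
    (exp (- v * ((x + a) * (x + a)) + c * Rabs (x + a)) <= K * exp (- Rabs x))%R.
Proof.
  intros Hv; exists (exp ((c + 1) * (c + 1) / (4 * v) + Rabs a)); intros x.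
  rewrite <- exp_plus; apply exp_le.
  set (m := (x + a)%R).
  assert (H1 : (Rabs x <= Rabs m + Rabs a)%R).
  { replace x with (m + - a)%R by (unfold m; ring).
    eapply Rle_trans; [apply Rabs_triang|]; rewrite Rabs_Ropp; lra. }
  assert (H2 : (- v * (m * m) + (c + 1) * Rabs m <= (c + 1) * (c + 1) / (4 * v))%R).
  { replace (m * m)%R with (Rabs m * Rabs m)%R
      by (rewrite <- Rabs_mult, Rabs_right; auto; apply Rle_ge, Rle_0_sqr).
    set (y := Rabs m).
    pose proof (Rle_0_sqr (2 * v * y - (c + 1))) as Hs; unfold Rsqr in Hs.
    apply Rmult_le_reg_r with (4 * v)%R; [lra|].
    replace ((c + 1) * (c + 1) / (4 * v) * (4 * v))%R with ((c + 1) * (c + 1))%R by (field; lra).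
    nra. }
  lra.
Qed.

Lemma pow_le_exp (x : R) (p : nat) : (0 <= x)%R -> (x ^ p <= exp (INR p * x))%R.
Proof.
  intros Hx; rewrite exp_INR_mult; apply pow_incr; split; auto.
  pose proof (exp_ineq1_le x); lra.
Qed.

Lemma Cmod_gterm (p : nat) (a b : R) (z t : C) (n : Z) :
  Cmod (gterm p a b z t n) =
  ((2 * PI * Rabs (IZR n + a)) ^ p *
   exp (- (PI * Im t) * ((IZR n + a) * (IZR n + a)) - 2 * PI * Im z * (IZR n + a)))%R.
Proof.
  unfold gterm; rewrite Cmod_mult, Cmod_pow, Cmod_cexp, !Cmod_mult, Cmod_Ci.
  unfold Cpi; rewrite !Cmod_R.
  rewrite (Rabs_right 2), (Rabs_right PI) by (pose proof PI_RGT_0; lra).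
  f_equal; [f_equal; ring|f_equal; destruct z, t; simpl; ring].
Qed.

(** The additional exponential leaves room for the weights in [cder_zsum]: the frequencies are
    linear in [n + a] for the derivative in [z] and quadratic for the one in [t]. As long as [w] is
    below [PI * Im t] some Gaussian decay survives. *)
Lemma gterm_decay (p : nat) (a b : R) (z t : C) (c w : R) :
  (w < PI * Im t)%R -> exists K : R, forall n : Z,
  (Cmod (gterm p a b z t n) *
     exp (c * Rabs (IZR n + a) + w * ((IZR n + a) * (IZR n + a)))
   <= K * exp (- Rabs (IZR n)))%R.
Proof.
  intros Hw.
  destruct (gaussian_decay (PI * Im t - w) (INR p * (2 * PI) + 2 * PI * Rabs (Im z) + c) a
              ltac:(lra)) as [K HK].
  exists K; intros n; eapply Rle_trans; [|apply HK]; rewrite Cmod_gterm.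
  pose proof PI_RGT_0 as Hpi; set (m := (IZR n + a)%R).
  pose proof (Rabs_pos m) as Hm.
  eapply Rle_trans.
  - apply Rmult_le_compat_r; [apply Rlt_le, exp_pos|].
    apply Rmult_le_compat_r; [apply Rlt_le, exp_pos|].
    apply pow_le_exp; apply Rmult_le_pos; lra.
  - rewrite <- !exp_plus; apply exp_le.
    assert (- (Im z * m) <= Rabs (Im z) * Rabs m)%R.
    { rewrite <- Rabs_mult, <- Rabs_Ropp; apply Rle_abs. }
    nra.
Qed.

Lemma gterm_summable (p : nat) (a b : R) (z t : C) :
  (0 < Im t)%R -> zsummable (gterm p a b z t).
Proof.
  intros Ht; destruct (gterm_decay p a b z t 0 0) as [K HK].
  - apply Rmult_lt_0_compat; auto; apply PI_RGT_0.
  - apply zsummable_exp_decay with K; intros n; specialize (HK n).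
    now rewrite !Rmult_0_l, Rplus_0_l, exp_0, Rmult_1_r in HK.
Qed.

Lemma cder_zsum (F : Z -> C -> C) (lam : Z -> C) (z : C) (delta K : R) :
  (0 < delta)%R ->
  (forall n h, F n (z + h) = F n z * cexp (lam n * h)) ->
  zsummable (fun n => F n z) ->
  (forall n, (Cmod (F n z) * (Cmod (lam n) ^ 2 * exp (Cmod (lam n) * delta))
              <= K * exp (- Rabs (IZR n)))%R) ->
  cder (fun w => zsum (fun n => F n w)) z (zsum (fun n => lam n * F n z)).
Proof.
  intros Hd HF [H1 H2] HK; unfold zsum.
  assert (HS : zsummable (fun n => RtoC (Cmod (F n z) * (Cmod (lam n) ^ 2 * exp (Cmod (lam n) * delta)))%R)).
  { apply zsummable_exp_decay with K; intros n; rewrite Cmod_R, Rabs_right; auto.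
    apply Rle_ge, Rmult_le_pos; [apply Cmod_ge_0|].
    apply Rmult_le_pos; [apply pow_le, Cmod_ge_0|apply Rlt_le, exp_pos]. }
  destruct HS as [HS1 HS2].
  apply cder_plus.
  - apply (cder_csum (fun n w => F (Z.of_nat n) w) (fun n => lam (Z.of_nat n)) z delta); auto.
    revert HS1; apply ex_series_ext; intros n; rewrite Cmod_R, Rabs_right; auto.
    apply Rle_ge, Rmult_le_pos; [apply Cmod_ge_0|].
    apply Rmult_le_pos; [apply pow_le, Cmod_ge_0|apply Rlt_le, exp_pos].
  - apply (cder_csum (fun n w => F (-1 - Z.of_nat n)%Z w) (fun n => lam (-1 - Z.of_nat n)%Z) z delta); auto.
    revert HS2; apply ex_series_ext; intros n; rewrite Cmod_R, Rabs_right; auto.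
    apply Rle_ge, Rmult_le_pos; [apply Cmod_ge_0|].
    apply Rmult_le_pos; [apply pow_le, Cmod_ge_0|apply Rlt_le, exp_pos].
Qed.

Lemma gtheta_cder_z (p : nat) (a b : R) (z t : C) : (0 < Im t)%R ->
  cder (fun w => gtheta p a b w t) z (gtheta (S p) a b z t).
Proof.
  intros Ht; pose proof PI_RGT_0 as Hpi.
  (* The frequency has modulus [y = 2 PI |n + a|]; its square is at most [exp (2 y)], and the radius
     [1] adds [exp y]. Together [3 y = 6 PI |n + a|]. *)
  destruct (gterm_decay p a b z t (6 * PI) 0) as [K HK].
  { now apply Rmult_lt_0_compat. }
  replace (gtheta (S p) a b z t) with
    (zsum (fun n => 2 * Cpi * Ci * RtoC (IZR n + a) * gterm p a b z t n))
    by (apply zsum_ext; intros n; unfold gterm; rewrite Cpow_S; ring).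
  apply (cder_zsum (fun n w => gterm p a b w t n) (fun n => 2 * Cpi * Ci * RtoC (IZR n + a))
           z 1 K); auto using gterm_summable; [lra| |].
  - intros n h; unfold gterm; rewrite <- (Cmult_assoc (_ ^ p)), <- cexp_add; do 2 f_equal; ring.
  - intros n; eapply Rle_trans; [|apply HK].
    apply Rmult_le_compat_l; [apply Cmod_ge_0|].
    replace (Cmod (2 * Cpi * Ci * RtoC (IZR n + a))) with (2 * PI * Rabs (IZR n + a))%R.
    2:{ rewrite !Cmod_mult, Cmod_Ci; unfold Cpi; rewrite !Cmod_R.
        rewrite (Rabs_right 2), (Rabs_right PI) by lra; ring. }
    pose proof (Rabs_pos (IZR n + a)).
    eapply Rle_trans.
    + apply Rmult_le_compat_r; [apply Rlt_le, exp_pos|].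
      apply pow_le_exp, Rmult_le_pos; lra.
    + rewrite <- exp_plus; apply exp_le; simpl INR; lra.
Qed.

(** The heat equation, term by term: [PI i m^2] is [(2 PI i m)^2] times [- i / (4 PI)], where
    [m = n + a]. *)
Lemma gtheta_cder_t (p : nat) (a b : R) (z t : C) : (0 < Im t)%R ->
  cder (fun s => gtheta p a b z s) t (gtheta (S (S p)) a b z t * (- Ci / (4 * Cpi))).
Proof.
  intros Ht; pose proof PI_RGT_0 as Hpi.
  (* The squared frequency [(PI m^2)^2] is at most [(2 PI |m|)^4], hence at most [exp (8 PI |m|)].
     The radius [Im t / 2] uses up half of the Gaussian exponent. *)
  destruct (gterm_decay p a b z t (8 * PI) (PI * (Im t / 2))) as [K HK].
  { apply Rmult_lt_compat_l; lra. }
  assert (HpiC : Cpi <> 0) by (intros H; apply RtoC_inj in H; lra).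
  replace (gtheta (S (S p)) a b z t * (- Ci / (4 * Cpi))) with
    (zsum (fun n => Cpi * Ci * (RtoC (IZR n + a) * RtoC (IZR n + a)) * gterm p a b z t n)).
  2:{ rewrite (Cmult_comm (gtheta _ _ _ _ _)); unfold gtheta; rewrite <- zsum_scal by now apply gterm_summable.
      apply zsum_ext; intros n; unfold gterm; rewrite !Cpow_S.
      replace Ci with (- Ci * (Ci * Ci)) at 1
        by (apply injective_projections; simpl; ring).
      field; repeat split; auto; intros H; apply RtoC_inj in H; lra. }
  apply (cder_zsum (fun n s => gterm p a b z s n)
           (fun n => Cpi * Ci * (RtoC (IZR n + a) * RtoC (IZR n + a)))
           t (Im t / 2) K); auto using gterm_summable; [lra| |].
  - intros n h; unfold gterm; rewrite <- (Cmult_assoc (_ ^ p)), <- cexp_add; do 2 f_equal; ring.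
  - intros n; eapply Rle_trans; [|apply HK].
    apply Rmult_le_compat_l; [apply Cmod_ge_0|].
    set (m := (IZR n + a)%R); pose proof (Rabs_pos m).
    replace (Cmod (Cpi * Ci * (RtoC m * RtoC m))) with (PI * (Rabs m * Rabs m))%R.
    2:{ rewrite !Cmod_mult, Cmod_Ci; unfold Cpi; rewrite !Cmod_R.
        rewrite (Rabs_right PI) by lra; ring. }
    replace (m * m)%R with (Rabs m * Rabs m)%R
      by (rewrite <- Rabs_mult, Rabs_right; auto; apply Rle_ge, Rle_0_sqr).
    apply Rle_trans with ((2 * PI * Rabs m) ^ 4 * exp (PI * (Rabs m * Rabs m) * (Im t / 2)))%R.
    + apply Rmult_le_compat_r; [apply Rlt_le, exp_pos|].
      replace ((2 * PI * Rabs m) ^ 4)%R with ((4 * PI * (PI * (Rabs m * Rabs m))) ^ 2)%R by ring.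
      pose proof PI2_1.
      assert (0 <= PI * (Rabs m * Rabs m))%R
        by (apply Rmult_le_pos; [lra|now apply Rmult_le_pos]).
      apply pow_incr; nra.
    + eapply Rle_trans.
      * apply Rmult_le_compat_r; [apply Rlt_le, exp_pos|].
        apply pow_le_exp, Rmult_le_pos; lra.
      * rewrite <- exp_plus; apply exp_le; simpl INR; nra.
Qed.

Lemma cexp_2PI_Z (n : Z) : cexp (2 * Cpi * Ci * RtoC (IZR n)) = 1.
Proof.
  unfold Cpi; replace (2 * RtoC PI * Ci * RtoC (IZR n)) with ((0, 2 * PI * IZR n)%R : C)
    by (apply injective_projections; simpl; ring).
  rewrite cexp_pair, exp_0.
  assert (H : forall k : nat, cos (2 * PI * INR k) = 1%R /\ sin (2 * PI * INR k) = 0%R).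
  { intros k; replace (2 * PI * INR k)%R with (0 + 2 * INR k * PI)%R by ring.
    now rewrite cos_period, sin_period, cos_0, sin_0. }
  destruct (Z_le_gt_dec 0 n) as [Hn|Hn].
  - destruct (H (Z.to_nat n)) as [Hc Hs]; rewrite INR_IZR_INZ, Z2Nat.id in Hc, Hs by lia.
    rewrite Hc, Hs; apply injective_projections; simpl; ring.
  - destruct (H (Z.to_nat (- n))) as [Hc Hs].
    rewrite INR_IZR_INZ, Z2Nat.id, opp_IZR in Hc, Hs by lia.
    replace (2 * PI * - IZR n)%R with (- (2 * PI * IZR n))%R in Hc, Hs by ring.
    rewrite cos_neg in Hc; rewrite sin_neg in Hs.
    rewrite Hc; replace (sin (2 * PI * IZR n)) with 0%R by lra.
    apply injective_projections; simpl; ring.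
Qed.

Lemma gtheta_shift_a (p : nat) (a b : R) (z t : C) : (0 < Im t)%R ->
  gtheta p (a + 1) b z t = gtheta p a b z t.
Proof.
  intros Ht; unfold gtheta; rewrite <- (zsum_shift (gterm p a b z t)) by now apply gterm_summable.
  apply zsum_ext; intros n; unfold gterm; rewrite plus_IZR.
  replace (IZR n + (a + 1))%R with (IZR n + 1 + a)%R by ring; reflexivity.
Qed.

Lemma gtheta_shift_b (p : nat) (a b : R) (z t : C) : (0 < Im t)%R ->
  gtheta p a (b + 1) z t = cexp (2 * Cpi * Ci * RtoC a) * gtheta p a b z t.
Proof.
  intros Ht; unfold gtheta; rewrite <- zsum_scal by now apply gterm_summable.
  apply zsum_ext; intros n; unfold gterm.
  rewrite <- (Cmult_1_l (cexp (2 * Cpi * Ci * RtoC a))), <- (cexp_2PI_Z n).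
  rewrite (Cmult_comm (_ ^ p)), (Cmult_comm (_ ^ p)), !Cmult_assoc, <- !cexp_add.
  f_equal; f_equal; rewrite !RtoC_plus; ring.
Qed.

(** The substitution [n -> -1 - n] turns [n + 1 - a] into [- (n + a)]. *)
Lemma gtheta_reflect (p : nat) (a b : R) (z t : C) :
  (0 < Im t)%R ->
  gtheta p (1 - a) b z t = (-1) ^ p * gtheta p a (- b) (- z) t.
Proof.
  intros Ht; unfold gtheta; rewrite <- (zsum_reflect (gterm p (1 - a) b z t)).
  rewrite <- zsum_scal by now apply gterm_summable.
  apply zsum_ext; intros n; unfold gterm; rewrite minus_IZR.
  rewrite (Cmult_assoc ((-1) ^ p)), <- Cpow_mult_l.
  replace (RtoC (IZR (-1) - IZR n + (1 - a))) with (- RtoC (IZR n + a)).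
  2:{ rewrite <- RtoC_opp; f_equal; lra. }
  f_equal; [f_equal; ring|f_equal; rewrite RtoC_opp; ring].
Qed.

(** With [n = k + k'] and [n' = k - k'] the shifted indices are [M + M'] and [M - M'], where
    [M = k + (a + a') / 2] and [M' = k' + (a - a') / 2]. Their squares add up to [2 M^2 + 2 M'^2],
    which separates the exponent and doubles [t]; the linear part becomes
    [M (2 x + b + b') + M' (2 y + b - b')]. Pairs of odd sum move both characteristics by [1/2]. *)
Lemma gtheta_product (a b a' b' : R) (x y t : C) : (0 < Im t)%R ->
  gtheta 0 a b (x + y) t * gtheta 0 a' b' (x - y) t =
  gtheta 0 ((a + a') / 2) (b + b') (2 * x) (2 * t) *
    gtheta 0 ((a - a') / 2) (b - b') (2 * y) (2 * t) +
  gtheta 0 ((1 + a + a') / 2) (b + b') (2 * x) (2 * t) *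
    gtheta 0 ((1 + a - a') / 2) (b - b') (2 * y) (2 * t).
Proof.
  intros Ht.
  assert (H2 : (0 < Im (2 * t))%R) by (rewrite im_scal_l; lra).
  apply zsum_mult_split; try now apply gterm_summable.
  - intros k k'; unfold gterm; simpl Cpow; rewrite !Cmult_1_l, <- !cexp_add; f_equal.
    rewrite plus_IZR, minus_IZR; rewrite ?RtoC_plus, ?RtoC_minus, ?RtoC_div, ?RtoC_plus, ?RtoC_minus, ?RtoC_plus by lra.
    field; intros H; apply RtoC_inj in H; lra.
  - intros k k'; unfold gterm; simpl Cpow; rewrite !Cmult_1_l, <- !cexp_add; f_equal.
    rewrite !plus_IZR, minus_IZR; rewrite ?RtoC_plus, ?RtoC_minus, ?RtoC_div, ?RtoC_plus, ?RtoC_minus, ?RtoC_plus by lra.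
    field; intros H; apply RtoC_inj in H; lra.
Qed.

(** * Product formulas *)

(** The sign compensates [i * (2 i) = - 2]: the shift [b = 1/2] gives a factor [i], and the
    difference of the two exponentials gives [2 i] times a sine. *)
Definition dtheta1 (p : nat) (z t : C) : C := - gtheta p (1 / 2) (1 / 2) z t.
Definition dtheta2 (p : nat) (z t : C) : C := gtheta p (1 / 2) 0 z t.
Definition dtheta3 (p : nat) (z t : C) : C := gtheta p 0 0 z t.
Definition dtheta4 (p : nat) (z t : C) : C := gtheta p 0 (1 / 2) z t.

Lemma RtoC_neq (r : R) : r <> 0%R -> RtoC r <> 0.
Proof. intros H H'; now apply RtoC_inj in H'. Qed.

Lemma Cpi_neq_0 : Cpi <> 0.
Proof. apply RtoC_neq; pose proof PI_RGT_0; lra. Qed.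

Lemma Ci_sqr : Ci * Ci = -1.
Proof. apply injective_projections; simpl; ring. Qed.

Lemma cexp_PI_nat (n : nat) : cexp (CN n * (Cpi * Ci)) = sgn n.
Proof.
  rewrite <- cexp_pow, cexp_PI; unfold sgn; rewrite RtoC_pow; reflexivity.
Qed.

Lemma sgn_sqr (n : nat) : sgn n * sgn n = 1.
Proof.
  unfold sgn; rewrite <- RtoC_mult, <- Rpow_mult_distr.
  replace (-1 * -1)%R with 1%R by ring; now rewrite pow1.
Qed.

Lemma Cmod_sgn (n : nat) : Cmod (sgn n) = 1%R.
Proof.
  unfold sgn; rewrite Cmod_R, <- RPow_abs, Rabs_left by lra.
  replace (- (-1))%R with 1%R by ring; now rewrite pow1.
Qed.

Lemma cexp_opp_PI_nat (n : nat) : cexp (- (CN n * (Cpi * Ci))) = sgn n.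
Proof.
  pose proof (cexp_opp (CN n * (Cpi * Ci))) as H; rewrite cexp_PI_nat in H.
  rewrite <- (Cmult_1_r (cexp _)), <- (sgn_sqr n), Cmult_assoc, H; ring.
Qed.

Lemma cexp_opp_PI2 : cexp (- (Cpi * Ci / 2)) = - Ci.
Proof.
  pose proof (cexp_opp (Cpi * Ci / 2)) as H; rewrite cexp_PI2 in H.
  replace (cexp (- (Cpi * Ci / 2))) with (cexp (- (Cpi * Ci / 2)) * Ci * - Ci).
  - rewrite H; ring.
  - transitivity (cexp (- (Cpi * Ci / 2)) * - (Ci * Ci)); [ring|rewrite Ci_sqr; ring].
Qed.

Lemma zsum_pair (f : Z -> C) : zsummable f ->
  zsum f = csum (fun n => f (Z.of_nat n) + f (-1 - Z.of_nat n)%Z).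
Proof. intros [H1 H2]; unfold zsum; now rewrite <- csum_plus. Qed.

Lemma zsummable_pair (f : Z -> C) : zsummable f ->
  csummable (fun n => f (Z.of_nat n) + f (-1 - Z.of_nat n)%Z).
Proof. intros [H1 H2]; now apply csummable_plus. Qed.

(** For integral characteristics the symmetry is [n -> - n], which fixes [0]; this is the origin of
    the isolated [1] in [theta3] and [theta4]. *)
Lemma zsum_pair_center (f : Z -> C) : zsummable f ->
  zsum f = f 0%Z + csum (fun n => f (Z.of_nat (S n)) + f (- Z.of_nat (S n))%Z).
Proof.
  intros [H1 H2]; unfold zsum; rewrite (csum_incr_1 (fun n => f (Z.of_nat n))) by auto.
  replace (csum (fun n => f (-1 - Z.of_nat n)%Z)) with (csum (fun n => f (- Z.of_nat (S n))%Z))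
    by (apply csum_ext; intros; f_equal; lia).
  rewrite csum_plus; [change (Z.of_nat 0) with 0%Z; ring| |].
  - now apply (csummable_incr_1 (fun n => f (Z.of_nat n))).
  - revert H2; apply ex_series_ext; intros n; do 2 f_equal; lia.
Qed.

Lemma zsummable_pair_center (f : Z -> C) : zsummable f ->
  csummable (fun n => f (Z.of_nat (S n)) + f (- Z.of_nat (S n))%Z).
Proof.
  intros [H1 H2]; apply csummable_plus.
  - now apply (csummable_incr_1 (fun n => f (Z.of_nat n))).
  - revert H2; apply ex_series_ext; intros n; do 2 f_equal; lia.
Qed.

Lemma IZR_CN (n : nat) : RtoC (IZR (Z.of_nat n)) = CN n.
Proof. unfold CN; now rewrite INR_IZR_INZ. Qed.

(** * Agreement with the trigonometric series, and parity in [z] *)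

Lemma theta1_eq (z t : C) : (0 < Im t)%R -> theta1 z t = dtheta1 0 z t.
Proof.
  intros Ht; pose proof (gterm_summable 0 (1/2) (1/2) z t Ht) as Hs.
  unfold theta1, dtheta1, gtheta; rewrite zsum_pair by auto.
  set (q := cexp (Cpi * Ci * t / 4)).
  assert (Hq : q <> 0) by apply cexp_neq_0.
  assert (H2 : RtoC 2 <> 0) by (apply RtoC_neq; lra).
  rewrite (csum_ext _ (fun n => - / (2 * q) * (gterm 0 (1/2) (1/2) z t (Z.of_nat n)
                          + gterm 0 (1/2) (1/2) z t (-1 - Z.of_nat n)%Z))).
  - rewrite csum_scal by now apply zsummable_pair. field; auto.
  - intros n; unfold gterm; simpl Cpow; rewrite !Cmult_1_l.
    set (A := cexp ((CN n * CN n + CN n) * Cpi * Ci * t)).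
    set (w := (2 * CN n + 1) * Cpi * z).
    (* The square [(n + 1/2)^2 = n^2 + n + 1/4] splits off [q], and the shift [b = 1/2] contributes
       [cexp (PI i (n + 1/2)) = (-1)^n i]. *)
    replace (cexp (Cpi * Ci * (RtoC (IZR (Z.of_nat n) + 1 / 2) * RtoC (IZR (Z.of_nat n) + 1 / 2) * t)
               + 2 * Cpi * Ci * RtoC (IZR (Z.of_nat n) + 1 / 2) * (z + RtoC (1 / 2))))
      with (q * A * sgn n * Ci * cexp (Ci * w)).
    2:{ transitivity (q * A * cexp (CN n * (Cpi * Ci)) * cexp (Cpi * Ci / 2) * cexp (Ci * w));
          [now rewrite cexp_PI_nat, cexp_PI2|].
        unfold q, A, w; rewrite <- !cexp_add; f_equal.
        rewrite RtoC_plus, IZR_CN, RtoC_div by lra; field; auto. }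
    replace (cexp (Cpi * Ci * (RtoC (IZR (-1 - Z.of_nat n) + 1 / 2) * RtoC (IZR (-1 - Z.of_nat n) + 1 / 2) * t)
               + 2 * Cpi * Ci * RtoC (IZR (-1 - Z.of_nat n) + 1 / 2) * (z + RtoC (1 / 2))))
      with (q * A * sgn n * - Ci * cexp (- (Ci * w))).
    2:{ transitivity (q * A * cexp (- (CN n * (Cpi * Ci))) * cexp (- (Cpi * Ci / 2)) * cexp (- (Ci * w)));
          [now rewrite cexp_opp_PI_nat, cexp_opp_PI2|].
        unfold q, A, w; rewrite <- !cexp_add; f_equal.
        rewrite minus_IZR, RtoC_plus, RtoC_minus, IZR_CN, RtoC_div by lra.
        change (IZR (-1)) with (-1)%R; field; auto. }
    unfold csin.
    transitivity (sgn n * A * (- Ci * (cexp (Ci * w) - cexp (- (Ci * w))) / 2)).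
    + replace (- Ci) with (/ Ci); [field; repeat split; auto; apply Ci_nz|].
      replace (- Ci) with (- (Ci * Ci) * / Ci); [rewrite Ci_sqr; ring|field; apply Ci_nz].
    + field; auto.
Qed.

Lemma theta2_eq (z t : C) : (0 < Im t)%R -> theta2 z t = dtheta2 0 z t.
Proof.
  intros Ht; pose proof (gterm_summable 0 (1/2) 0 z t Ht) as Hs.
  unfold theta2, dtheta2, gtheta; rewrite zsum_pair by auto.
  set (q := cexp (Cpi * Ci * t / 4)).
  assert (Hq : q <> 0) by apply cexp_neq_0.
  assert (H2 : RtoC 2 <> 0) by (apply RtoC_neq; lra).
  rewrite (csum_ext _ (fun n => / (2 * q) * (gterm 0 (1/2) 0 z t (Z.of_nat n)
                          + gterm 0 (1/2) 0 z t (-1 - Z.of_nat n)%Z))).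
  - rewrite csum_scal by now apply zsummable_pair. field; auto.
  - intros n; unfold gterm; simpl Cpow; rewrite !Cmult_1_l.
    set (A := cexp ((CN n * CN n + CN n) * Cpi * Ci * t)).
    set (w := (2 * CN n + 1) * Cpi * z).
    replace (cexp (Cpi * Ci * (RtoC (IZR (Z.of_nat n) + 1 / 2) * RtoC (IZR (Z.of_nat n) + 1 / 2) * t)
               + 2 * Cpi * Ci * RtoC (IZR (Z.of_nat n) + 1 / 2) * (z + RtoC 0)))
      with (q * A * cexp (Ci * w)).
    2:{ unfold q, A, w; rewrite <- !cexp_add; f_equal.
        rewrite RtoC_plus, IZR_CN, RtoC_div by lra; field; auto. }
    replace (cexp (Cpi * Ci * (RtoC (IZR (-1 - Z.of_nat n) + 1 / 2) * RtoC (IZR (-1 - Z.of_nat n) + 1 / 2) * t)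
               + 2 * Cpi * Ci * RtoC (IZR (-1 - Z.of_nat n) + 1 / 2) * (z + RtoC 0)))
      with (q * A * cexp (- (Ci * w))).
    2:{ unfold q, A, w; rewrite <- !cexp_add; f_equal.
        rewrite minus_IZR, RtoC_plus, RtoC_minus, IZR_CN, RtoC_div by lra.
        change (IZR (-1)) with (-1)%R; field; auto. }
    unfold ccos; field; auto.
Qed.

Lemma theta3_eq (z t : C) : (0 < Im t)%R -> theta3 z t = dtheta3 0 z t.
Proof.
  intros Ht; pose proof (gterm_summable 0 0 0 z t Ht) as Hs.
  unfold theta3, dtheta3, gtheta; rewrite zsum_pair_center by auto.
  assert (H2 : RtoC 2 <> 0) by (apply RtoC_neq; lra).
  rewrite (csum_ext _ (fun n => / 2 * (gterm 0 0 0 z t (Z.of_nat (S n))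
                          + gterm 0 0 0 z t (- Z.of_nat (S n))%Z))).
  - rewrite csum_scal by now apply zsummable_pair_center.
    replace (gterm 0 0 0 z t 0) with (RtoC 1); [field; auto|].
    unfold gterm; simpl Cpow; rewrite Cmult_1_l, Rplus_0_l, <- cexp_0; f_equal; ring.
  - intros n; unfold gterm; simpl Cpow; rewrite !Cmult_1_l, !Rplus_0_r, opp_IZR, RtoC_opp, IZR_CN.
    set (A := cexp (CN (S n) * CN (S n) * Cpi * Ci * t)).
    set (w := 2 * CN (S n) * Cpi * z).
    transitivity (/ 2 * (A * cexp (Ci * w) + A * cexp (- (Ci * w))));
      [unfold ccos; field; auto|f_equal; f_equal].
    + unfold A, w; rewrite <- !cexp_add; f_equal; ring.
    + unfold A, w; rewrite <- !cexp_add; f_equal; ring.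
Qed.

Lemma theta4_eq (z t : C) : (0 < Im t)%R -> theta4 z t = dtheta4 0 z t.
Proof.
  intros Ht; pose proof (gterm_summable 0 0 (1/2) z t Ht) as Hs.
  unfold theta4, dtheta4, gtheta; rewrite zsum_pair_center by auto.
  assert (H2 : RtoC 2 <> 0) by (apply RtoC_neq; lra).
  rewrite (csum_ext _ (fun n => / 2 * (gterm 0 0 (1/2) z t (Z.of_nat (S n))
                          + gterm 0 0 (1/2) z t (- Z.of_nat (S n))%Z))).
  - rewrite csum_scal by now apply zsummable_pair_center.
    replace (gterm 0 0 (1/2) z t 0) with (RtoC 1); [field; auto|].
    unfold gterm; simpl Cpow; rewrite Cmult_1_l, Rplus_0_l, <- cexp_0; f_equal; ring.
  - intros n; unfold gterm; simpl Cpow; rewrite !Cmult_1_l, !Rplus_0_r, opp_IZR, RtoC_opp, IZR_CN.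
    set (A := cexp (CN (S n) * CN (S n) * Cpi * Ci * t)).
    set (w := 2 * CN (S n) * Cpi * z).
    transitivity (/ 2 * (sgn (S n) * A * cexp (Ci * w) + sgn (S n) * A * cexp (- (Ci * w))));
      [unfold ccos; field; auto|f_equal; f_equal].
    + unfold A, w; rewrite <- cexp_PI_nat, <- !cexp_add; f_equal.
      rewrite RtoC_div by lra; field; auto.
    + unfold A, w; rewrite <- cexp_opp_PI_nat, <- !cexp_add; f_equal.
      rewrite RtoC_div by lra; field; auto.
Qed.

Lemma dtheta1_cder (p : nat) (z t : C) : (0 < Im t)%R ->
  cder (fun w => dtheta1 p w t) z (dtheta1 (S p) z t).
Proof.
  intros Ht; pose proof (cder_mult _ _ _ _ _ (cder_const (-1) z)
    (gtheta_cder_z p (1/2) (1/2) z t Ht)) as H.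
  unfold dtheta1; replace (- gtheta (S p) (1/2) (1/2) z t) with
    (0 * gtheta p (1/2) (1/2) z t + -1 * gtheta (S p) (1/2) (1/2) z t) by ring.
  revert H; apply cder_ext; intros w; ring.
Qed.

Lemma dtheta2_cder (p : nat) (z t : C) : (0 < Im t)%R ->
  cder (fun w => dtheta2 p w t) z (dtheta2 (S p) z t).
Proof. exact (gtheta_cder_z p (1/2) 0 z t). Qed.

Lemma dtheta3_cder (p : nat) (z t : C) : (0 < Im t)%R ->
  cder (fun w => dtheta3 p w t) z (dtheta3 (S p) z t).
Proof. exact (gtheta_cder_z p 0 0 z t). Qed.

Lemma dtheta4_cder (p : nat) (z t : C) : (0 < Im t)%R ->
  cder (fun w => dtheta4 p w t) z (dtheta4 (S p) z t).
Proof. exact (gtheta_cder_z p 0 (1/2) z t). Qed.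

(** Reflection changes [b = 1/2] into [- 1/2]. Moving it back by [1] costs [cexp (PI i) = -1], and
    this makes [theta1] odd where the other thetas are even. *)
Lemma dtheta1_parity (p : nat) (z t : C) : (0 < Im t)%R ->
  dtheta1 p (- z) t = - (-1) ^ p * dtheta1 p z t.
Proof.
  intros Ht; unfold dtheta1.
  pose proof (gtheta_reflect p (1/2) (1/2) z t Ht) as H.
  replace (1 - 1 / 2)%R with (1 / 2)%R in H by field; rewrite H.
  replace (gtheta p (1/2) (1/2) (- z) t) with (- gtheta p (1/2) (- (1/2)) (- z) t).
  - transitivity (((-1) * (-1)) ^ p * gtheta p (1/2) (- (1/2)) (- z) t).
    + replace (-1 * -1) with (RtoC 1) by ring; rewrite Cpow_1_l; ring.
    + rewrite Cpow_mult_l; ring.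
  - replace (1 / 2)%R with (- (1 / 2) + 1)%R at 4 by field.
    rewrite gtheta_shift_b by auto.
    replace (2 * Cpi * Ci * RtoC (1 / 2)) with (Cpi * Ci).
    + rewrite cexp_PI; ring.
    + rewrite RtoC_div by lra; field; apply RtoC_neq; lra.
Qed.

Lemma dtheta2_parity (p : nat) (z t : C) : (0 < Im t)%R ->
  dtheta2 p (- z) t = (-1) ^ p * dtheta2 p z t.
Proof.
  intros Ht; unfold dtheta2.
  pose proof (gtheta_reflect p (1/2) 0 z t Ht) as H.
  replace (1 - 1 / 2)%R with (1 / 2)%R in H by field; rewrite Ropp_0 in H; rewrite H.
  rewrite Cmult_assoc, <- Cpow_mult_l; replace (-1 * -1) with (RtoC 1) by ring.
  rewrite Cpow_1_l; ring.
Qed.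

Lemma dtheta3_parity (p : nat) (z t : C) : (0 < Im t)%R ->
  dtheta3 p (- z) t = (-1) ^ p * dtheta3 p z t.
Proof.
  intros Ht; unfold dtheta3.
  pose proof (gtheta_reflect p 0 0 z t Ht) as H.
  replace (1 - 0)%R with (0 + 1)%R in H by ring.
  rewrite Ropp_0, gtheta_shift_a in H by auto; rewrite H.
  rewrite Cmult_assoc, <- Cpow_mult_l; replace (-1 * -1) with (RtoC 1) by ring.
  rewrite Cpow_1_l; ring.
Qed.

Lemma gtheta_0_half (p : nat) (z t : C) : (0 < Im t)%R ->
  gtheta p 0 (- (1/2)) z t = gtheta p 0 (1/2) z t.
Proof.
  intros Ht; replace (1 / 2)%R with (- (1 / 2) + 1)%R at 2 by field.
  rewrite gtheta_shift_b by auto; rewrite Cmult_0_r, cexp_0; ring.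
Qed.

Lemma dtheta4_parity (p : nat) (z t : C) : (0 < Im t)%R ->
  dtheta4 p (- z) t = (-1) ^ p * dtheta4 p z t.
Proof.
  intros Ht; unfold dtheta4.
  pose proof (gtheta_reflect p 0 (1/2) z t Ht) as H.
  replace (1 - 0)%R with (0 + 1)%R in H by ring.
  rewrite gtheta_0_half, gtheta_shift_a in H by auto; rewrite H.
  rewrite Cmult_assoc, <- Cpow_mult_l; replace (-1 * -1) with (RtoC 1) by ring.
  rewrite Cpow_1_l; ring.
Qed.

Lemma Im_double_pos (t : C) : (0 < Im t)%R -> (0 < Im (2 * t))%R.
Proof. rewrite im_scal_l; lra. Qed.

Lemma gtheta_half_1 (p : nat) (z t : C) : (0 < Im t)%R ->
  gtheta p (1/2) 1 z t = - gtheta p (1/2) 0 z t.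
Proof.
  intros Ht; replace 1%R with (0 + 1)%R at 2 by ring; rewrite gtheta_shift_b by auto.
  replace (2 * Cpi * Ci * RtoC (1 / 2)) with (Cpi * Ci).
  - rewrite cexp_PI; ring.
  - rewrite RtoC_div by lra; field; apply RtoC_neq; lra.
Qed.

Lemma gtheta_half_neg_half (p : nat) (z t : C) : (0 < Im t)%R ->
  gtheta p (1/2) (- (1/2)) z t = - gtheta p (1/2) (1/2) z t.
Proof.
  intros Ht; replace (1/2)%R with (- (1/2) + 1)%R at 4 by field; rewrite gtheta_shift_b by auto.
  replace (2 * Cpi * Ci * RtoC (1 / 2)) with (Cpi * Ci).
  - rewrite cexp_PI; ring.
  - rewrite RtoC_div by lra; field; apply RtoC_neq; lra.
Qed.

Lemma gtheta_1 (p : nat) (b : R) (z t : C) : (0 < Im t)%R ->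
  gtheta p 1 b z t = gtheta p 0 b z t.
Proof.
  intros Ht; replace 1%R with (0 + 1)%R by ring; now rewrite gtheta_shift_a.
Qed.

Lemma gtheta_0_1 (p : nat) (z t : C) : (0 < Im t)%R ->
  gtheta p 0 1 z t = gtheta p 0 0 z t.
Proof.
  intros Ht; replace 1%R with (0 + 1)%R by ring.
  rewrite gtheta_shift_b, Cmult_0_r, cexp_0 by auto; ring.
Qed.

(** * Products of pairs of thetas in terms of [2 x], [2 y] and parameter [2 t] *)

Lemma theta33_product (x y t : C) : (0 < Im t)%R ->
  dtheta3 0 (x + y) t * dtheta3 0 (x - y) t =
  dtheta3 0 (2 * x) (2 * t) * dtheta3 0 (2 * y) (2 * t) +
  dtheta2 0 (2 * x) (2 * t) * dtheta2 0 (2 * y) (2 * t).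
Proof.
  intros Ht; unfold dtheta2, dtheta3; rewrite gtheta_product by auto.
  replace ((0 + 0) / 2)%R with 0%R by field; replace ((0 - 0) / 2)%R with 0%R by field.
  replace ((1 + 0 + 0) / 2)%R with (1/2)%R by field; replace ((1 + 0 - 0) / 2)%R with (1/2)%R by field.
  replace (0 + 0)%R with 0%R by ring; replace (0 - 0)%R with 0%R by ring; reflexivity.
Qed.

Lemma theta44_product (x y t : C) : (0 < Im t)%R ->
  dtheta4 0 (x + y) t * dtheta4 0 (x - y) t =
  dtheta3 0 (2 * x) (2 * t) * dtheta3 0 (2 * y) (2 * t) -
  dtheta2 0 (2 * x) (2 * t) * dtheta2 0 (2 * y) (2 * t).
Proof.
  intros Ht; pose proof (Im_double_pos t Ht); unfold dtheta2, dtheta3, dtheta4.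
  rewrite gtheta_product by auto.
  replace ((0 + 0) / 2)%R with 0%R by field; replace ((0 - 0) / 2)%R with 0%R by field.
  replace ((1 + 0 + 0) / 2)%R with (1/2)%R by field; replace ((1 + 0 - 0) / 2)%R with (1/2)%R by field.
  replace (1/2 + 1/2)%R with 1%R by field; replace (1/2 - 1/2)%R with 0%R by ring.
  rewrite gtheta_half_1 by auto.
  rewrite gtheta_0_1 by auto; ring.
Qed.

Lemma theta22_product (x y t : C) : (0 < Im t)%R ->
  dtheta2 0 (x + y) t * dtheta2 0 (x - y) t =
  dtheta2 0 (2 * x) (2 * t) * dtheta3 0 (2 * y) (2 * t) +
  dtheta3 0 (2 * x) (2 * t) * dtheta2 0 (2 * y) (2 * t).
Proof.
  intros Ht; pose proof (Im_double_pos t Ht); unfold dtheta2, dtheta3.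
  rewrite gtheta_product by auto.
  replace ((1/2 + 1/2) / 2)%R with (1/2)%R by field; replace ((1/2 - 1/2) / 2)%R with 0%R by field.
  replace ((1 + 1/2 + 1/2) / 2)%R with 1%R by field; replace ((1 + 1/2 - 1/2) / 2)%R with (1/2)%R by field.
  replace (0 + 0)%R with 0%R by ring; replace (0 - 0)%R with 0%R by ring.
  now rewrite gtheta_1.
Qed.

Lemma theta11_product (x y t : C) : (0 < Im t)%R ->
  dtheta1 0 (x + y) t * dtheta1 0 (x - y) t =
  dtheta3 0 (2 * x) (2 * t) * dtheta2 0 (2 * y) (2 * t) -
  dtheta2 0 (2 * x) (2 * t) * dtheta3 0 (2 * y) (2 * t).
Proof.
  intros Ht; pose proof (Im_double_pos t Ht); unfold dtheta1, dtheta2, dtheta3.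
  match goal with |- - ?u * - ?v = _ => replace (- u * - v) with (u * v) by ring end.
  rewrite gtheta_product by auto.
  replace ((1/2 + 1/2) / 2)%R with (1/2)%R by field; replace ((1/2 - 1/2) / 2)%R with 0%R by field.
  replace ((1 + 1/2 + 1/2) / 2)%R with 1%R by field; replace ((1 + 1/2 - 1/2) / 2)%R with (1/2)%R by field.
  replace (1/2 + 1/2)%R with 1%R by field; replace (1/2 - 1/2)%R with 0%R by ring.
  rewrite gtheta_half_1, gtheta_1 by auto.
  rewrite gtheta_0_1 by auto; ring.
Qed.

Lemma theta12_product (x y t : C) : (0 < Im t)%R ->
  dtheta1 0 (x + y) t * dtheta2 0 (x - y) t =
  dtheta1 0 (2 * x) (2 * t) * dtheta4 0 (2 * y) (2 * t) +
  dtheta4 0 (2 * x) (2 * t) * dtheta1 0 (2 * y) (2 * t).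
Proof.
  intros Ht; pose proof (Im_double_pos t Ht); unfold dtheta1, dtheta2, dtheta4.
  match goal with |- - ?u * ?v = _ => replace (- u * v) with (- (u * v)) by ring end.
  rewrite gtheta_product by auto.
  replace ((1/2 + 1/2) / 2)%R with (1/2)%R by field; replace ((1/2 - 1/2) / 2)%R with 0%R by field.
  replace ((1 + 1/2 + 1/2) / 2)%R with 1%R by field; replace ((1 + 1/2 - 1/2) / 2)%R with (1/2)%R by field.
  rewrite Rplus_0_r, Rminus_0_r, gtheta_1 by auto; ring.
Qed.

Lemma theta34_product (x y t : C) : (0 < Im t)%R ->
  dtheta3 0 (x + y) t * dtheta4 0 (x - y) t =
  dtheta4 0 (2 * x) (2 * t) * dtheta4 0 (2 * y) (2 * t) -
  dtheta1 0 (2 * x) (2 * t) * dtheta1 0 (2 * y) (2 * t).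
Proof.
  intros Ht; pose proof (Im_double_pos t Ht); unfold dtheta1, dtheta3, dtheta4.
  rewrite gtheta_product by auto.
  replace ((0 + 0) / 2)%R with 0%R by field; replace ((0 - 0) / 2)%R with 0%R by field.
  replace ((1 + 0 + 0) / 2)%R with (1/2)%R by field; replace ((1 + 0 - 0) / 2)%R with (1/2)%R by field.
  rewrite Rplus_0_l, Rminus_0_l, gtheta_0_half, gtheta_half_neg_half by auto; ring.
Qed.

Lemma gtheta_quarter_1 (b : R) (z t : C) : (0 < Im t)%R ->
  gtheta 0 (1/4) (b + 1) z t = Ci * gtheta 0 (1/4) b z t.
Proof.
  intros Ht; rewrite gtheta_shift_b by auto; f_equal.
  transitivity (cexp (Cpi * Ci / 2)); [f_equal|apply cexp_PI2].
  rewrite RtoC_div by lra; field; split; apply RtoC_neq; lra.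
Qed.

Lemma gtheta_3_quarters (b : R) (z t : C) : (0 < Im t)%R ->
  gtheta 0 (3/4) b z t = gtheta 0 (1/4) (- b) (- z) t.
Proof.
  intros Ht; replace (3/4)%R with (1 - 1/4)%R by field.
  rewrite gtheta_reflect by auto; simpl; ring.
Qed.

(** The characteristics [1/4] and [3/4 = 1 - 1/4] are exchanged by reflection, so a single function
    and its values at opposite arguments remain. The companion [theta24_product] has the same two
    terms with a plus sign, as required by [wronskian_of_products]. *)
Lemma theta13_product (x y t : C) : (0 < Im t)%R ->
  dtheta1 0 (x + y) t * dtheta3 0 (x - y) t =
  - (gtheta 0 (1/4) (1/2) (2 * x) (2 * t) * gtheta 0 (1/4) (1/2) (2 * y) (2 * t) -
     gtheta 0 (1/4) (1/2) (- (2 * x)) (2 * t) * gtheta 0 (1/4) (1/2) (- (2 * y)) (2 * t)).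
Proof.
  intros Ht; pose proof (Im_double_pos t Ht); unfold dtheta1, dtheta3.
  match goal with |- - ?u * ?v = _ => replace (- u * v) with (- (u * v)) by ring end.
  rewrite gtheta_product by auto; f_equal.
  replace ((1/2 + 0) / 2)%R with (1/4)%R by field; replace ((1/2 - 0) / 2)%R with (1/4)%R by field.
  replace ((1 + 1/2 + 0) / 2)%R with (3/4)%R by field; replace ((1 + 1/2 - 0) / 2)%R with (3/4)%R by field.
  rewrite Rplus_0_r, Rminus_0_r, !gtheta_3_quarters by auto.
  assert (Hs : forall w, gtheta 0 (1/4) (1/2) w (2 * t) = Ci * gtheta 0 (1/4) (- (1/2)) w (2 * t)).
  { intros w; rewrite <- gtheta_quarter_1 by auto; f_equal; field. }
  rewrite (Hs (- (2 * x))), (Hs (- (2 * y))).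
  pose proof Ci_sqr as Hi; ring [Hi].
Qed.

Lemma theta24_product (x y t : C) : (0 < Im t)%R ->
  dtheta2 0 (x + y) t * dtheta4 0 (x - y) t =
  - Ci * (gtheta 0 (1/4) (1/2) (2 * x) (2 * t) * gtheta 0 (1/4) (1/2) (2 * y) (2 * t) +
     gtheta 0 (1/4) (1/2) (- (2 * x)) (2 * t) * gtheta 0 (1/4) (1/2) (- (2 * y)) (2 * t)).
Proof.
  intros Ht; pose proof (Im_double_pos t Ht); unfold dtheta2, dtheta4.
  rewrite gtheta_product by auto.
  replace ((1/2 + 0) / 2)%R with (1/4)%R by field; replace ((1/2 - 0) / 2)%R with (1/4)%R by field.
  replace ((1 + 1/2 + 0) / 2)%R with (3/4)%R by field; replace ((1 + 1/2 - 0) / 2)%R with (3/4)%R by field.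
  rewrite Rplus_0_l, Rminus_0_l, !gtheta_3_quarters, Ropp_involutive by auto.
  assert (Hs : forall w, gtheta 0 (1/4) (1/2) w (2 * t) = Ci * gtheta 0 (1/4) (- (1/2)) w (2 * t)).
  { intros w; rewrite <- gtheta_quarter_1 by auto; f_equal; field. }
  rewrite !Hs.
  pose proof Ci_sqr as Hi; ring [Hi].
Qed.

Lemma theta14_product (x y t : C) : (0 < Im t)%R ->
  dtheta1 0 (x + y) t * dtheta4 0 (x - y) t =
  - Ci * (gtheta 0 (1/4) 0 (2 * x) (2 * t) * gtheta 0 (1/4) 0 (2 * y) (2 * t) -
     gtheta 0 (1/4) 0 (- (2 * x)) (2 * t) * gtheta 0 (1/4) 0 (- (2 * y)) (2 * t)).
Proof.
  intros Ht; pose proof (Im_double_pos t Ht); unfold dtheta1, dtheta4.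
  match goal with |- - ?u * ?v = _ => replace (- u * v) with (- (u * v)) by ring end.
  rewrite gtheta_product by auto.
  replace ((1/2 + 0) / 2)%R with (1/4)%R by field; replace ((1/2 - 0) / 2)%R with (1/4)%R by field.
  replace ((1 + 1/2 + 0) / 2)%R with (3/4)%R by field; replace ((1 + 1/2 - 0) / 2)%R with (3/4)%R by field.
  replace (1/2 + 1/2)%R with (0 + 1)%R by field; replace (1/2 - 1/2)%R with 0%R by ring.
  rewrite !gtheta_3_quarters, gtheta_quarter_1, Ropp_0 by auto.
  assert (Hs : forall w, gtheta 0 (1/4) 0 w (2 * t) = Ci * gtheta 0 (1/4) (- (0 + 1)) w (2 * t)).
  { intros w; rewrite <- gtheta_quarter_1 by auto; f_equal; field. }
  rewrite (Hs (- (2 * x))).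
  pose proof Ci_sqr as Hi; ring [Hi].
Qed.

Lemma theta23_product (x y t : C) : (0 < Im t)%R ->
  dtheta2 0 (x + y) t * dtheta3 0 (x - y) t =
  gtheta 0 (1/4) 0 (2 * x) (2 * t) * gtheta 0 (1/4) 0 (2 * y) (2 * t) +
  gtheta 0 (1/4) 0 (- (2 * x)) (2 * t) * gtheta 0 (1/4) 0 (- (2 * y)) (2 * t).
Proof.
  intros Ht; pose proof (Im_double_pos t Ht); unfold dtheta2, dtheta3.
  rewrite gtheta_product by auto.
  replace ((1/2 + 0) / 2)%R with (1/4)%R by field; replace ((1/2 - 0) / 2)%R with (1/4)%R by field.
  replace ((1 + 1/2 + 0) / 2)%R with (3/4)%R by field; replace ((1 + 1/2 - 0) / 2)%R with (3/4)%R by field.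
  replace (0 + 0)%R with 0%R by field; replace (0 - 0)%R with 0%R by ring.
  now rewrite !gtheta_3_quarters, Ropp_0.
Qed.

(** * Wronskians and doubling *)

Lemma cder_shift (f : C -> C) (x l y0 : C) : cder f (x + y0) l -> cder (fun y => f (x + y)) y0 l.
Proof.
  intros H; replace l with (1 * l) by ring.
  apply cder_ext with (fun y => f (1 * y + x)); [intros; f_equal; ring|].
  apply cder_affine; now replace (1 * y0 + x) with (x + y0) by ring.
Qed.

Lemma cder_reflect (f : C -> C) (x l y0 : C) :
  cder f (x - y0) l -> cder (fun y => f (x - y)) y0 (- l).
Proof.
  intros H; replace (- l) with (-1 * l) by ring.
  apply cder_ext with (fun y => f (-1 * y + x)); [intros; f_equal; ring|].
  apply cder_affine; now replace (-1 * y0 + x) with (x - y0) by ring.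
Qed.

Lemma cder_eq (f : C -> C) (z l l' : C) : l = l' -> cder f z l -> cder f z l'.
Proof. intros; now subst. Qed.

Lemma cder_product_shift (f g f' g' : C -> C) (x y : C) :
  (forall w, cder f w (f' w)) -> (forall w, cder g w (g' w)) ->
  cder (fun y => f (x + y) * g (x - y)) y (f' (x + y) * g (x - y) - f (x + y) * g' (x - y)).
Proof.
  intros Hf Hg.
  pose proof (cder_mult _ _ _ _ _ (cder_shift f x _ y (Hf (x + y))) (cder_reflect g x _ y (Hg (x - y)))) as H.
  revert H; apply cder_eq; simpl; ring.
Qed.

Lemma cder_scal (c : C) (f : C -> C) (z l : C) : cder f z l -> cder (fun w => c * f w) z (c * l).
Proof.
  intros H; apply cder_eq with (0 * f z + c * l); [ring|].
  exact (cder_mult _ _ _ _ _ (cder_const c z) H).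
Qed.

(* Both products are, up to constants, multiples of [H x + H (- x)] after setting [y = 0],
   in the first case after differentiating in [y]. *)
Lemma wronskian_of_products (f g h k H f' g' : C -> C) (H' c d : C) :
  (forall w, cder f w (f' w)) -> (forall w, cder g w (g' w)) -> cder H 0 H' ->
  (forall x y, f (x + y) * g (x - y) = c * (H x * H y - H (- x) * H (- y))) ->
  (forall x y, h (x + y) * k (x - y) = d * (H x * H y + H (- x) * H (- y))) ->
  forall x, (f' x * g x - f x * g' x) * (h 0 * k 0)
            = (f' 0 * g 0 - f 0 * g' 0) * (h x * k x).
Proof.
  intros Hf Hg HH Hfg Hhk.
  assert (HW : forall x, f' x * g x - f x * g' x = c * H' * (H x + H (- x))).
  { intros x.
    pose proof (cder_product_shift f g f' g' x 0 Hf Hg) as H1.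
    rewrite Cplus_0_r in H1; replace (x - 0) with x in H1 by ring.
    apply (cder_unique _ _ _ _ H1).
    apply cder_ext with (fun y => c * (H x * H y + - H (- x) * H (0 - y))).
    - intros y; rewrite Hfg; replace (0 - y) with (- y) by ring; ring.
    - replace (c * H' * (H x + H (- x))) with (c * (H x * H' + - H (- x) * - H')) by ring.
      apply cder_scal, cder_plus; apply cder_scal; auto.
      apply cder_reflect; now replace (0 - 0) with (RtoC 0) by ring. }
  assert (HK : forall x, h x * k x = d * H 0 * (H x + H (- x))).
  { intros x; pose proof (Hhk x 0) as E.
    rewrite Cplus_0_r in E; replace (x - 0) with x in E by ring.
    rewrite E; replace (- 0) with (RtoC 0) by ring; ring. }
  intros x; rewrite (HW x), (HW 0), (HK x), (HK 0); replace (- 0) with (RtoC 0) by ring; ring.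
Qed.

Lemma C_eq_opp_0 (u : C) : u = - u -> u = 0.
Proof.
  intros H; apply NNPP; intros Hn.
  assert (H2 : 2 * u = 0) by (transitivity (u - - u); [ring|rewrite <- H; ring]).
  revert H2; apply Cmult_neq_0; auto; apply RtoC_neq; lra.
Qed.

Lemma dtheta1_at_0 (p : nat) (t : C) : (0 < Im t)%R -> dtheta1 (2 * p) 0 t = 0.
Proof.
  intros Ht; pose proof (dtheta1_parity (2 * p) 0 t Ht) as H.
  rewrite Cpow_mult_r in H; replace (- 0) with (RtoC 0) in H by ring.
  replace ((-1) ^ 2) with (RtoC 1) in H by (simpl; ring); rewrite Cpow_1_l in H.
  apply C_eq_opp_0; rewrite H at 1; ring.
Qed.

Lemma even_derivative_at_0 (u : C) : u = (-1) ^ 1 * u -> u = 0.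
Proof. intros H; apply C_eq_opp_0; rewrite H at 1; simpl; ring. Qed.

Lemma dtheta2_1_at_0 (t : C) : (0 < Im t)%R -> dtheta2 1 0 t = 0.
Proof.
  intros Ht; pose proof (dtheta2_parity 1 0 t Ht) as H.
  replace (- 0) with (RtoC 0) in H by ring; now apply even_derivative_at_0.
Qed.

Lemma dtheta3_1_at_0 (t : C) : (0 < Im t)%R -> dtheta3 1 0 t = 0.
Proof.
  intros Ht; pose proof (dtheta3_parity 1 0 t Ht) as H.
  replace (- 0) with (RtoC 0) in H by ring; now apply even_derivative_at_0.
Qed.

Lemma dtheta4_1_at_0 (t : C) : (0 < Im t)%R -> dtheta4 1 0 t = 0.
Proof.
  intros Ht; pose proof (dtheta4_parity 1 0 t Ht) as H.
  replace (- 0) with (RtoC 0) in H by ring; now apply even_derivative_at_0.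
Qed.

Lemma dtheta1_cder_double (z t : C) : (0 < Im t)%R ->
  cder (fun w => dtheta1 0 (2 * w) (2 * t)) z (2 * dtheta1 1 (2 * z) (2 * t)).
Proof.
  intros Ht; apply cder_ext with (fun w => dtheta1 0 (2 * w + 0) (2 * t));
    [intros; f_equal; ring|].
  apply (cder_affine (fun w => dtheta1 0 w (2 * t))); rewrite Cplus_0_r.
  apply dtheta1_cder, Im_double_pos, Ht.
Qed.

Lemma gtheta_cder_double (p : nat) (a b : R) (z t : C) : (0 < Im t)%R ->
  cder (fun w => gtheta p a b (2 * w) (2 * t)) z (2 * gtheta (S p) a b (2 * z) (2 * t)).
Proof.
  intros Ht; apply cder_ext with (fun w => gtheta p a b (2 * w + 0) (2 * t));
    [intros; f_equal; ring|].
  apply (cder_affine (fun w => gtheta p a b w (2 * t))); rewrite Cplus_0_r.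
  apply gtheta_cder_z, Im_double_pos, Ht.
Qed.

(** No quarter characteristic occurs here, so [H] is assembled as [V + i U] from the even function
    [V] and the odd function [U]. Then [H x * H y - H (- x) * H (- y) = 2 i (V x * U y + U x * V
    y)], and with a plus sign the value is [2 (V x * V y - U x * U y)], hence the constants
    [/ (2 * Ci)] and [/ 2]. *)
Lemma wronskian12 (x t : C) : (0 < Im t)%R ->
  (dtheta1 1 x t * dtheta2 0 x t - dtheta1 0 x t * dtheta2 1 x t) *
    (dtheta3 0 0 t * dtheta4 0 0 t) =
  dtheta1 1 0 t * dtheta2 0 0 t * (dtheta3 0 x t * dtheta4 0 x t).
Proof.
  intros Ht.
  set (V := fun w => dtheta4 0 (2 * w) (2 * t)); set (U := fun w => dtheta1 0 (2 * w) (2 * t)).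
  pose proof (Im_double_pos t Ht) as Ht2.
  assert (HV : forall w, V (- w) = V w).
  { intros w; unfold V; replace (2 * - w) with (- (2 * w)) by ring.
    rewrite dtheta4_parity by auto; simpl; ring. }
  assert (HU : forall w, U (- w) = - U w).
  { intros w; unfold U; replace (2 * - w) with (- (2 * w)) by ring.
    rewrite dtheta1_parity by auto; simpl; ring. }
  assert (H2 : RtoC 2 <> 0) by (apply RtoC_neq; lra).
  pose proof (wronskian_of_products (fun w => dtheta1 0 w t) (fun w => dtheta2 0 w t)
    (fun w => dtheta3 0 w t) (fun w => dtheta4 0 w t) (fun w => V w + Ci * U w)
    (fun w => dtheta1 1 w t) (fun w => dtheta2 1 w t)
    (2 * dtheta4 1 (2 * 0) (2 * t) + Ci * (2 * dtheta1 1 (2 * 0) (2 * t)))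
    (/ (2 * Ci)) (/ 2)) as H.
  rewrite H; clear H.
  - rewrite dtheta2_1_at_0 by auto; ring.
  - intros w; now apply dtheta1_cder.
  - intros w; now apply dtheta2_cder.
  - apply cder_plus; [exact (gtheta_cder_double 0 0 (1/2) 0 t Ht)|].
    apply cder_scal; now apply dtheta1_cder_double.
  - intros a b; rewrite !HV, !HU, theta12_product by auto.
    fold (U a) (U b) (V a) (V b); field; auto using Ci_nz.
  - intros a b; rewrite !HV, !HU, theta34_product by auto.
    fold (U a) (U b) (V a) (V b).
    transitivity (V a * V b + (Ci * Ci) * (U a * U b)); [rewrite Ci_sqr; ring|field; auto].
Qed.

Lemma wronskian13 (x t : C) : (0 < Im t)%R ->
  (dtheta1 1 x t * dtheta3 0 x t - dtheta1 0 x t * dtheta3 1 x t) *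
    (dtheta2 0 0 t * dtheta4 0 0 t) =
  dtheta1 1 0 t * dtheta3 0 0 t * (dtheta2 0 x t * dtheta4 0 x t).
Proof.
  intros Ht.
  pose proof (wronskian_of_products (fun w => dtheta1 0 w t) (fun w => dtheta3 0 w t)
    (fun w => dtheta2 0 w t) (fun w => dtheta4 0 w t)
    (fun w => gtheta 0 (1/4) (1/2) (2 * w) (2 * t))
    (fun w => dtheta1 1 w t) (fun w => dtheta3 1 w t)
    (2 * gtheta 1 (1/4) (1/2) (2 * 0) (2 * t)) (-1) (- Ci)) as H.
  rewrite H; clear H.
  - rewrite dtheta3_1_at_0 by auto; ring.
  - intros w; now apply dtheta1_cder.
  - intros w; now apply dtheta3_cder.
  - now apply gtheta_cder_double.
  - intros a b; rewrite theta13_product by auto.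
    replace (2 * - a) with (- (2 * a)) by ring; replace (2 * - b) with (- (2 * b)) by ring; ring.
  - intros a b; rewrite theta24_product by auto.
    replace (2 * - a) with (- (2 * a)) by ring; replace (2 * - b) with (- (2 * b)) by ring; ring.
Qed.

Lemma wronskian14 (x t : C) : (0 < Im t)%R ->
  (dtheta1 1 x t * dtheta4 0 x t - dtheta1 0 x t * dtheta4 1 x t) *
    (dtheta2 0 0 t * dtheta3 0 0 t) =
  dtheta1 1 0 t * dtheta4 0 0 t * (dtheta2 0 x t * dtheta3 0 x t).
Proof.
  intros Ht.
  pose proof (wronskian_of_products (fun w => dtheta1 0 w t) (fun w => dtheta4 0 w t)
    (fun w => dtheta2 0 w t) (fun w => dtheta3 0 w t)
    (fun w => gtheta 0 (1/4) 0 (2 * w) (2 * t))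
    (fun w => dtheta1 1 w t) (fun w => dtheta4 1 w t)
    (2 * gtheta 1 (1/4) 0 (2 * 0) (2 * t)) (- Ci) 1) as H.
  rewrite H; clear H.
  - rewrite dtheta4_1_at_0 by auto; ring.
  - intros w; now apply dtheta1_cder.
  - intros w; now apply dtheta4_cder.
  - now apply gtheta_cder_double.
  - intros a b; rewrite theta14_product by auto.
    replace (2 * - a) with (- (2 * a)) by ring; replace (2 * - b) with (- (2 * b)) by ring; ring.
  - intros a b; rewrite theta23_product by auto.
    replace (2 * - a) with (- (2 * a)) by ring; replace (2 * - b) with (- (2 * b)) by ring; ring.
Qed.

Lemma theta2_doubling (t : C) : (0 < Im t)%R ->
  dtheta2 0 0 t * dtheta2 0 0 t = 2 * (dtheta2 0 0 (2 * t) * dtheta3 0 0 (2 * t)).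
Proof.
  intros Ht; pose proof (theta22_product 0 0 t Ht) as H.
  replace (0 + 0) with (RtoC 0) in H by ring; replace (0 - 0) with (RtoC 0) in H by ring.
  rewrite H, Cmult_0_r; ring.
Qed.

Lemma theta34_doubling (t : C) : (0 < Im t)%R ->
  dtheta3 0 0 t * dtheta4 0 0 t = dtheta4 0 0 (2 * t) * dtheta4 0 0 (2 * t).
Proof.
  intros Ht; pose proof (theta34_product 0 0 t Ht) as H.
  replace (0 + 0) with (RtoC 0) in H by ring; replace (0 - 0) with (RtoC 0) in H by ring.
  rewrite H, Cmult_0_r, (dtheta1_at_0 0) by now apply Im_double_pos. ring.
Qed.

(** The [y]-derivative of [theta12_product] at [x = y = 0], where [theta1] vanishes. *)
Lemma theta1'_doubling (t : C) : (0 < Im t)%R ->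
  dtheta1 1 0 t * dtheta2 0 0 t = 2 * (dtheta1 1 0 (2 * t) * dtheta4 0 0 (2 * t)).
Proof.
  intros Ht; pose proof (Im_double_pos t Ht) as Ht2.
  pose proof (cder_product_shift (fun w => dtheta1 0 w t) (fun w => dtheta2 0 w t)
    (fun w => dtheta1 1 w t) (fun w => dtheta2 1 w t) 0 0
    (fun w => dtheta1_cder 0 w t Ht) (fun w => dtheta2_cder 0 w t Ht)) as H.
  replace (0 + 0) with (RtoC 0) in H by ring; replace (0 - 0) with (RtoC 0) in H by ring.
  rewrite dtheta2_1_at_0 in H by auto.
  replace (dtheta1 1 0 t * dtheta2 0 0 t) with
    (dtheta1 1 0 t * dtheta2 0 0 t - dtheta1 0 0 t * 0) by ring.
  apply (cder_unique _ _ _ _ H).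
  apply cder_ext with (fun y => dtheta4 0 (2 * 0) (2 * t) * dtheta1 0 (2 * y) (2 * t)).
  - intros y; rewrite theta12_product, Cmult_0_r, (dtheta1_at_0 0) by auto; ring.
  - apply cder_eq with (dtheta4 0 (2 * 0) (2 * t) * (2 * dtheta1 1 (2 * 0) (2 * t)));
      [rewrite Cmult_0_r; ring|].
    now apply cder_scal, dtheta1_cder_double.
Qed.

Lemma clim_cexp_doubling (e : R) (t : C) : (0 < e)%R -> (0 < Im t)%R ->
  clim (fun n => cexp (RtoC e * Cpi * Ci * (RtoC (2 ^ n) * t))) 0.
Proof.
  intros He Ht eps Heps; pose proof PI_RGT_0 as Hpi.
  set (y := (e * PI * Im t)%R).
  assert (Hy : (0 < y)%R) by (unfold y; apply Rmult_lt_0_compat; [apply Rmult_lt_0_compat|]; auto).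
  assert (Hlt : (Rabs (exp (- y)) < 1)%R).
  { rewrite Rabs_right by (left; apply exp_pos); rewrite <- exp_0; apply exp_increasing; lra. }
  destruct (pow_lt_1_zero _ Hlt eps Heps) as [N HN].
  exists N; intros n Hn; specialize (HN n Hn).
  replace (_ - 0) with (cexp (RtoC e * Cpi * Ci * (RtoC (2 ^ n) * t))) by ring.
  rewrite Cmod_cexp; eapply Rle_lt_trans; [|exact HN].
  rewrite Rabs_right by (left; apply pow_lt, exp_pos).
  rewrite <- exp_INR_mult; apply exp_le.
  replace (Re (RtoC e * Cpi * Ci * (RtoC (2 ^ n) * t))) with (- (2 ^ n * y))%R
    by (unfold y; destruct t; simpl; ring).
  assert (INR n <= 2 ^ n)%R.
  { clear; induction n as [|n IH]; [simpl; lra|].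
    rewrite S_INR; simpl; assert (1 <= 2 ^ n)%R by (apply pow_R1_Rle; lra); lra. }
  nra.
Qed.

(** All exponents are nonnegative, so the series at [t] itself dominates those at [2 ^ n t]; only
    the terms of exponent [0] survive in the limit. *)
Lemma csum_doubling_limit (w b : nat -> C) (e : nat -> R) (t : C) : (0 < Im t)%R ->
  (forall k, (e k = 0%R /\ b k = w k) \/ ((0 < e k)%R /\ b k = 0)) ->
  csummable (fun k => w k * cexp (RtoC (e k) * Cpi * Ci * t)) ->
  clim (fun n => csum (fun k => w k * cexp (RtoC (e k) * Cpi * Ci * (RtoC (2 ^ n) * t)))) (csum b).
Proof.
  intros Ht He Hs.
  apply clim_csum_dominated with (fun k => Cmod (w k * cexp (RtoC (e k) * Cpi * Ci * t))); auto.
  - intros n k; rewrite !Cmod_mult, !Cmod_cexp; apply Rmult_le_compat_l; [apply Cmod_ge_0|].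
    apply exp_le.
    replace (Re (RtoC (e k) * Cpi * Ci * (RtoC (2 ^ n) * t))) with (- (2 ^ n * (e k * PI * Im t)))%R
      by (destruct t; simpl; ring).
    replace (Re (RtoC (e k) * Cpi * Ci * t)) with (- (e k * PI * Im t))%R
      by (destruct t; simpl; ring).
    assert (1 <= 2 ^ n)%R by (apply pow_R1_Rle; lra).
    assert (0 <= e k * PI * Im t)%R.
    { pose proof PI_RGT_0; destruct (He k) as [[H' _]|[H' _]].
      - rewrite H'; lra.
      - apply Rmult_le_pos; [apply Rmult_le_pos|]; lra. }
    nra.
  - intros k; destruct (He k) as [[H1 H2]|[H1 H2]]; rewrite H2.
    + apply clim_ext with (fun _ => w k); [|apply clim_const].
      intros n; rewrite H1, !Cmult_0_l, cexp_0; ring.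
    + rewrite <- (Cmult_0_r (w k)); apply clim_mult; [apply clim_const|].
      now apply clim_cexp_doubling.
Qed.

Lemma csum_zero : csum (fun _ => RtoC 0) = 0.
Proof.
  assert (H : csummable (fun _ => RtoC 0)).
  { apply csummable_dominated with (fun n => 0 * exp (- INR n))%R;
      [intros; rewrite Cmod_0; lra|apply ex_series_exp_opp]. }
  transitivity (csum (fun _ => 0 * RtoC 0)); [apply csum_ext; intros; ring|].
  rewrite (csum_scal 0 _ H); ring.
Qed.

Lemma csum_first (c : C) : csum (fun k => match k with O => c | S _ => RtoC 0 end) = c.
Proof.
  rewrite csum_incr_1; [rewrite csum_zero; ring|].
  apply (csummable_dominated _ (fun k => Cmod c * exp 0 * exp (- INR k))%R).
  - intros [|k]; [simpl INR; rewrite Ropp_0, exp_0; lra|rewrite Cmod_0].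
    apply Rmult_le_pos; [|apply Rlt_le, exp_pos].
    apply Rmult_le_pos; [apply Cmod_ge_0|apply Rlt_le, exp_pos].
  - apply ex_series_exp_opp.
Qed.

Lemma CN_exponent (k : nat) : CN k * CN k + CN k = RtoC (INR k * INR k + INR k).
Proof. unfold CN; now rewrite RtoC_plus, RtoC_mult. Qed.

Lemma odd_series_summable (p : nat) (t : C) : (0 < Im t)%R ->
  csummable (fun k => (2 * CN k + 1) ^ p * cexp ((CN k * CN k + CN k) * Cpi * Ci * t)).
Proof.
  intros Ht; destruct (gterm_summable p (1/2) 0 0 t Ht) as [H _].
  apply (csummable_scal (/ ((Cpi * Ci) ^ p * cexp (Cpi * Ci * t / 4)))) in H.
  revert H; apply ex_series_ext; intros n; f_equal; unfold gterm.
  rewrite RtoC_plus, IZR_CN, RtoC_div by lra.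
  replace (2 * Cpi * Ci * (CN n + 1 / 2)) with (Cpi * Ci * (2 * CN n + 1))
    by (field; apply RtoC_neq; lra).
  match goal with |- _ * (_ * cexp ?u) = _ =>
    replace u with (Cpi * Ci * t / 4 + (CN n * CN n + CN n) * Cpi * Ci * t)
      by (field; split; apply RtoC_neq; lra) end.
  rewrite cexp_add, (Cpow_mult_l (Cpi * Ci) (2 * CN n + 1)); field; split; [apply cexp_neq_0|].
  apply Cpow_nz, Cmult_neq_0; [apply Cpi_neq_0|apply Ci_nz].
Qed.

(** For odd order the sign of the power of [n + 1/2] under [n -> -1 - n] cancels the sign between
    the phases [i] and [- i], so the two terms of each pair are equal. *)
Lemma dtheta1_odd_at_0 (j : nat) (t : C) : (0 < Im t)%R ->
  let p := S (2 * j) in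
  dtheta1 p 0 t = - 2 * Ci * (Cpi * Ci) ^ p * cexp (Cpi * Ci * t / 4) *
    csum (fun k => sgn k * ((2 * CN k + 1) ^ p * cexp ((CN k * CN k + CN k) * Cpi * Ci * t))).
Proof.
  intros Ht p; unfold dtheta1, gtheta; rewrite zsum_pair by now apply gterm_summable.
  assert (H2 : RtoC 2 <> 0) by (apply RtoC_neq; lra).
  set (q := cexp (Cpi * Ci * t / 4)).
  rewrite (csum_ext _ (fun k => (2 * Ci * (Cpi * Ci) ^ p * q) *
     (sgn k * ((2 * CN k + 1) ^ p * cexp ((CN k * CN k + CN k) * Cpi * Ci * t))))).
  - rewrite csum_scal; [ring|].
    pose proof (odd_series_summable p t Ht) as Hs; revert Hs; apply ex_series_ext.
    intros n; now rewrite (Cmod_mult (sgn n)), Cmod_sgn, Rmult_1_l.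
  - intros n; unfold gterm.
    rewrite minus_IZR, !RtoC_plus, RtoC_minus, IZR_CN, RtoC_div by lra.
    change (IZR (-1)) with (-1)%R.
    replace (2 * Cpi * Ci * (CN n + 1 / 2)) with (Cpi * Ci * (2 * CN n + 1))
      by (field; apply RtoC_neq; lra).
    replace (2 * Cpi * Ci * (-1 - CN n + 1 / 2)) with (-1 * (Cpi * Ci * (2 * CN n + 1)))
      by (field; apply RtoC_neq; lra).
    rewrite !Cpow_mult_l; replace ((-1) ^ p) with (RtoC (-1)).
    2:{ unfold p; rewrite Cpow_S, Cpow_mult_r; replace ((-1) ^ 2) with (RtoC 1) by (simpl; ring).
        rewrite Cpow_1_l; ring. }
    set (A := cexp ((CN n * CN n + CN n) * Cpi * Ci * t)).
    match goal with |- _ * cexp ?u + _ * cexp ?v = _ =>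
      replace (cexp u) with (q * A * sgn n * Ci); [replace (cexp v) with (q * A * sgn n * - Ci)|] end.
    + ring.
    + transitivity (q * A * cexp (- (CN n * (Cpi * Ci))) * cexp (- (Cpi * Ci / 2)));
        [now rewrite cexp_opp_PI_nat, cexp_opp_PI2|].
      unfold q, A; rewrite <- !cexp_add; f_equal; field; auto.
    + transitivity (q * A * cexp (CN n * (Cpi * Ci)) * cexp (Cpi * Ci / 2));
        [now rewrite cexp_PI_nat, cexp_PI2|].
      unfold q, A; rewrite <- !cexp_add; f_equal; field; auto.
Qed.

(** * Jacobi's derivative formula *)

Lemma ccos_0 (u : C) : ccos (u * 0) = 1.
Proof.
  unfold ccos; replace (Ci * (u * 0)) with (RtoC 0) by ring.
  replace (- 0) with (RtoC 0) by ring; rewrite cexp_0; field; apply RtoC_neq; lra.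
Qed.

Definition pronic (k : nat) : R := (INR k * INR k + INR k)%R.

Lemma vtheta2_series (t : C) : (0 < Im t)%R ->
  dtheta2 0 0 t = 2 * cexp (Cpi * Ci * t / 4) *
    csum (fun k => 1 * cexp (RtoC (pronic k) * Cpi * Ci * t)).
Proof.
  intros Ht; rewrite <- theta2_eq by auto; unfold theta2; f_equal.
  apply csum_ext; intros n; rewrite ccos_0, CN_exponent; unfold pronic; ring.
Qed.

Lemma vtheta3_series (t : C) : (0 < Im t)%R ->
  dtheta3 0 0 t = 1 + 2 * csum (fun n => 1 * cexp (RtoC (INR (S n) * INR (S n)) * Cpi * Ci * t)).
Proof.
  intros Ht; rewrite <- theta3_eq by auto; unfold theta3; do 2 f_equal.
  apply csum_ext; intros n; rewrite ccos_0; unfold CN; rewrite RtoC_mult; ring.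
Qed.

Lemma vtheta4_series (t : C) : (0 < Im t)%R ->
  dtheta4 0 0 t = 1 + 2 * csum (fun n => sgn (S n) * cexp (RtoC (INR (S n) * INR (S n)) * Cpi * Ci * t)).
Proof.
  intros Ht; rewrite <- theta4_eq by auto; unfold theta4; do 2 f_equal.
  apply csum_ext; intros n; rewrite ccos_0; unfold CN; rewrite RtoC_mult; ring.
Qed.

Lemma theta1'_series (t : C) : (0 < Im t)%R ->
  dtheta1 1 0 t = 2 * Cpi * cexp (Cpi * Ci * t / 4) *
    csum (fun k => sgn k * (2 * CN k + 1) * cexp (RtoC (pronic k) * Cpi * Ci * t)).
Proof.
  intros Ht; pose proof (dtheta1_odd_at_0 0 t Ht) as H; simpl Nat.mul in H.
  rewrite H, Cpow_1_r.
  replace (- 2 * Ci * (Cpi * Ci)) with (2 * Cpi) by (pose proof Ci_sqr as Hi; ring [Hi]).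
  f_equal; apply csum_ext; intros k; rewrite Cpow_1_r, CN_exponent; unfold pronic; ring.
Qed.

Lemma Im_pow_pos (t : C) (n : nat) : (0 < Im t)%R -> (0 < Im (RtoC (2 ^ n) * t))%R.
Proof.
  intros Ht; rewrite im_scal_l; apply Rmult_lt_0_compat; auto; apply pow_lt; lra.
Qed.

Lemma pronic_cases (w : nat -> C) (k : nat) :
  (pronic k = 0%R /\ match k with O => w O | S _ => RtoC 0 end = w k) \/
  ((0 < pronic k)%R /\ match k with O => w O | S _ => RtoC 0 end = 0).
Proof.
  destruct k as [|k]; [left|right]; split; auto; unfold pronic.
  - simpl; ring.
  - pose proof (lt_0_INR (S k) ltac:(lia)); nra.
Qed.

Lemma square_positive (k : nat) : (0 < INR (S k) * INR (S k))%R.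
Proof. pose proof (lt_0_INR (S k) ltac:(lia)); nra. Qed.

Lemma square_series_summable (t : C) : (0 < Im t)%R ->
  csummable (fun n => 1 * cexp (RtoC (INR (S n) * INR (S n)) * Cpi * Ci * t)).
Proof.
  intros Ht; destruct (gterm_summable 0 0 0 0 t Ht) as [H _].
  apply csummable_incr_1 in H; revert H; apply ex_series_ext; intros n; f_equal.
  unfold gterm; rewrite Rplus_0_r, IZR_CN; simpl Cpow; f_equal; f_equal.
  unfold CN; rewrite RtoC_mult; ring.
Qed.

Lemma vtheta3_limit (t : C) : (0 < Im t)%R ->
  clim (fun n => dtheta3 0 0 (RtoC (2 ^ n) * t)) 1.
Proof.
  intros Ht; eapply clim_ext; [intros n; symmetry; apply vtheta3_series; now apply Im_pow_pos|].
  assert (E : 1 + 2 * csum (fun _ => RtoC 0) = 1) by (rewrite csum_zero; ring).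
  match goal with |- clim ?s _ => cut (clim s (1 + 2 * csum (fun _ => RtoC 0)));
    [now rewrite E|clear E] end.
  apply clim_plus; [|apply clim_mult]; try apply clim_const.
  apply (csum_doubling_limit (fun _ => 1) (fun _ => RtoC 0) (fun n => INR (S n) * INR (S n))%R); auto.
  - right; split; auto; apply square_positive.
  - now apply square_series_summable.
Qed.

Lemma vtheta4_limit (t : C) : (0 < Im t)%R ->
  clim (fun n => dtheta4 0 0 (RtoC (2 ^ n) * t)) 1.
Proof.
  intros Ht; eapply clim_ext; [intros n; symmetry; apply vtheta4_series; now apply Im_pow_pos|].
  assert (E : 1 + 2 * csum (fun _ => RtoC 0) = 1) by (rewrite csum_zero; ring).
  match goal with |- clim ?s _ => cut (clim s (1 + 2 * csum (fun _ => RtoC 0)));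
    [now rewrite E|clear E] end.
  apply clim_plus; [|apply clim_mult]; try apply clim_const.
  apply (csum_doubling_limit (fun n => sgn (S n)) (fun _ => RtoC 0) (fun n => INR (S n) * INR (S n))%R); auto.
  - right; split; auto; apply square_positive.
  - pose proof (square_series_summable t Ht) as H; revert H; apply ex_series_ext.
    intros n; now rewrite !Cmod_mult, Cmod_sgn, Cmod_1.
Qed.

(** [theta2 (0)] without its factor [2 cexp (PI i s / 4)]. That factor tends to [0] as the imaginary
    part grows, whereas the remaining series tends to [1]; the same is done for [theta1'] next. *)
Definition vtheta2_tail (s : C) : C := csum (fun k => 1 * cexp (RtoC (pronic k) * Cpi * Ci * s)).
Definition theta1'_tail (s : C) : C :=
  csum (fun k => sgn k * (2 * CN k + 1) * cexp (RtoC (pronic k) * Cpi * Ci * s)).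

Lemma vtheta2_tail_limit (t : C) : (0 < Im t)%R ->
  clim (fun n => vtheta2_tail (RtoC (2 ^ n) * t)) 1.
Proof.
  intros Ht; rewrite <- (csum_first 1).
  apply (csum_doubling_limit (fun _ => 1) _ pronic); auto.
  - intros k; apply (pronic_cases (fun _ => RtoC 1)).
  - pose proof (odd_series_summable 0 t Ht) as H; revert H; apply ex_series_ext.
    intros n; now rewrite CN_exponent.
Qed.

Lemma theta1'_tail_limit (t : C) : (0 < Im t)%R ->
  clim (fun n => theta1'_tail (RtoC (2 ^ n) * t)) 1.
Proof.
  intros Ht; replace (RtoC 1) with
    (csum (fun k => match k with O => sgn 0 * (2 * CN 0 + 1) | S _ => RtoC 0 end)).
  2:{ rewrite csum_first; unfold sgn, CN; simpl; ring. }
  apply (csum_doubling_limit (fun k => sgn k * (2 * CN k + 1)) _ pronic); auto.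
  - intros k; apply (pronic_cases (fun k => sgn k * (2 * CN k + 1))).
  - pose proof (odd_series_summable 1 t Ht) as H; revert H; apply ex_series_ext.
    intros n; rewrite CN_exponent, Cpow_1_r, !Cmod_mult, Cmod_sgn, Rmult_1_l; reflexivity.
Qed.

Lemma clim_eventually_neq_0 (s : nat -> C) (l : C) : clim s l -> l <> 0 ->
  exists N, forall n, (N <= n)%nat -> s n <> 0.
Proof.
  intros H Hl; apply Cmod_gt_0 in Hl; destruct (H _ Hl) as [N HN]; exists N; intros n Hn Hs.
  specialize (HN n Hn); rewrite Hs in HN; replace (0 - l) with (- l) in HN by ring.
  rewrite Cmod_opp in HN; lra.
Qed.

Definition theta_product (s : C) : C := dtheta2 0 0 s * dtheta3 0 0 s * dtheta4 0 0 s.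

(** By the doubling formulas a zero at [s] forces a zero at [2 s], hence at every [2 ^ n t]. This is
    impossible for large [n] because of the limits. *)
Lemma theta_product_neq_0 (t : C) : (0 < Im t)%R -> theta_product t <> 0.
Proof.
  intros Ht.
  assert (Hstep : forall s, (0 < Im s)%R -> theta_product (2 * s) <> 0 -> theta_product s <> 0).
  { intros s Hs H2 H0; unfold theta_product in *.
    pose proof (theta2_doubling s Hs) as E2; pose proof (theta34_doubling s Hs) as E34.
    assert (H : 2 * (dtheta2 0 0 (2 * s) * dtheta3 0 0 (2 * s)) *
                (dtheta4 0 0 (2 * s) * dtheta4 0 0 (2 * s)) = 0).
    { rewrite <- E2, <- E34.
      transitivity (dtheta2 0 0 s * (dtheta2 0 0 s * dtheta3 0 0 s * dtheta4 0 0 s));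
        [ring|rewrite H0; ring]. }
    revert H; replace (2 * _ * _) with
      (2 * (dtheta2 0 0 (2 * s) * dtheta3 0 0 (2 * s) * dtheta4 0 0 (2 * s)) * dtheta4 0 0 (2 * s))
      by ring.
    apply Cmult_neq_0.
    - apply Cmult_neq_0; auto; apply RtoC_neq; lra.
    - intros H4; apply H2; rewrite H4; ring. }
  assert (Hdown : forall n, theta_product (RtoC (2 ^ n) * t) <> 0 -> theta_product t <> 0).
  { induction n as [|n IH]; intros H.
    - now replace (RtoC (2 ^ 0) * t) with t in H by (simpl; ring).
    - apply IH, Hstep; [now apply Im_pow_pos|].
      now replace (2 * (RtoC (2 ^ n) * t)) with (RtoC (2 ^ S n) * t)
        by (simpl; rewrite RtoC_mult; ring). }
  assert (H1 : RtoC 1 <> 0) by (apply RtoC_neq; lra).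
  destruct (clim_eventually_neq_0 _ _ (vtheta2_tail_limit t Ht) H1) as [N2 HN2].
  destruct (clim_eventually_neq_0 _ _ (vtheta3_limit t Ht) H1) as [N3 HN3].
  destruct (clim_eventually_neq_0 _ _ (vtheta4_limit t Ht) H1) as [N4 HN4].
  apply (Hdown (N2 + N3 + N4)%nat); unfold theta_product.
  apply Cmult_neq_0; [apply Cmult_neq_0|]; [|apply HN3; lia|apply HN4; lia].
  rewrite vtheta2_series by now apply Im_pow_pos.
  apply Cmult_neq_0; [|apply HN2; lia].
  apply Cmult_neq_0; [apply RtoC_neq; lra|apply cexp_neq_0].
Qed.

Lemma Cmult_reg_l (c u v : C) : c <> 0 -> c * u = c * v -> u = v.
Proof.
  intros Hc H; replace u with (/ c * (c * u)) by (field; auto); rewrite H; field; auto.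
Qed.

(* [theta1' / theta_product] is invariant under [t -> 2 t], and tends to [PI] along the
   sequence [2 ^ n t]. *)
Lemma jacobi_derivative_formula (t : C) : (0 < Im t)%R ->
  dtheta1 1 0 t = Cpi * theta_product t.
Proof.
  intros Ht.
  assert (Hstep : forall s, (0 < Im s)%R ->
            dtheta1 1 0 s * theta_product (2 * s) = dtheta1 1 0 (2 * s) * theta_product s).
  { intros s Hs; pose proof (theta_product_neq_0 s Hs) as Hnz; unfold theta_product in *.
    pose proof (theta2_doubling s Hs) as E2; pose proof (theta34_doubling s Hs) as E34.
    pose proof (theta1'_doubling s Hs) as E1.
    assert (Hv2 : dtheta2 0 0 s <> 0) by (intros H; apply Hnz; rewrite H; ring).
    apply (Cmult_reg_l (dtheta2 0 0 s)); auto.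
    transitivity (dtheta1 1 0 s * dtheta2 0 0 s *
      (dtheta2 0 0 (2 * s) * dtheta3 0 0 (2 * s) * dtheta4 0 0 (2 * s))); [ring|].
    rewrite E1.
    transitivity (dtheta1 1 0 (2 * s) * (dtheta2 0 0 s * dtheta2 0 0 s) *
       (dtheta3 0 0 s * dtheta4 0 0 s)); [rewrite E2, E34; ring|ring]. }
  assert (Hall : forall n, dtheta1 1 0 t * theta_product (RtoC (2 ^ n) * t) =
                           dtheta1 1 0 (RtoC (2 ^ n) * t) * theta_product t).
  { induction n as [|n IH].
    - now replace (RtoC (2 ^ 0) * t) with t by (simpl; ring).
    - replace (RtoC (2 ^ S n) * t) with (2 * (RtoC (2 ^ n) * t))
        by (simpl; rewrite RtoC_mult; ring).
      pose proof (Im_pow_pos t n Ht) as Hs; pose proof (Hstep _ Hs) as E.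
      apply (Cmult_reg_l _ _ _ (theta_product_neq_0 _ Hs)).
      set (s := RtoC (2 ^ n) * t) in *.
      transitivity (dtheta1 1 0 t * theta_product s * theta_product (2 * s)); [ring|].
      rewrite IH.
      transitivity (dtheta1 1 0 s * theta_product (2 * s) * theta_product t); [ring|].
      rewrite E; ring. }
  (* The common factor [2 cexp (PI i s / 4)] would send both sides to [0]; it has to be cancelled
     before the limit is taken. *)
  assert (Hred : forall n,
     dtheta1 1 0 t * (vtheta2_tail (RtoC (2 ^ n) * t) * dtheta3 0 0 (RtoC (2 ^ n) * t)
                      * dtheta4 0 0 (RtoC (2 ^ n) * t)) =
     Cpi * theta_product t * theta1'_tail (RtoC (2 ^ n) * t)).
  { intros n; pose proof (Hall n) as E; pose proof (Im_pow_pos t n Ht) as Hs.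
    unfold theta_product at 1 in E; rewrite (vtheta2_series _ Hs), (theta1'_series _ Hs) in E.
    fold (vtheta2_tail (RtoC (2 ^ n) * t)) (theta1'_tail (RtoC (2 ^ n) * t)) in E.
    apply (Cmult_reg_l (2 * cexp (Cpi * Ci * (RtoC (2 ^ n) * t) / 4))).
    - apply Cmult_neq_0; [apply RtoC_neq; lra|apply cexp_neq_0].
    - etransitivity; [|etransitivity; [exact E|]]; ring. }
  pose proof (clim_mult _ _ _ _ (clim_const (dtheta1 1 0 t))
    (clim_mult _ _ _ _ (clim_mult _ _ _ _ (vtheta2_tail_limit t Ht) (vtheta3_limit t Ht))
       (vtheta4_limit t Ht))) as L1.
  pose proof (clim_mult _ _ _ _ (clim_const (Cpi * theta_product t)) (theta1'_tail_limit t Ht)) as L2.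
  pose proof (clim_unique _ _ _ (clim_ext _ _ _ Hred L1) L2) as E.
  rewrite !Cmult_1_r in E; exact E.
Qed.

(** * Finite triple products *)

Section FiniteTripleProduct.
Context (x : C) (x_neq_0 : x <> 0) (x_small : (Cmod x < 1)%R).

(* Up to a factor independent of [j], the coefficient of [sin ((2 j + 1) PI z)] in
   [sin (PI z) * \prod_(1 <= k <= n) (1 - 2 x^k cos (2 PI z) + x^(2 k))]; it vanishes
   for [j > n] because the subtraction is truncated. *)
Fixpoint tpcoef (n j : nat) : C :=
  match j with
  | O => 1
  | S j => tpcoef n j * (- x ^ S j * (1 - x ^ (n - j)) / (1 - x ^ (n + j + 2)))
  end.

(** Equal to [(-1)^j x^(j (j + 1) / 2)], the coefficients of the sine series of [theta1] when
    [x = cexp (2 PI i t)]. *)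
Fixpoint tplimit (j : nat) : C :=
  match j with O => 1 | S j => tplimit j * - x ^ S j end.

Lemma tpcoef_S (n j : nat) : tpcoef n (S j) =
  tpcoef n j * (- x ^ S j * (1 - x ^ (n - j)) / (1 - x ^ (n + j + 2))).
Proof. reflexivity. Qed.

Lemma tpcoef_0 (n : nat) : tpcoef n 0 = 1.
Proof. reflexivity. Qed.

Lemma Cmod_pow_lt_1 (k : nat) : (Cmod (x ^ S k) <= Cmod x)%R.
Proof.
  rewrite Cmod_pow; simpl; pose proof (Cmod_ge_0 x).
  assert (Cmod x ^ k <= 1)%R.
  { rewrite <- (pow1 k); apply pow_incr; lra. }
  nra.
Qed.

Lemma one_sub_pow_neq_0 (k : nat) : 1 - x ^ S k <> 0.
Proof.
  intros H; pose proof (Cmod_pow_lt_1 k) as Hk.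
  assert (E : x ^ S k = 1) by (symmetry; now apply Ceq_minus).
  rewrite E, Cmod_1 in Hk; lra.
Qed.

Lemma one_sub_pow_neq_0' (k : nat) : k <> O -> 1 - x ^ k <> 0.
Proof. destruct k; [easy|intros _; apply one_sub_pow_neq_0]. Qed.

Lemma one_add_pow_neq_0 (k : nat) : 1 + x ^ S k <> 0.
Proof.
  intros H; pose proof (Cmod_pow_lt_1 k) as Hk.
  assert (E : x ^ S k = - (1)).
  { transitivity (1 + x ^ S k - 1); [ring|rewrite H; ring]. }
  rewrite E, Cmod_opp, Cmod_1 in Hk; lra.
Qed.

Lemma tpcoef_vanish (n j : nat) : (n < j)%nat -> tpcoef n j = 0.
Proof.
  induction j as [|j IH]; intros H; [lia|]; rewrite tpcoef_S.
  destruct (Nat.eq_dec j n) as [->|Hne].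
  - rewrite Nat.sub_diag; change (x ^ 0) with (RtoC 1); unfold Cdiv; ring.
  - rewrite IH by lia; ring.
Qed.

(** With [(x)_m] the product of [1 - x^i] for [1 <= i <= m], the coefficient is [tplimit j] times
    [(x)_n (x)_(n+1) / ((x)_(n-j) (x)_(n+1+j))]; the factor here is the quotient of two such
    expressions. *)
Lemma tpcoef_succ_n (n j : nat) : (j <= n)%nat ->
  tpcoef (S n) j = tpcoef n j *
    ((1 - x ^ S n) * (1 - x ^ (S (S n))) / ((1 - x ^ (S n - j)) * (1 - x ^ (S (S n) + j)))).
Proof.
  induction j as [|j IH]; intros H.
  - rewrite Nat.sub_0_r, Nat.add_0_r; rewrite !tpcoef_0; field.
    split; apply one_sub_pow_neq_0.
  - rewrite !tpcoef_S, IH by lia.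
    replace (S n + j + 2)%nat with (S (S n) + S j)%nat by lia.
    replace (n + j + 2)%nat with (S (S n) + j)%nat by lia.
    replace (S n - S j)%nat with (n - j)%nat by lia.
    pose proof (one_sub_pow_neq_0' (S n - j) ltac:(lia)).
    pose proof (one_sub_pow_neq_0' (n - j) ltac:(lia)).
    pose proof (one_sub_pow_neq_0' (S (S n) + j) ltac:(lia)).
    pose proof (one_sub_pow_neq_0' (S (S n) + S j) ltac:(lia)).
    set (A := x ^ (S n - j)) in *; set (B := x ^ (n - j)) in *.
    set (D := x ^ (S (S n) + j)) in *; set (E := x ^ (S (S n) + S j)) in *.
    set (F := x ^ S n); set (G := x ^ S (S n)); set (K := x ^ S j).
    field; auto.
Qed.

(** The coefficient of index [j - 1]. At [j = 0] the frequency is [-1], and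
    [sin (- PI z) = - sin (PI z)] gives the sign. *)
Definition tpprev (n j : nat) : C := match j with O => - tpcoef n 0 | S j => tpcoef n j end.

(** Multiplication by a further factor changes the coefficient of [sin (PI z)]; this restores the
    normalization [tpcoef (S n) 0 = 1]. *)
Definition tpscale (n : nat) : C :=
  (1 + x ^ S n) * (1 - x ^ (2 * n + 3)) / (1 - x ^ S (S n)).

Lemma tpscale_neq_0 (n : nat) : tpscale n <> 0.
Proof.
  unfold tpscale, Cdiv; apply Cmult_neq_0; [apply Cmult_neq_0|].
  - apply one_add_pow_neq_0.
  - apply one_sub_pow_neq_0'; lia.
  - intros H; pose proof (one_sub_pow_neq_0 (S n)) as Hn.
    apply C1_nz; rewrite <- (Cinv_r _ Hn), H; ring.
Qed.

(** Multiplication by [1 - 2 X cos (2 PI z) + X^2] with [X = x^(n+1)]: the cosine shifts the odd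
    frequency [2 j + 1] by [2] in both directions. *)
Lemma tpcoef_recursion (n j : nat) :
  tpscale n * tpcoef (S n) j =
  (1 + x ^ S n * x ^ S n) * tpcoef n j - x ^ S n * (tpprev n j + tpcoef n (S j)).
Proof.
  destruct j as [|j].
  - unfold tpprev; rewrite tpcoef_S, !tpcoef_0, Nat.sub_0_r, Nat.add_0_r.
    unfold tpscale; replace (n + 2)%nat with (S (S n)) by lia.
    replace (2 * n + 3)%nat with (S (S n + S n)) by lia.
    pose proof (one_sub_pow_neq_0 (S n)) as H.
    rewrite (Cpow_S x (S n + S n)), Cpow_add_r.
    rewrite (Cpow_S x (S n)), (Cpow_S x n) in *.
    set (X := x ^ n) in *; field; auto.
  - simpl tpprev; destruct (le_lt_dec (S j) n) as [Hle|Hlt].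
    + rewrite tpcoef_succ_n by auto.
      (* With [n = m + j + 1] all exponents become sums, and the identity is rational in [x], [x^j]
         and [x^m]. *)
      destruct (Nat.le_exists_sub (S j) n Hle) as [m [Hm _]].
      rewrite !tpcoef_S; unfold tpscale.
      replace (n - j)%nat with (S m) by lia; replace (n - S j)%nat with m by lia.
      replace (S n - S j)%nat with (S m) by lia.
      replace (n + j + 2)%nat with (S n + S j)%nat by lia.
      replace (n + S j + 2)%nat with (S (S n + S j)) by lia.
      replace (S (S n) + S j)%nat with (S (S n + S j)) by lia.
      replace (2 * n + 3)%nat with (S (S n + S n)) by lia.
      pose proof (one_sub_pow_neq_0 (S n)) as H1.
      pose proof (one_sub_pow_neq_0 m) as H2.
      pose proof (one_sub_pow_neq_0 (n + S j)) as H3.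
      pose proof (one_sub_pow_neq_0 (S n + S j)) as H4.
      change (S (n + S j)) with (S n + S j)%nat in H3.
      rewrite ?(Cpow_S x (S n + S n)), ?(Cpow_S x (S n + S j)) in *.
      rewrite !(Cpow_add_r x (S n)) in *.
      replace (x ^ S n) with (x * (x * x ^ j * x ^ m)) in *
        by (rewrite Hm, <- Cpow_S, <- Cpow_add_r, <- Cpow_S; f_equal; lia).
      rewrite ?Cpow_S in *.
      replace (x ^ n) with (x * x ^ j * x ^ m) in *
        by (rewrite Hm, <- Cpow_S, <- Cpow_add_r; f_equal; lia).
      set (Y := x ^ j) in *; set (Z := x ^ m) in *.
      field; auto.
    (* Beyond index [n] only the new top coefficient, of index [n + 1], is nonzero; its sole source
       is [tpprev]. *)
    + destruct (Nat.eq_dec j n) as [->|Hne].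
      * rewrite (tpcoef_vanish n (S n)), (tpcoef_vanish n (S (S n))) by lia.
        rewrite tpcoef_S, tpcoef_succ_n by lia; unfold tpscale.
        replace (S n - n)%nat with 1%nat by lia.
        replace (S (S n) + n)%nat with (S n + S n)%nat by lia.
        replace (S n + n + 2)%nat with (S (S n + S n))%nat by lia.
        replace (2 * n + 3)%nat with (S (S n + S n)) by lia.
        pose proof (one_sub_pow_neq_0 (S n)) as H1.
        pose proof (one_sub_pow_neq_0 0) as H2.
        pose proof (one_sub_pow_neq_0 (n + S n)) as H3.
        pose proof (one_sub_pow_neq_0 (S n + S n)) as H4.
        change (S (n + S n)) with (S n + S n)%nat in H3.
        rewrite ?(Cpow_S x (S n + S n)) in *.
        rewrite !(Cpow_add_r x (S n)) in *.
        rewrite ?Cpow_1_r in *; rewrite ?Cpow_S in *.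
        set (X := x ^ n) in *; field; auto.
      * rewrite !tpcoef_vanish by lia; ring.
Qed.

Lemma tpcoef_ratio_bound (n j : nat) :
  (Cmod ((1 - x ^ (n - j)) / (1 - x ^ (n + j + 2))) <= 2 / (1 - Cmod x))%R.
Proof.
  replace (n + j + 2)%nat with (S (S (n + j))) by lia.
  rewrite Cmod_div by apply one_sub_pow_neq_0.
  assert (H1 : (Cmod (1 - x ^ (n - j)) <= 2)%R).
  { eapply Rle_trans; [apply Cmod_triangle|]; rewrite Cmod_opp, Cmod_1, Cmod_pow.
    assert (Cmod x ^ (n - j) <= 1)%R; [|lra].
    rewrite <- (pow1 (n - j)); apply pow_incr; pose proof (Cmod_ge_0 x); lra. }
  assert (H2 : (1 - Cmod x <= Cmod (1 - x ^ S (S (n + j))))%R).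
  { pose proof (Cmod_pow_lt_1 (S (n + j))) as Hk.
    pose proof (Cmod_triangle (1 - x ^ S (S (n + j))) (x ^ S (S (n + j)))) as Ht.
    replace (1 - x ^ S (S (n + j)) + x ^ S (S (n + j))) with (RtoC 1) in Ht by ring.
    rewrite Cmod_1 in Ht; lra. }
  apply Rmult_le_compat; try lra; [apply Cmod_ge_0| |].
  - apply Rlt_le, Rinv_0_lt_compat; lra.
  - apply Rinv_le_contravar; lra.
Qed.

(** The powers [x^1, ..., x^j] multiply to Gaussian decay in [j], against which the [j] quotients
    cost only a geometric factor. Nothing depends on [n], as the passage to the limit requires. *)
Lemma tpcoef_bound (n j : nat) :
  (Cmod (tpcoef n j) <= exp (INR j * ln (2 / (1 - Cmod x)) + ln (Cmod x) * (INR j * (INR j + 1) / 2)))%R.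
Proof.
  pose proof (proj1 (Cmod_gt_0 x) x_neq_0) as Hpos.
  induction j as [|j IH].
  - simpl; rewrite Cmod_1, Rmult_0_l, Rplus_0_l, Rmult_0_l.
    unfold Rdiv; rewrite !Rmult_0_l, Rmult_0_r, exp_0; lra.
  - rewrite tpcoef_S, Cmod_mult.
    replace (- x ^ S j * (1 - x ^ (n - j)) / (1 - x ^ (n + j + 2)))
      with (- x ^ S j * ((1 - x ^ (n - j)) / (1 - x ^ (n + j + 2)))) by (unfold Cdiv; ring).
    rewrite Cmod_mult, Cmod_opp, Cmod_pow.
    assert (HK : (0 < 2 / (1 - Cmod x))%R) by (apply Rdiv_lt_0_compat; lra).
    replace (exp _) with (exp (INR j * ln (2 / (1 - Cmod x)) + ln (Cmod x) * (INR j * (INR j + 1) / 2))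
       * (Cmod x ^ S j * (2 / (1 - Cmod x))))%R.
    + apply Rmult_le_compat; auto using Cmod_ge_0.
      * apply Rmult_le_pos; [apply pow_le|]; apply Cmod_ge_0.
      * apply Rmult_le_compat_l; [apply pow_le, Cmod_ge_0|apply tpcoef_ratio_bound].
    + assert (E1 : (Cmod x ^ S j)%R = exp (INR (S j) * ln (Cmod x)))
        by (rewrite exp_INR_mult, exp_ln; auto).
      pose proof (exp_ln _ HK) as E2.
      set (L := ln (2 / (1 - Cmod x))) in *; rewrite E1, <- E2.
      rewrite <- !exp_plus; f_equal; rewrite S_INR; field.
Qed.

Lemma tpcoef_decay : exists K : R, forall n j,
  (Cmod (tpcoef n j) * (2 * INR j + 5) ^ 3 <= K * exp (- INR j))%R.
Proof.
  pose proof (proj1 (Cmod_gt_0 x) x_neq_0) as Hpos.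
  assert (Hln : (ln (Cmod x) < 0)%R) by (rewrite <- ln_1; apply ln_increasing; lra).
  set (L := ln (2 / (1 - Cmod x))); set (c := ln (Cmod x)) in *.
  (* The weight is at most [exp (3 (2 j + 5)) = exp 15 * exp (6 j)], which explains the [6] here and
     the [exp 15] below. *)
  destruct (gaussian_decay (- c / 2) (L + c / 2 + 6) 0 ltac:(lra)) as [K HK].
  exists (exp 15 * K)%R; intros n j; specialize (HK (INR j)).
  pose proof (pos_INR j) as Hj; rewrite Rplus_0_r, !(Rabs_right (INR j)) in HK by lra.
  apply Rle_trans with (exp 15 * exp (- (- c / 2) * (INR j * INR j) + (L + c / 2 + 6) * INR j))%R.
  - eapply Rle_trans.
    + apply Rmult_le_compat; [apply Cmod_ge_0|apply pow_le; lra|apply tpcoef_bound|].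
      apply pow_le_exp; lra.
    + fold L c; rewrite <- !exp_plus; apply exp_le; simpl INR; lra.
  - rewrite Rmult_assoc; apply Rmult_le_compat_l; auto; apply Rlt_le, exp_pos.
Qed.

Lemma tpcoef_weighted_decay : exists K : R, forall (n j p : nat) (u : C),
  (p <= 3)%nat -> (Cmod u <= 2 * INR j + 5)%R ->
  (Cmod (tpcoef n j * u ^ p) <= K * exp (- INR j))%R.
Proof.
  destruct tpcoef_decay as [K HK]; exists K; intros n j p u Hp Hu.
  eapply Rle_trans; [|apply (HK n j)].
  rewrite Cmod_mult, Cmod_pow; apply Rmult_le_compat_l; [apply Cmod_ge_0|].
  pose proof (pos_INR j); pose proof (Cmod_ge_0 u).
  apply Rle_trans with ((2 * INR j + 5) ^ p)%R.
  - apply pow_incr; lra.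
  - apply Rle_pow; [lra|auto].
Qed.

Lemma Cmod_odd_le (j : nat) (c : R) : (-5 <= c <= 5)%R ->
  (Cmod (2 * CN j + RtoC c) <= 2 * INR j + 5)%R.
Proof.
  intros Hc; unfold CN; rewrite <- RtoC_mult, <- RtoC_plus, Cmod_R.
  pose proof (pos_INR j); apply Rabs_le; lra.
Qed.

Lemma tpcoef_weighted_summable (n p : nat) (c : R) : (p <= 3)%nat -> (-5 <= c <= 5)%R ->
  csummable (fun j => tpcoef n j * (2 * CN j + RtoC c) ^ p).
Proof.
  intros Hp Hc; destruct tpcoef_weighted_decay as [K HK].
  apply csummable_dominated with (fun j => K * exp (- INR j))%R; [|apply ex_series_exp_opp].
  intros j; apply HK; auto using Cmod_odd_le.
Qed.

Definition tpmoment (n p : nat) : C := csum (fun j => tpcoef n j * (2 * CN j + 1) ^ p).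

(** Both shifted sums are reindexed. The boundary terms are [- tpcoef n 0] from [tpprev] and
    [(-1)^p * tpcoef n 0] from the weight [2 j - 1] at [j = 0]; they agree because [p] is odd. *)
Lemma tpcoef_neighbours (n p : nat) : (p <= 3)%nat -> (-1) ^ p = - (1) ->
  csummable (fun j => (tpprev n j + tpcoef n (S j)) * (2 * CN j + 1) ^ p) /\
  csum (fun j => (tpprev n j + tpcoef n (S j)) * (2 * CN j + 1) ^ p) =
  csum (fun j => tpcoef n j * (2 * CN j + 3) ^ p) + csum (fun j => tpcoef n j * (2 * CN j + RtoC (-1)) ^ p).
Proof.
  intros Hp Hodd.
  pose proof (tpcoef_weighted_summable n p 3 Hp ltac:(lra)) as HA.
  pose proof (tpcoef_weighted_summable n p (-1) Hp ltac:(lra)) as HB.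
  assert (HCN : forall j, CN (S j) = CN j + 1).
  { intros j; unfold CN; now rewrite S_INR, RtoC_plus. }
  set (A' := fun j => tpprev n j * (2 * CN j + 1) ^ p).
  set (B' := fun j => tpcoef n (S j) * (2 * CN j + 1) ^ p).
  assert (EA : forall j, A' (S j) = tpcoef n j * (2 * CN j + 3) ^ p).
  { intros j; unfold A'; simpl tpprev; rewrite HCN; do 2 f_equal; ring. }
  assert (EB : forall j, B' j = (fun j => tpcoef n j * (2 * CN j + RtoC (-1)) ^ p) (S j)).
  { intros j; unfold B'; rewrite HCN; do 2 f_equal; ring. }
  assert (SA : csummable A').
  { apply (ex_series_incr_1 (fun j => Cmod (A' j)) : _ <-> _).
    revert HA; apply ex_series_ext; intros j; now rewrite EA. }
  assert (SB : csummable B').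
  { apply csummable_incr_1 in HB; revert HB; apply ex_series_ext; intros j; now rewrite EB. }
  assert (Eq : forall j, (tpprev n j + tpcoef n (S j)) * (2 * CN j + 1) ^ p = A' j + B' j)
    by (intros j; unfold A', B'; ring).
  split.
  - pose proof (csummable_plus _ _ SA SB) as H; revert H; apply ex_series_ext.
    intros j; now rewrite Eq.
  - rewrite (csum_ext _ _ Eq), csum_plus by auto.
    rewrite (csum_incr_1 A' SA), (csum_ext _ _ EA).
    rewrite (csum_incr_1 (fun j => tpcoef n j * (2 * CN j + RtoC (-1)) ^ p) HB), <- (csum_ext _ _ EB).
    unfold A'; simpl tpprev; simpl tpcoef.
    replace (2 * CN 0 + 1) with (RtoC 1) by (unfold CN; simpl; ring).
    replace (2 * CN 0 + RtoC (-1)) with (RtoC (-1)) by (unfold CN; simpl; ring).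
    rewrite Hodd, Cpow_1_l; ring.
Qed.

Lemma tpmoment_recursion (n p : nat) : (p <= 3)%nat -> (-1) ^ p = - (1) ->
  tpscale n * tpmoment (S n) p =
  (1 + x ^ S n * x ^ S n) * tpmoment n p
  - x ^ S n * (csum (fun j => tpcoef n j * (2 * CN j + 3) ^ p)
               + csum (fun j => tpcoef n j * (2 * CN j + RtoC (-1)) ^ p)).
Proof.
  intros Hp Hodd; destruct (tpcoef_neighbours n p Hp Hodd) as [HS HE]; rewrite <- HE.
  pose proof (tpcoef_weighted_summable n p 1 Hp ltac:(lra)) as H1.
  pose proof (tpcoef_weighted_summable (S n) p 1 Hp ltac:(lra)) as H2.
  unfold tpmoment; rewrite <- csum_scal, <- csum_scal by auto.
  match goal with |- _ = ?u - ?v * ?w => replace (u - v * w) with (u + - v * w) by ring end.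
  rewrite <- csum_scal, <- csum_plus by auto using csummable_scal.
  apply csum_ext; intros j; rewrite Cmult_assoc, tpcoef_recursion; ring.
Qed.

Lemma tpmoment1_step (n : nat) :
  tpscale n * tpmoment (S n) 1 = (1 - x ^ S n) * (1 - x ^ S n) * tpmoment n 1.
Proof.
  rewrite tpmoment_recursion by (try lia; simpl; ring).
  rewrite <- csum_plus by (apply tpcoef_weighted_summable; try lia; lra).
  rewrite (csum_ext _ (fun j => 2 * (tpcoef n j * (2 * CN j + 1) ^ 1)))
    by (intros j; simpl; ring).
  rewrite csum_scal by (apply tpcoef_weighted_summable; try lia; lra).
  fold (tpmoment n 1); ring.
Qed.

(** For [m = 2 j + 1] the two shifts give [(m + 2)^3 + (m - 2)^3 = 2 m^3 + 24 m], so the first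
    moment enters with coefficient [24]. *)
Lemma tpmoment3_step (n : nat) :
  tpscale n * tpmoment (S n) 3 =
  (1 - x ^ S n) * (1 - x ^ S n) * tpmoment n 3 - 24 * x ^ S n * tpmoment n 1.
Proof.
  rewrite tpmoment_recursion by (try lia; simpl; ring).
  rewrite <- csum_plus by (apply tpcoef_weighted_summable; try lia; lra).
  rewrite (csum_ext _ (fun j => 2 * (tpcoef n j * (2 * CN j + 1) ^ 3)
                                + 24 * (tpcoef n j * (2 * CN j + 1) ^ 1)))
    by (intros j; simpl; ring).
  pose proof (tpcoef_weighted_summable n 1 1 ltac:(lia) ltac:(lra)) as H1.
  pose proof (tpcoef_weighted_summable n 3 1 ltac:(lia) ltac:(lra)) as H3.
  rewrite (csum_plus _ _ (csummable_scal 2 _ H3) (csummable_scal 24 _ H1)).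
  rewrite (csum_scal 2 _ H3), (csum_scal 24 _ H1).
  fold (tpmoment n 1) (tpmoment n 3); ring.
Qed.

Lemma tpmoment_0 (p : nat) : tpmoment 0 p = 1.
Proof.
  etransitivity; [|apply csum_first]; apply csum_ext; intros [|j].
  - simpl tpcoef; replace (2 * CN 0 + 1) with (RtoC 1) by (unfold CN; simpl; ring).
    rewrite Cpow_1_l; ring.
  - rewrite tpcoef_vanish by lia; ring.
Qed.

Definition lambert_term (i : nat) : C := x ^ S i / ((1 - x ^ S i) * (1 - x ^ S i)).

(** Dividing the recursion of the third moment by that of the first, each new factor subtracts
    [24 X / (1 - X)^2] with [X = x^(n+1)]. The scale [tpscale] cancels. *)
Lemma tpmoment_ratio (n : nat) :
  tpmoment n 3 = (1 - 24 * fsum lambert_term (seq 0 n)) * tpmoment n 1.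
Proof.
  induction n as [|n IH].
  - rewrite !tpmoment_0; simpl; ring.
  - apply (Cmult_reg_l (tpscale n) _ _ (tpscale_neq_0 n)).
    assert (E : fsum lambert_term (seq 0 (S n)) =
                fsum lambert_term (seq 0 n) + x ^ S n / ((1 - x ^ S n) * (1 - x ^ S n))).
    { rewrite seq_S, fsum_app; simpl fsum; fold (lambert_term n); ring. }
    rewrite E, tpmoment3_step, IH.
    set (s := fsum lambert_term (seq 0 n)).
    transitivity ((1 - 24 * (s + x ^ S n / ((1 - x ^ S n) * (1 - x ^ S n))))
                  * (tpscale n * tpmoment (S n) 1)); [|ring].
    rewrite tpmoment1_step; pose proof (one_sub_pow_neq_0 n) as H.
    set (X := x ^ S n) in *; field; auto.
Qed.

Lemma clim_pow : clim (fun n => x ^ n) 0.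
Proof.
  intros eps Heps.
  assert (Hlt : (Rabs (Cmod x) < 1)%R) by (rewrite Rabs_right; auto; apply Rle_ge, Cmod_ge_0).
  destruct (pow_lt_1_zero _ Hlt eps Heps) as [N HN]; exists N; intros n Hn.
  replace (x ^ n - 0) with (x ^ n) by ring; rewrite Cmod_pow.
  specialize (HN n Hn); rewrite Rabs_right in HN; auto; apply Rle_ge, pow_le, Cmod_ge_0.
Qed.

Lemma tpcoef_ratio_limit (j : nat) :
  clim (fun n => (1 - x ^ (n - j)) / (1 - x ^ (n + j + 2))) 1.
Proof.
  intros eps Heps.
  (* The error is a difference of two small powers over a denominator of modulus at least
     [1 - Cmod x]. *)
  destruct (clim_pow (eps * (1 - Cmod x) / 2)%R) as [N HN].
  { apply Rdiv_lt_0_compat; [apply Rmult_lt_0_compat|]; lra. }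
  exists (N + j)%nat; intros n Hn.
  replace (n + j + 2)%nat with (S (S (n + j))) by lia.
  pose proof (one_sub_pow_neq_0 (S (n + j))) as Hnz.
  pose proof (HN (n - j)%nat ltac:(lia)) as H1.
  pose proof (HN (S (S (n + j))) ltac:(lia)) as H2.
  replace (x ^ (n - j) - 0) with (x ^ (n - j)) in H1 by ring.
  replace (x ^ S (S (n + j)) - 0) with (x ^ S (S (n + j))) in H2 by ring.
  replace ((1 - x ^ (n - j)) / (1 - x ^ S (S (n + j))) - 1)
    with ((x ^ S (S (n + j)) + - x ^ (n - j)) / (1 - x ^ S (S (n + j)))) by (field; auto).
  rewrite Cmod_div by auto.
  assert (H3 : (1 - Cmod x <= Cmod (1 - x ^ S (S (n + j))))%R).
  { pose proof (Cmod_pow_lt_1 (S (n + j))) as Hk.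
    pose proof (Cmod_triangle (1 - x ^ S (S (n + j))) (x ^ S (S (n + j)))) as Ht.
    replace (1 - x ^ S (S (n + j)) + x ^ S (S (n + j))) with (RtoC 1) in Ht by ring.
    rewrite Cmod_1 in Ht; lra. }
  pose proof (Cmod_triangle (x ^ S (S (n + j))) (- x ^ (n - j))) as H4; rewrite Cmod_opp in H4.
  apply Rmult_lt_reg_r with (Cmod (1 - x ^ S (S (n + j)))); [lra|].
  unfold Rdiv; rewrite Rmult_assoc, Rinv_l by lra; nra.
Qed.

Lemma tpcoef_limit (j : nat) : clim (fun n => tpcoef n j) (tplimit j).
Proof.
  induction j as [|j IH]; [exact (clim_const 1)|].
  apply clim_ext with (fun n => tpcoef n j * (- x ^ S j * ((1 - x ^ (n - j)) / (1 - x ^ (n + j + 2))))).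
  - intros n; rewrite tpcoef_S; unfold Cdiv; ring.
  - replace (tplimit (S j)) with (tplimit j * (- x ^ S j * 1)) by (simpl; ring).
    apply clim_mult; auto; apply clim_mult; [apply clim_const|apply tpcoef_ratio_limit].
Qed.

Lemma tpmoment_limit (p : nat) : (p <= 3)%nat ->
  clim (fun n => tpmoment n p) (csum (fun j => tplimit j * (2 * CN j + 1) ^ p)).
Proof.
  intros Hp; destruct tpcoef_weighted_decay as [K HK].
  apply clim_csum_dominated with (fun j => K * exp (- INR j))%R; [|apply ex_series_exp_opp|].
  - intros n j; apply HK; auto; apply Cmod_odd_le; lra.
  - intros j; apply clim_mult; [apply tpcoef_limit|apply clim_const].
Qed.

Lemma lambert_summable : csummable lambert_term.
Proof.
  apply csummable_dominated with (fun i => / ((1 - Cmod x) * (1 - Cmod x)) * Cmod x ^ i)%R.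
  - intros i; unfold lambert_term; pose proof (one_sub_pow_neq_0 i) as Hnz.
    pose proof (Cmod_ge_0 x) as Hx.
    assert (H3 : (1 - Cmod x <= Cmod (1 - x ^ S i))%R).
    { pose proof (Cmod_pow_lt_1 i) as Hk.
      pose proof (Cmod_triangle (1 - x ^ S i) (x ^ S i)) as Ht.
      replace (1 - x ^ S i + x ^ S i) with (RtoC 1) in Ht by ring.
      rewrite Cmod_1 in Ht; lra. }
    rewrite Cmod_div by now apply Cmult_neq_0.
    rewrite Cmod_mult, Cmod_pow; unfold Rdiv; rewrite (Rmult_comm (Cmod x ^ S i)).
    apply Rmult_le_compat.
    + apply Rlt_le, Rinv_0_lt_compat; nra.
    + apply pow_le; auto.
    + apply Rinv_le_contravar; nra.
    + simpl; pose proof (pow_le (Cmod x) i Hx); nra.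
  - apply @ex_series_scal_l, ex_series_geom; rewrite Rabs_right; auto; apply Rle_ge, Cmod_ge_0.
Qed.

Lemma triple_product_moments :
  csum (fun j => tplimit j * (2 * CN j + 1) ^ 3) =
  (1 - 24 * csum lambert_term) * csum (fun j => tplimit j * (2 * CN j + 1) ^ 1).
Proof.
  apply (clim_unique (fun n => tpmoment n 3)); [apply tpmoment_limit; lia|].
  apply clim_ext with (fun n => (1 + -24 * fsum lambert_term (seq 0 n)) * tpmoment n 1).
  - intros n; rewrite tpmoment_ratio; ring.
  - apply clim_mult; [|apply tpmoment_limit; lia].
    replace (1 - 24 * csum lambert_term) with (1 + -24 * csum lambert_term) by ring.
    apply clim_plus; [apply clim_const|apply clim_mult; [apply clim_const|]].
    apply clim_csum, lambert_summable.
Qed.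

End FiniteTripleProduct.

Lemma tplimit_cexp (t : C) (k : nat) :
  sgn k * cexp ((CN k * CN k + CN k) * Cpi * Ci * t) = tplimit (cexp (2 * Cpi * Ci * t)) k.
Proof.
  induction k as [|k IH].
  - simpl; unfold sgn, CN; simpl; rewrite Cmult_1_l, <- cexp_0; f_equal; ring.
  - simpl tplimit; rewrite <- IH, <- Cpow_S, cexp_pow.
    replace (sgn (S k)) with (- sgn k) by (unfold sgn; simpl; rewrite RtoC_mult; ring).
    transitivity (- sgn k * (cexp ((CN k * CN k + CN k) * Cpi * Ci * t) *
       cexp (CN (S k) * (2 * Cpi * Ci * t)))); [|ring].
    rewrite <- cexp_add; do 2 f_equal; unfold CN; rewrite S_INR, RtoC_plus; ring.
Qed.

(** Three derivatives against one give [(PI i)^2 = - PI^2], and [- PI^2 (1 - 24 S) = - 12 eta] for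
    the Lambert series [S]. *)
Lemma theta1'''_eta (t : C) : (0 < Im t)%R ->
  dtheta1 3 0 t = - 12 * eta t * dtheta1 1 0 t.
Proof.
  intros Ht; set (x := cexp (2 * Cpi * Ci * t)).
  assert (Hx : x <> 0) by apply cexp_neq_0.
  assert (Hx1 : (Cmod x < 1)%R).
  { unfold x; rewrite Cmod_cexp, <- exp_0; apply exp_increasing.
    pose proof PI_RGT_0; destruct t as [a b]; simpl in *; nra. }
  pose proof (dtheta1_odd_at_0 1 t Ht) as H3; pose proof (dtheta1_odd_at_0 0 t Ht) as H1.
  simpl Nat.mul in H1, H3; rewrite H1, H3.
  assert (Hser : forall p, csum (fun k => sgn k * ((2 * CN k + 1) ^ p *
             cexp ((CN k * CN k + CN k) * Cpi * Ci * t))) =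
             csum (fun k => tplimit x k * (2 * CN k + 1) ^ p)).
  { intros p; apply csum_ext; intros k; unfold x; rewrite <- tplimit_cexp; ring. }
  rewrite !Hser, (triple_product_moments x Hx Hx1).
  replace (eta t) with (2 * Cpi * Cpi * (1 / 24 - csum (lambert_term x))).
  2:{ unfold eta; do 2 f_equal; apply csum_ext; intros n; unfold lambert_term, x.
      rewrite !cexp_pow; replace (CN (S n) * (2 * Cpi * Ci * t)) with (2 * CN (S n) * Cpi * Ci * t) by ring.
      reflexivity. }
  set (q := cexp (Cpi * Ci * t / 4)); set (S0 := csum (lambert_term x)).
  set (M := csum _).
  transitivity (- 2 * Ci * (Cpi ^ 3 * (Ci * Ci) * Ci) * q * ((1 - 24 * S0) * M)); [ring|].
  rewrite Ci_sqr; field; apply RtoC_neq; lra.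
Qed.

(** * Second derivatives and the theorem *)

Lemma dtheta2_cder_double (p : nat) (z t : C) : (0 < Im t)%R ->
  cder (fun w => dtheta2 p (2 * w) (2 * t)) z (2 * dtheta2 (S p) (2 * z) (2 * t)).
Proof. exact (gtheta_cder_double p (1/2) 0 z t). Qed.

Lemma dtheta3_cder_double (p : nat) (z t : C) : (0 < Im t)%R ->
  cder (fun w => dtheta3 p (2 * w) (2 * t)) z (2 * dtheta3 (S p) (2 * z) (2 * t)).
Proof. exact (gtheta_cder_double p 0 0 z t). Qed.

Lemma dtheta1_cder_t (p : nat) (z t : C) : (0 < Im t)%R ->
  cder (fun s => dtheta1 p z s) t (dtheta1 (S (S p)) z t * (- Ci / (4 * Cpi))).
Proof.
  intros Ht; pose proof (cder_scal (-1) _ _ _ (gtheta_cder_t p (1/2) (1/2) z t Ht)) as H.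
  apply cder_eq with (-1 * (gtheta (S (S p)) (1/2) (1/2) z t * (- Ci / (4 * Cpi))));
    [unfold dtheta1; ring|].
  revert H; apply cder_ext; intros s; unfold dtheta1; ring.
Qed.

Lemma dtheta2_cder_t (p : nat) (z t : C) : (0 < Im t)%R ->
  cder (fun s => dtheta2 p z s) t (dtheta2 (S (S p)) z t * (- Ci / (4 * Cpi))).
Proof. exact (gtheta_cder_t p (1/2) 0 z t). Qed.

Lemma dtheta3_cder_t (p : nat) (z t : C) : (0 < Im t)%R ->
  cder (fun s => dtheta3 p z s) t (dtheta3 (S (S p)) z t * (- Ci / (4 * Cpi))).
Proof. exact (gtheta_cder_t p 0 0 z t). Qed.

Lemma dtheta4_cder_t (p : nat) (z t : C) : (0 < Im t)%R ->
  cder (fun s => dtheta4 p z s) t (dtheta4 (S (S p)) z t * (- Ci / (4 * Cpi))).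
Proof. exact (gtheta_cder_t p 0 (1/2) z t). Qed.

(* Unification must not unfold the theta series when distinct thetas are compared. *)
Local Opaque dtheta1 dtheta2 dtheta3 dtheta4.

Lemma cder_minus (f g : C -> C) (z l m : C) :
  cder f z l -> cder g z m -> cder (fun w => f w - g w) z (l - m).
Proof.
  intros Hf Hg; apply cder_eq with (l + -1 * m); [ring|].
  apply cder_ext with (fun w => f w + -1 * g w); [intros; ring|].
  now apply cder_plus, cder_scal.
Qed.

(** The second [y]-derivative of [f (x + y) * f (x - y)] at [0] is [2 (f f'' - f'^2)], while the
    arguments [2 y] on the right give a factor [4]. *)
Lemma second_derivative_of_product (f f1 f2 : C -> C) (c d x t : C) : (0 < Im t)%R ->
  (forall w, cder f w (f1 w)) -> (forall w, cder f1 w (f2 w)) ->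
  (forall y, f (x + y) * f (x - y) =
     c * dtheta3 0 (2 * y) (2 * t) + d * dtheta2 0 (2 * y) (2 * t)) ->
  f x * f2 x - f1 x * f1 x = 2 * (c * dtheta3 2 0 (2 * t) + d * dtheta2 2 0 (2 * t)).
Proof.
  intros Ht Hf Hf1 Hprod.
  assert (H1 : forall y, f1 (x + y) * f (x - y) - f (x + y) * f1 (x - y) =
            c * (2 * dtheta3 1 (2 * y) (2 * t)) + d * (2 * dtheta2 1 (2 * y) (2 * t))).
  { intros y; apply (cder_unique (fun y => f (x + y) * f (x - y)) y).
    - exact (cder_product_shift f f f1 f1 x y Hf Hf).
    - eapply cder_ext; [intros w; symmetry; apply Hprod|].
      apply cder_plus; apply cder_scal; [now apply dtheta3_cder_double|now apply dtheta2_cder_double]. }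
  pose proof (cder_minus _ _ _ _ _ (cder_product_shift f1 f f2 f1 x 0 Hf1 Hf)
    (cder_product_shift f f1 f1 f2 x 0 Hf Hf1)) as H2.
  assert (H3 : cder (fun y => f1 (x + y) * f (x - y) - f (x + y) * f1 (x - y)) 0
     (c * (2 * (2 * dtheta3 2 (2 * 0) (2 * t))) + d * (2 * (2 * dtheta2 2 (2 * 0) (2 * t))))).
  { eapply cder_ext; [intros w; symmetry; apply H1|].
    apply cder_plus; apply cder_scal, cder_scal;
      [now apply dtheta3_cder_double|now apply dtheta2_cder_double]. }
  pose proof (cder_unique _ _ _ _ H2 H3) as E.
  rewrite Cmult_0_r, Cplus_0_r in E; replace (x - 0) with x in E by ring.
  apply (Cmult_reg_l 2); [apply RtoC_neq; lra|].
  etransitivity; [|etransitivity; [exact E|]]; ring.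
Qed.

(** * Identities at a fixed parameter [t], with constants expressed by [al] and [be] *)

Section FixedTau.
Context (t : C) (Ht : (0 < Im t)%R).

Local Notation al := (dtheta3 0 0 (2 * t)).
Local Notation be := (dtheta2 0 0 (2 * t)).
Local Notation v2 := (dtheta2 0 0 t).
Local Notation v3 := (dtheta3 0 0 t).
Local Notation v4 := (dtheta4 0 0 t).
Local Notation L := (Lambda0 t).

Lemma vtheta_neq_0 : v2 <> 0 /\ v3 <> 0 /\ v4 <> 0.
Proof.
  pose proof (theta_product_neq_0 t Ht) as H; unfold theta_product in H.
  repeat split; intros E; apply H; rewrite E; ring.
Qed.

(** Together with [theta2_sqr] this relates the squares at [t] to [theta3] and [theta2] at [2 x] and
    [2 t], the functions in which second derivatives of products come out. *)
Lemma theta1_sqr (x : C) : dtheta1 0 x t * dtheta1 0 x t =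
  be * dtheta3 0 (2 * x) (2 * t) - al * dtheta2 0 (2 * x) (2 * t).
Proof.
  pose proof (theta11_product x 0 t Ht) as H.
  rewrite Cplus_0_r, Cmult_0_r in H; replace (x - 0) with x in H by ring.
  rewrite H; ring.
Qed.

Lemma theta2_sqr (x : C) : dtheta2 0 x t * dtheta2 0 x t =
  al * dtheta2 0 (2 * x) (2 * t) + be * dtheta3 0 (2 * x) (2 * t).
Proof.
  pose proof (theta22_product x 0 t Ht) as H.
  rewrite Cplus_0_r, Cmult_0_r in H; replace (x - 0) with x in H by ring.
  rewrite H; ring.
Qed.

Lemma vtheta2_sqr : v2 * v2 = 2 * al * be.
Proof. rewrite theta2_sqr, Cmult_0_r; ring. Qed.

Lemma vtheta3_sqr : v3 * v3 = al * al + be * be.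
Proof.
  pose proof (theta33_product 0 0 t Ht) as H.
  rewrite Cplus_0_r, Cmult_0_r in H; replace (0 - 0) with (RtoC 0) in H by ring; exact H.
Qed.

Lemma vtheta4_sqr : v4 * v4 = al * al - be * be.
Proof.
  pose proof (theta44_product 0 0 t Ht) as H.
  rewrite Cplus_0_r, Cmult_0_r in H; replace (0 - 0) with (RtoC 0) in H by ring; exact H.
Qed.

(** Jacobi's formula evaluates the constant of the Wronskian; the nonzero factor [v3 * v4] then
    cancels. *)
Lemma jacobi_wronskian12 (x : C) :
  dtheta1 1 x t * dtheta2 0 x t - dtheta1 0 x t * dtheta2 1 x t =
  Cpi * (v2 * v2) * (dtheta3 0 x t * dtheta4 0 x t).
Proof.
  destruct vtheta_neq_0 as [N2 [N3 N4]]; pose proof (wronskian12 x t Ht) as H.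
  rewrite jacobi_derivative_formula in H by auto; unfold theta_product in H.
  apply (Cmult_reg_l (v3 * v4)); [now apply Cmult_neq_0|].
  rewrite (Cmult_comm (v3 * v4)), H; ring.
Qed.

Lemma jacobi_wronskian13 (x : C) :
  dtheta1 1 x t * dtheta3 0 x t - dtheta1 0 x t * dtheta3 1 x t =
  Cpi * (v3 * v3) * (dtheta2 0 x t * dtheta4 0 x t).
Proof.
  destruct vtheta_neq_0 as [N2 [N3 N4]]; pose proof (wronskian13 x t Ht) as H.
  rewrite jacobi_derivative_formula in H by auto; unfold theta_product in H.
  apply (Cmult_reg_l (v2 * v4)); [now apply Cmult_neq_0|].
  rewrite (Cmult_comm (v2 * v4)), H; ring.
Qed.

Lemma jacobi_wronskian14 (x : C) :
  dtheta1 1 x t * dtheta4 0 x t - dtheta1 0 x t * dtheta4 1 x t =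
  Cpi * (v4 * v4) * (dtheta2 0 x t * dtheta3 0 x t).
Proof.
  destruct vtheta_neq_0 as [N2 [N3 N4]]; pose proof (wronskian14 x t Ht) as H.
  rewrite jacobi_derivative_formula in H by auto; unfold theta_product in H.
  apply (Cmult_reg_l (v2 * v3)); [now apply Cmult_neq_0|].
  rewrite (Cmult_comm (v2 * v3)), H; ring.
Qed.

Lemma wronskian12_derivative (x : C) :
  dtheta1 2 x t * dtheta2 0 x t - dtheta1 0 x t * dtheta2 2 x t =
  Cpi * (v2 * v2) * (dtheta3 1 x t * dtheta4 0 x t + dtheta3 0 x t * dtheta4 1 x t).
Proof.
  apply (cder_unique (fun w => dtheta1 1 w t * dtheta2 0 w t - dtheta1 0 w t * dtheta2 1 w t) x).
  - eapply cder_eq; [|exact (cder_minus _ _ _ _ _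
      (cder_mult _ _ _ _ _ (dtheta1_cder 1 x t Ht) (dtheta2_cder 0 x t Ht))
      (cder_mult _ _ _ _ _ (dtheta1_cder 0 x t Ht) (dtheta2_cder 1 x t Ht)))]; simpl; ring.
  - eapply cder_ext; [intros w; symmetry; apply jacobi_wronskian12|].
    exact (cder_scal _ _ _ _
      (cder_mult _ _ _ _ _ (dtheta3_cder 0 x t Ht) (dtheta4_cder 0 x t Ht))).
Qed.

Lemma wronskian13_derivative (x : C) :
  dtheta1 2 x t * dtheta3 0 x t - dtheta1 0 x t * dtheta3 2 x t =
  Cpi * (v3 * v3) * (dtheta2 1 x t * dtheta4 0 x t + dtheta2 0 x t * dtheta4 1 x t).
Proof.
  apply (cder_unique (fun w => dtheta1 1 w t * dtheta3 0 w t - dtheta1 0 w t * dtheta3 1 w t) x).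
  - eapply cder_eq; [|exact (cder_minus _ _ _ _ _
      (cder_mult _ _ _ _ _ (dtheta1_cder 1 x t Ht) (dtheta3_cder 0 x t Ht))
      (cder_mult _ _ _ _ _ (dtheta1_cder 0 x t Ht) (dtheta3_cder 1 x t Ht)))]; simpl; ring.
  - eapply cder_ext; [intros w; symmetry; apply jacobi_wronskian13|].
    exact (cder_scal _ _ _ _
      (cder_mult _ _ _ _ _ (dtheta2_cder 0 x t Ht) (dtheta4_cder 0 x t Ht))).
Qed.

Lemma wronskian14_derivative (x : C) :
  dtheta1 2 x t * dtheta4 0 x t - dtheta1 0 x t * dtheta4 2 x t =
  Cpi * (v4 * v4) * (dtheta2 1 x t * dtheta3 0 x t + dtheta2 0 x t * dtheta3 1 x t).
Proof.
  apply (cder_unique (fun w => dtheta1 1 w t * dtheta4 0 w t - dtheta1 0 w t * dtheta4 1 w t) x).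
  - eapply cder_eq; [|exact (cder_minus _ _ _ _ _
      (cder_mult _ _ _ _ _ (dtheta1_cder 1 x t Ht) (dtheta4_cder 0 x t Ht))
      (cder_mult _ _ _ _ _ (dtheta1_cder 0 x t Ht) (dtheta4_cder 1 x t Ht)))]; simpl; ring.
  - eapply cder_ext; [intros w; symmetry; apply jacobi_wronskian14|].
    exact (cder_scal _ _ _ _
      (cder_mult _ _ _ _ _ (dtheta2_cder 0 x t Ht) (dtheta3_cder 0 x t Ht))).
Qed.

(* Logarithmically: [theta1''' / theta1' = v2'' / v2 + v3'' / v3 + v4'' / v4] at [0]. *)
Lemma vtheta_second_derivatives :
  dtheta1 3 0 t * v2 - dtheta1 1 0 t * dtheta2 2 0 t =
  Cpi * (v2 * v2) * (dtheta3 2 0 t * v4 + v3 * dtheta4 2 0 t).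
Proof.
  apply (cder_unique (fun w => dtheta1 2 w t * dtheta2 0 w t - dtheta1 0 w t * dtheta2 2 w t) 0).
  - eapply cder_eq; [|exact (cder_minus _ _ _ _ _
      (cder_mult _ _ _ _ _ (dtheta1_cder 2 0 t Ht) (dtheta2_cder 0 0 t Ht))
      (cder_mult _ _ _ _ _ (dtheta1_cder 0 0 t Ht) (dtheta2_cder 2 0 t Ht)))].
    simpl; rewrite (dtheta1_at_0 0), (dtheta1_at_0 1) by auto; ring.
  - eapply cder_ext; [intros w; symmetry; apply wronskian12_derivative|].
    eapply cder_eq; [|exact (cder_scal _ _ _ _ (cder_plus _ _ _ _ _
      (cder_mult _ _ _ _ _ (dtheta3_cder 1 0 t Ht) (dtheta4_cder 0 0 t Ht))
      (cder_mult _ _ _ _ _ (dtheta3_cder 0 0 t Ht) (dtheta4_cder 1 0 t Ht))))].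
    simpl; rewrite dtheta3_1_at_0, dtheta4_1_at_0 by auto; ring.
Qed.

Lemma half_constants_neq_0 : al <> 0 /\ be <> 0 /\ al * al * al * al - be * be * be * be <> 0.
Proof.
  destruct vtheta_neq_0 as [N2 [N3 N4]].
  repeat split; intros E.
  - apply (Cmult_neq_0 _ _ N2 N2); rewrite vtheta2_sqr, E; ring.
  - apply (Cmult_neq_0 _ _ N2 N2); rewrite vtheta2_sqr, E; ring.
  - apply (Cmult_neq_0 _ _ (Cmult_neq_0 _ _ N3 N3) (Cmult_neq_0 _ _ N4 N4)).
    rewrite vtheta3_sqr, vtheta4_sqr; etransitivity; [|exact E]; ring.
Qed.

Lemma Lambda0_eq : L = eta t + Cpi * Cpi / 6 * (al * al * al * al + be * be * be * be).
Proof.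
  unfold Lambda0, vtheta3, vtheta4; rewrite theta3_eq, theta4_eq by auto.
  replace (v3 ^ 4) with ((v3 * v3) * (v3 * v3)) by (simpl; ring).
  replace (v4 ^ 4) with ((v4 * v4) * (v4 * v4)) by (simpl; ring).
  rewrite vtheta3_sqr, vtheta4_sqr; field; split; apply RtoC_neq; lra.
Qed.

(** The only place where [eta] meets the theta constants: two linear equations for two unknowns,
    solved by elimination. *)
Lemma half_constants_second_derivatives :
  4 * dtheta3 2 0 (2 * t) =
    al * (- 8 * L + 2 * Cpi * Cpi * (al * al * al * al - be * be * be * be)) /\
  4 * dtheta2 2 0 (2 * t) =
    be * (- 8 * L - 2 * Cpi * Cpi * (al * al * al * al - be * be * be * be)).
Proof.
  destruct half_constants_neq_0 as [Na [Nb Nd]]; destruct vtheta_neq_0 as [N2 [N3 N4]].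
  (* At [x = 0] the four product formulas for squares express [- theta1'^2] and each
     [v_k * theta_k''] linearly in the unknowns. *)
  assert (E1 : - (dtheta1 1 0 t * dtheta1 1 0 t) = 2 * (- be * dtheta3 2 0 (2 * t) + al * dtheta2 2 0 (2 * t))).
  { rewrite <- (second_derivative_of_product (fun w => dtheta1 0 w t) (fun w => dtheta1 1 w t)
      (fun w => dtheta1 2 w t) _ _ 0 t Ht).
    - rewrite (dtheta1_at_0 0) by auto; ring.
    - intros w; now apply dtheta1_cder.
    - intros w; now apply dtheta1_cder.
    - intros y; rewrite theta11_product, Cmult_0_r by auto; ring. }
  assert (E2 : v2 * dtheta2 2 0 t = 2 * (be * dtheta3 2 0 (2 * t) + al * dtheta2 2 0 (2 * t))).
  { rewrite <- (second_derivative_of_product (fun w => dtheta2 0 w t) (fun w => dtheta2 1 w t)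
      (fun w => dtheta2 2 w t) _ _ 0 t Ht).
    - rewrite dtheta2_1_at_0 by auto; ring.
    - intros w; now apply dtheta2_cder.
    - intros w; now apply dtheta2_cder.
    - intros y; rewrite theta22_product, Cmult_0_r by auto; ring. }
  assert (E3 : v3 * dtheta3 2 0 t = 2 * (al * dtheta3 2 0 (2 * t) + be * dtheta2 2 0 (2 * t))).
  { rewrite <- (second_derivative_of_product (fun w => dtheta3 0 w t) (fun w => dtheta3 1 w t)
      (fun w => dtheta3 2 w t) _ _ 0 t Ht).
    - rewrite dtheta3_1_at_0 by auto; ring.
    - intros w; now apply dtheta3_cder.
    - intros w; now apply dtheta3_cder.
    - intros y; rewrite theta33_product, Cmult_0_r by auto; ring. }
  assert (E4 : v4 * dtheta4 2 0 t = 2 * (al * dtheta3 2 0 (2 * t) + - be * dtheta2 2 0 (2 * t))).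
  { rewrite <- (second_derivative_of_product (fun w => dtheta4 0 w t) (fun w => dtheta4 1 w t)
      (fun w => dtheta4 2 w t) _ _ 0 t Ht).
    - rewrite dtheta4_1_at_0 by auto; ring.
    - intros w; now apply dtheta4_cder.
    - intros w; now apply dtheta4_cder.
    - intros y; rewrite theta44_product, Cmult_0_r by auto; ring. }
  pose proof vtheta_second_derivatives as E5.
  rewrite theta1'''_eta, jacobi_derivative_formula in E5 by auto.
  rewrite jacobi_derivative_formula in E1 by auto.
  unfold theta_product in E1, E5.
  pose proof vtheta2_sqr as S2; pose proof vtheta3_sqr as S3; pose proof vtheta4_sqr as S4.
  pose proof Lambda0_eq as EL.
  set (a2 := dtheta3 2 0 (2 * t)) in *; set (b2 := dtheta2 2 0 (2 * t)) in *.
  pose proof Cpi_neq_0 as Npi.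
  assert (N : forall r : R, r <> 0%R -> RtoC r <> 0) by apply RtoC_neq.
  assert (F1 : - (Cpi * Cpi * ((v2 * v2) * (v3 * v3) * (v4 * v4))) = 2 * (- be * a2 + al * b2))
    by (rewrite <- E1; ring).
  (* Multiplying by [v3 * v4] leaves only the squares [v_k^2] and the products [v_k * theta_k''],
     all of them polynomial in [al], [be] and the unknowns. *)
  assert (F5 : - 12 * eta t * ((v2 * v2) * (v3 * v3) * (v4 * v4)) =
     (v2 * dtheta2 2 0 t) * ((v3 * v3) * (v4 * v4))
     + (v2 * v2) * ((v3 * dtheta3 2 0 t) * (v4 * v4) + (v4 * dtheta4 2 0 t) * (v3 * v3))).
  { apply (Cmult_reg_l Cpi); auto.
    transitivity ((- 12 * eta t * (Cpi * (v2 * v3 * v4)) * v2 - Cpi * (v2 * v3 * v4) * dtheta2 2 0 t) * (v3 * v4)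
        + Cpi * v2 * dtheta2 2 0 t * ((v3 * v3) * (v4 * v4))); [ring|].
    rewrite E5; ring. }
  rewrite E2, E3, E4, S2, S3, S4 in F5; rewrite S2, S3, S4 in F1.
  set (d := al * al * al * al - be * be * be * be) in *.
  assert (B2 : b2 = be * (a2 / al) - Cpi * Cpi * be * d).
  { apply (Cmult_reg_l (2 * al)); [apply Cmult_neq_0; auto; apply N; lra|].
    transitivity (2 * (- be * a2 + al * b2) + 2 * be * a2); [ring|].
    rewrite <- F1; unfold d; field; auto. }
  (* After the elimination of [b2], the coefficient of [a2] in [F5] is [12 * be * d], which is
     nonzero. *)
  assert (A2 : a2 = al * (- 8 * L + 2 * Cpi * Cpi * d) / 4).
  { apply (Cmult_reg_l (12 * be * d)).
    - apply Cmult_neq_0; auto; apply Cmult_neq_0; auto; apply N; lra.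
    - rewrite EL; rewrite B2 in F5.
      assert (F5' : - 24 * eta t * be * al * d =
        2 * (be * a2 + al * (be * (a2 / al) - Cpi * Cpi * be * d)) * d +
        2 * al * be * (2 * (al * a2 + be * (be * (a2 / al) - Cpi * Cpi * be * d)) * (al * al - be * be) +
         2 * (al * a2 + - be * (be * (a2 / al) - Cpi * Cpi * be * d)) * (al * al + be * be))).
      { etransitivity; [|etransitivity; [exact F5|]]; unfold d; ring. }
      transitivity (2 * (be * a2 + al * (be * (a2 / al) - Cpi * Cpi * be * d)) * d +
        2 * al * be * (2 * (al * a2 + be * (be * (a2 / al) - Cpi * Cpi * be * d)) * (al * al - be * be) +
         2 * (al * a2 + - be * (be * (a2 / al) - Cpi * Cpi * be * d)) * (al * al + be * be))
         + (2 * Cpi * Cpi * al * be * d * d - 8 * Cpi * Cpi * al * be * (be * be * be * be) * d)).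
      + unfold d; field; auto.
      + rewrite <- F5'; unfold d; field; repeat split; apply N; lra. }
  split.
  - rewrite A2; field; apply N; lra.
  - rewrite B2, A2; field; repeat split; auto; apply N; lra.
Qed.

(** In the values of [half_constants_second_derivatives] the [L] parts have equal signs and the
    [PI^2] parts opposite ones. The former therefore recombine into [theta1^2], the latter into
    [theta2^2]; for [theta2] the roles are exchanged. *)
Lemma theta1_log_second_derivative (x : C) :
  dtheta1 0 x t * dtheta1 2 x t - dtheta1 1 x t * dtheta1 1 x t =
  - (Cpi * Cpi * (v3 * v3) * (v4 * v4)) * (dtheta2 0 x t * dtheta2 0 x t)
  - 4 * L * (dtheta1 0 x t * dtheta1 0 x t).
Proof.
  destruct half_constants_second_derivatives as [Ha Hb].
  rewrite (second_derivative_of_product (fun w => dtheta1 0 w t) (fun w => dtheta1 1 w t)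
      (fun w => dtheta1 2 w t) (- dtheta2 0 (2 * x) (2 * t)) (dtheta3 0 (2 * x) (2 * t)) x t Ht).
  - rewrite theta1_sqr, theta2_sqr, vtheta3_sqr, vtheta4_sqr.
    apply (Cmult_reg_l 2); [apply RtoC_neq; lra|].
    transitivity (- dtheta2 0 (2 * x) (2 * t) * (4 * dtheta3 2 0 (2 * t)) +
                  dtheta3 0 (2 * x) (2 * t) * (4 * dtheta2 2 0 (2 * t))); [ring|].
    rewrite Ha, Hb; ring.
  - intros w; now apply dtheta1_cder.
  - intros w; now apply dtheta1_cder.
  - intros y; rewrite theta11_product by auto; ring.
Qed.

Lemma theta2_log_second_derivative (x : C) :
  dtheta2 0 x t * dtheta2 2 x t - dtheta2 1 x t * dtheta2 1 x t =
  - (Cpi * Cpi * (v3 * v3) * (v4 * v4)) * (dtheta1 0 x t * dtheta1 0 x t)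
  - 4 * L * (dtheta2 0 x t * dtheta2 0 x t).
Proof.
  destruct half_constants_second_derivatives as [Ha Hb].
  rewrite (second_derivative_of_product (fun w => dtheta2 0 w t) (fun w => dtheta2 1 w t)
      (fun w => dtheta2 2 w t) (dtheta2 0 (2 * x) (2 * t)) (dtheta3 0 (2 * x) (2 * t)) x t Ht).
  - rewrite theta1_sqr, theta2_sqr, vtheta3_sqr, vtheta4_sqr.
    apply (Cmult_reg_l 2); [apply RtoC_neq; lra|].
    transitivity (dtheta2 0 (2 * x) (2 * t) * (4 * dtheta3 2 0 (2 * t)) +
                  dtheta3 0 (2 * x) (2 * t) * (4 * dtheta2 2 0 (2 * t))); [ring|].
    rewrite Ha, Hb; ring.
  - intros w; now apply dtheta2_cder.
  - intros w; now apply dtheta2_cder.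
  - intros y; rewrite theta22_product by auto; ring.
Qed.

(** By the heat equation the [t]-derivative of [theta1'] is governed by the third [z]-derivative,
    obtained here by differentiating once more. *)
Lemma theta1_third_derivative (x : C) :
  dtheta1 0 x t * dtheta1 3 x t - dtheta1 1 x t * dtheta1 2 x t =
  - 2 * (Cpi * Cpi * (v3 * v3) * (v4 * v4)) * (dtheta2 0 x t * dtheta2 1 x t)
  - 8 * L * (dtheta1 0 x t * dtheta1 1 x t).
Proof.
  apply (cder_unique (fun w => dtheta1 0 w t * dtheta1 2 w t - dtheta1 1 w t * dtheta1 1 w t) x).
  - eapply cder_eq; [|exact (cder_minus _ _ _ _ _
      (cder_mult _ _ _ _ _ (dtheta1_cder 0 x t Ht) (dtheta1_cder 2 x t Ht))
      (cder_mult _ _ _ _ _ (dtheta1_cder 1 x t Ht) (dtheta1_cder 1 x t Ht)))]; simpl; ring.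
  - eapply cder_ext; [intros w; symmetry; apply theta1_log_second_derivative|].
    eapply cder_eq; [|exact (cder_minus _ _ _ _ _
      (cder_scal _ _ _ _ (cder_mult _ _ _ _ _ (dtheta2_cder 0 x t Ht) (dtheta2_cder 0 x t Ht)))
      (cder_scal _ _ _ _ (cder_mult _ _ _ _ _ (dtheta1_cder 0 x t Ht) (dtheta1_cder 0 x t Ht))))]; simpl; ring.
Qed.

End FixedTau.

Lemma Im_near_pos (tau h : C) : (Cmod h < Im tau)%R -> (0 < Im (tau + h))%R.
Proof.
  intros H; pose proof (im_le_Cmod h) as Hh; destruct tau as [a b], h as [c d]; simpl in *.
  pose proof (Rle_abs (- d)) as Hd; rewrite Rabs_Ropp in Hd; lra.
Qed.

Lemma theta1'_eq (z s : C) : (0 < Im s)%R -> theta1' z s = dtheta1 1 z s.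
Proof.
  intros Hs; apply CDerive_cder.
  apply cder_ext with (fun w => dtheta1 0 w s); [intros w; now rewrite theta1_eq|].
  now apply dtheta1_cder.
Qed.

(** The given series are identified with [gtheta] only on the upper half-plane, so the derivative is
    transported through a disc of radius [Im tau]. *)
Lemma is_derive_theta (f g : C -> C) (tau l l' : C) : (0 < Im tau)%R ->
  (forall s, (0 < Im s)%R -> f s = g s) -> l' = l -> cder g tau l' ->
  @is_derive C_AbsRing C_NormedModule f tau l.
Proof.
  intros Ht Hfg <- H; apply cder_is_derive; revert H; apply cder_local with (Im tau); auto.
  intros h Hh; symmetry; apply Hfg; now apply Im_near_pos.
Qed.

Theorem theorem4p2 (tau z : C) (Htau : (0 < Im tau)%R)
  (Hnz : theta1 z tau * theta2 z tau <> 0) :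
  let t1 := theta1 z tau in
  let t2 := theta2 z tau in
  let t3 := theta3 z tau in
  let t4 := theta4 z tau in
  let t1' := theta1' z tau in
  let v2 := vtheta2 tau in
  let v3 := vtheta3 tau in
  let v4 := vtheta4 tau in
  let L0 := Lambda0 tau in
  @is_derive C_AbsRing C_NormedModule (fun s => theta1 z s) tau
    (- Ci / (4 * Cpi) * (t1' ^ 2 / t1)
     + Ci / 4 * Cpi * v3 ^ 2 * v4 ^ 2 * (t2 ^ 2 / t1)
     + Ci / Cpi * L0 * t1)
  /\ @is_derive C_AbsRing C_NormedModule (fun s => theta2 z s) tau
    (- Ci / (4 * Cpi) * (t1' / t1 - Cpi * v2 ^ 2 * (t3 * t4 / (t1 * t2))) ^ 2 * t2
     + Ci / 4 * Cpi * v3 ^ 2 * v4 ^ 2 * (t1 ^ 2 / t2)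
     + Ci / Cpi * L0 * t2)
  /\ @is_derive C_AbsRing C_NormedModule (fun s => theta3 z s) tau
    (- Ci / (4 * Cpi) * (t1' ^ 2 / t1 ^ 2) * t3
     + Ci / 2 * v3 ^ 2 * t1' * (t2 * t4 / t1 ^ 2)
     - Ci / 4 * Cpi * v2 ^ 2 * v3 ^ 2 * (t4 ^ 2 / t1 ^ 2) * t3
     + Ci / Cpi * L0 * t3)
  /\ @is_derive C_AbsRing C_NormedModule (fun s => theta4 z s) tau
    (- Ci / (4 * Cpi) * (t1' ^ 2 / t1 ^ 2) * t4
     + Ci / 2 * v4 ^ 2 * t1' * (t2 * t3 / t1 ^ 2)
     - Ci / 4 * Cpi * v2 ^ 2 * v4 ^ 2 * (t3 ^ 2 / t1 ^ 2) * t4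
     + Ci / Cpi * L0 * t4)
  /\ @is_derive C_AbsRing C_NormedModule (fun s => theta1' z s) tau
    (- Ci / (4 * Cpi) * (t1' ^ 3 / t1 ^ 2)
     + 3 * Ci / Cpi * (Cpi ^ 2 / 4 * v3 ^ 2 * v4 ^ 2 * (t2 ^ 2 / t1 ^ 2) + L0) * t1'
     - Ci / 2 * Cpi ^ 2 * v2 ^ 2 * v3 ^ 2 * v4 ^ 2 * (t2 * t3 * t4 / t1 ^ 2)).
Proof.
  intros t1 t2 t3 t4 t1' v2 v3 v4 L0.
  assert (N1 : t1 <> 0) by (intros E; apply Hnz; fold t1; rewrite E; ring).
  assert (N2 : t2 <> 0) by (intros E; apply Hnz; fold t2; rewrite E; ring).
  pose proof Cpi_neq_0 as Npi.
  assert (N4 : RtoC 4 <> 0) by (apply RtoC_neq; lra).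
  assert (N22 : RtoC 2 <> 0) by (apply RtoC_neq; lra).
  pose proof (jacobi_wronskian12 tau Htau z) as W2.
  pose proof (jacobi_wronskian13 tau Htau z) as W3.
  pose proof (jacobi_wronskian14 tau Htau z) as W4.
  pose proof (wronskian13_derivative tau Htau z) as V3.
  pose proof (wronskian14_derivative tau Htau z) as V4.
  pose proof (theta1_log_second_derivative tau Htau z) as Q1.
  pose proof (theta2_log_second_derivative tau Htau z) as Q2.
  pose proof (theta1_third_derivative tau Htau z) as Q3.
  pose proof (theta1_eq z tau Htau) as E1; pose proof (theta2_eq z tau Htau) as E2.
  pose proof (theta3_eq z tau Htau) as E3; pose proof (theta4_eq z tau Htau) as E4.
  pose proof (theta2_eq 0 tau Htau) as F2; pose proof (theta3_eq 0 tau Htau) as F3.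
  pose proof (theta4_eq 0 tau Htau) as F4; pose proof (theta1'_eq z tau Htau) as E1'.
  fold t1 in E1; fold t2 in E2; fold t3 in E3; fold t4 in E4; fold t1' in E1'.
  fold (vtheta2 tau) v2 in F2; fold (vtheta3 tau) v3 in F3; fold (vtheta4 tau) v4 in F4.
  revert W2 W3 W4 V3 V4 Q1 Q2 Q3; rewrite <- E1, <- E2, <- E3, <- E4, <- E1', <- F2, <- F3, <- F4.
  intros W2 W3 W4 V3 V4 Q1 Q2 Q3.
  fold L0 in Q1, Q2, Q3.
  (* All [z]-derivatives are now solved for in terms of [t1, t2, t3, t4, t1'] and the constants;
     first derivatives come from the Wronskians. *)
  assert (D2 : dtheta2 1 z tau = (t1' * t2 - Cpi * (v2 * v2) * (t3 * t4)) / t1)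
    by (rewrite <- W2; field; auto).
  assert (D3 : dtheta3 1 z tau = (t1' * t3 - Cpi * (v3 * v3) * (t2 * t4)) / t1)
    by (rewrite <- W3; field; auto).
  assert (D4 : dtheta4 1 z tau = (t1' * t4 - Cpi * (v4 * v4) * (t2 * t3)) / t1)
    by (rewrite <- W4; field; auto).
  assert (H1 : dtheta1 2 z tau = (t1' * t1' - Cpi * Cpi * (v3 * v3) * (v4 * v4) * (t2 * t2)
                                  - 4 * L0 * (t1 * t1)) / t1).
  { apply (Cmult_reg_l t1); auto.
    transitivity (t1 * dtheta1 2 z tau - t1' * t1' + t1' * t1'); [ring|rewrite Q1; field; auto]. }
  (* Taking the second logarithmic derivative of [theta2] itself, instead of the derivative of its
     Wronskian, yields the form of the claim with [t1^2 / t2]. *)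
  assert (H2 : dtheta2 2 z tau = (dtheta2 1 z tau * dtheta2 1 z tau
       - Cpi * Cpi * (v3 * v3) * (v4 * v4) * (t1 * t1) - 4 * L0 * (t2 * t2)) / t2).
  { apply (Cmult_reg_l t2); auto.
    transitivity (t2 * dtheta2 2 z tau - dtheta2 1 z tau * dtheta2 1 z tau
      + dtheta2 1 z tau * dtheta2 1 z tau); [ring|rewrite Q2; field; auto]. }
  assert (H3 : dtheta3 2 z tau = (dtheta1 2 z tau * t3 -
     Cpi * (v3 * v3) * (dtheta2 1 z tau * t4 + t2 * dtheta4 1 z tau)) / t1)
    by (rewrite <- V3; field; auto).
  assert (H4 : dtheta4 2 z tau = (dtheta1 2 z tau * t4 -
     Cpi * (v4 * v4) * (dtheta2 1 z tau * t3 + t2 * dtheta3 1 z tau)) / t1)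
    by (rewrite <- V4; field; auto).
  assert (H5 : dtheta1 3 z tau = (t1' * dtheta1 2 z tau
     - 2 * (Cpi * Cpi * (v3 * v3) * (v4 * v4)) * (t2 * dtheta2 1 z tau) - 8 * L0 * (t1 * t1')) / t1).
  { apply (Cmult_reg_l t1); auto.
    transitivity (t1 * dtheta1 3 z tau - t1' * dtheta1 2 z tau + t1' * dtheta1 2 z tau);
      [ring|rewrite Q3; field; auto]. }
  (* Each [tau]-derivative is [- i / (4 PI)] times the [z]-derivative two orders higher. After
     substitution the five claims are rational identities in which the thetas may be treated as
     independent variables. *)
  split; [|split; [|split; [|split]]].
  - eapply is_derive_theta; [exact Htau|intros s Hs; exact (theta1_eq z s Hs)| |apply dtheta1_cder_t; exact Htau].
    rewrite H1; field; auto.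
  - eapply is_derive_theta; [exact Htau|intros s Hs; exact (theta2_eq z s Hs)| |apply dtheta2_cder_t; exact Htau].
    rewrite H2, D2; field; auto.
  - eapply is_derive_theta; [exact Htau|intros s Hs; exact (theta3_eq z s Hs)| |apply dtheta3_cder_t; exact Htau].
    rewrite H3, H1, D2, D4; field; auto.
  - eapply is_derive_theta; [exact Htau|intros s Hs; exact (theta4_eq z s Hs)| |apply dtheta4_cder_t; exact Htau].
    rewrite H4, H1, D2, D3; field; auto.
  - eapply is_derive_theta; [exact Htau|intros s Hs; exact (theta1'_eq z s Hs)| |apply dtheta1_cder_t; exact Htau].
    rewrite H5, H1, D2; field; auto.
Qed.
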